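(* Let $K$ be a $p$-adic field with ring of integers $\mathcal O_K$, maximal ideal $\mathcal M_K$ and residue field $\mathbb F_q$, and let $\overline K$ be an algebraic closure of $K$. Let $f(x,y)\in\mathcal O_K[[x,y]]$ with $f(0,0)=0$ admit the decomposition $$f(x,y)=cx^{\alpha}y^{\beta}\prod_{i=1}^k\prod_{\ell=1}^{r_i}\prod_{\tau=1}^{s_{i\ell}}f_{i\ell\tau}(x,y),\qquad f_{i\ell\tau}(x,y)=(y^{a_i}+\xi_{i\ell}x^{b_i})^{A_{i\ell\tau}}+(\text{higher terms}),$$ with $c\in\mathcal O_K\setminus\mathcal M_K$, $\alpha,\beta\in\mathbb N$, $f_{i\ell\tau}$ monic, non-smooth and irreducible in $\overline K[[x]][y]$, $a_i,b_i\ge2$ coprime, $A_{i\ell\tau}\ge1$, $\xi_{i\ell}\in\overline K^*$, and $\xi_{i\ell}\ne\xi_{i\ell'}$ for $\ell\neq\ell'$. Assume in addition that for all $1\le i\le k$ and $1\le\ell\le r_i$, $\xi_{i\ell}\in\mathcal O_K\setminus\mathcal M_K$ and $f_{i\ell}:=\prod_\tau f_{i\ell\tau}$ is monic in $K[[x]][y]$. Put $P_i=(a_i,b_i)^t$, numbered so that $P_1<\dots<P_k$, and let $\Phi$ be a toric modification admissible for $f$, associated to a regular simplicial cone subdivision $T_1<\dots<T_m$ with $\{P_1,\dots,P_k\}\subseteq\{T_1,\dots,T_m\}$. Then $$Z_0(f;s)=\frac{q-1}{q^2}\left(\sum_{j=1}^m\frac{\#\widetilde{E}(T_j)^{\circ}}{q^{N_js+\nu_j}-1}+\sum_{j=0}^m\frac{q-1}{(q^{N_js+\nu_j}-1)(q^{N_{j+1}s+\nu_{j+1}}-1)}\right)+\sum_{i=1}^k\sum_{\ell=1}^{r_i}\int_{\mathcal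 M_K^{\oplus 2}}|f'[i,\ell](u,v)|^s\,|u^{\nu(P_i)-1}du\wedge dv|,$$ with the convention that in the second sum the term $j=0$ (resp. $j=m$) is $0$ if $\alpha=0$ (resp. $\beta=0$). Here $f'[i,\ell](u,v)$ is $\Phi^*f$ written in the Tschirnhausen coordinates $(u,v)$ at the point of $E(P_i)$ associated to $\ell$.
   Context: **Zeta function.** $\mathcal O_K=\{|\xi|\le1\}$, $\mathcal M_K=\{|\xi|<1\}$, with $|\cdot|$ normalized so that a uniformizer has absolute value $q^{-1}$. $|dx\wedge dy|$ is the Haar measure on $K^2$ giving $\mathcal O_K^2$ measure $1$. A series in $\mathcal O_K[[x,y]]$ converges on $\mathcal M_K^{\oplus2}=\mathcal M_K\times\mathcal M_K$. $Z_0(f;s)=\int_{\mathcal M_K^{\oplus 2}}|f(x,y)|^s|dx\wedge dy|$ for $\Re(s)>0$. $\mathbb N$ includes $0$. $\widetilde f$ is the reduction of $f$ modulo $\mathcal M_K$. **Higher terms.** In an initial expansion attached to $(a_i,b_i)$, give $x$ weight $a_i$ and $y$ weight $b_i$; ''higher terms'' means monomials of weighted degree strictly larger than that of the displayed leading form. **Toric modifications.** For primitive integral column vectors, $P<Q$ means $\det(P,Q)>0$. A simplicial cone subdivision is a sequence $T_1<\dots<T_m$ of primitive vectors $T_j=(c_j,d_j)^t$ with entries in $\mathbb N$. Put $T_0=(1,0)^t$, $T_{m+1}=(0,1)^t$, $\sigma_j=(T_j,T_{j+1})$ for $0\le j\le m$; it is regular if $\det\sigma_j=1$ for all $j$. For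 an integral matrix $\sigma=\begin{pmatrix}a&b\\c&d\end{pmatrix}$ put $\Phi_\sigma(x,y)=(x^ay^b,x^cy^d)$. Take copies $K^2_{\sigma_j}$ of $K^2$ with coordinates $(x_j,y_j)$, glued by $(x_i,y_i)=\Phi_{\sigma_i^{-1}\sigma_j}(x_j,y_j)$ (the usual toric gluing); the resulting $K$-analytic surface is $X_\Sigma$, and $\Phi:X_\Sigma\to K^2$ is $\Phi_{\sigma_j}$ on $K^2_{\sigma_j}$. For $1\le j\le m$, the exceptional divisor $E(T_j)$ is $\{y_{j-1}=0\}$ in $K^2_{\sigma_{j-1}}$ and $\{x_j=0\}$ in $K^2_{\sigma_j}$; $E(T_0)=\{x_0=0\}$, $E(T_{m+1})=\{y_m=0\}$. The same construction over $\mathbb F_q$ gives $\widetilde\Phi:\widetilde X_\Sigma\to\mathbb F_q^2$ with divisors $\widetilde E(T_j)$. **Strata.** $\widetilde E'$ is the strict transform of $\widetilde f$ (closure of $\widetilde\Phi^{-1}(\widetilde f^{-1}(0)\setminus\{\mathbf 0\})$, understood algebraically: in each chart, the zero locus of $\widetilde\Phi^*\widetilde f$ divided by the maximal powers of the equations of $\widetilde E(T_1),\dots,\widetilde E(T_m)$; it contains $\widetilde E(T_0)$ if $\alpha>0$ and $\widetilde E(T_{m+1})$ if $\beta>0$). For $1\le j\le m$, $\widetilde E(T_j)^\circ=\widetilde E(T_j)\setminus\big(\bigcup_{1\le j'\le m,\,j'\ne j}\widetilde E(T_{j'})\cup\widetilde E'\big)$, and $\#$ counts $\mathbb F_q$-points.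 **Numerical data.** For $0\le j\le m+1$, $N_j=N(T_j)$ is the multiplicity of $\Phi^*f$ along $E(T_j)$ and $\nu_j-1=\nu(T_j)-1$ that of $\Phi^*(dx\wedge dy)$. Thus $\nu_j=c_j+d_j$, $N_0=\alpha$, $N_{m+1}=\beta$. $N(P_i),\nu(P_i)$ are the values at the index $j$ with $T_j=P_i$. **Tschirnhausen coordinates.** For $g\in\mathcal O_K[[x]][y]$ monic of degree $n$ in $y$ and $a\mid n$, the $n/a$-th Tschirnhausen approximate polynomial of $g$ is the monic polynomial $h\in\mathcal O_K[[x]][y]$ of degree $a$ in $y$ with $\deg_y(g-h^{n/a})<n-a$. Fix $1\le i\le k$, $1\le\ell\le r_i$, put $A_{i\ell}=\sum_\tau A_{i\ell\tau}$, and let $h_{i\ell}=y^{a_i}+\xi_{i\ell}x^{b_i}+(\text{higher terms})$ be the $A_{i\ell}$-th Tschirnhausen approximate polynomial of $f_{i\ell}$. Let $T_j=P_i$. On the chart $(K^2_{\sigma_j};x_j,y_j)$ one has $\Phi^*h_{i\ell}=x_j^{a_ib_i}y_j^{c_{j+1}b_i}(y_j+\xi_{i\ell}+x_jR'(x_j,y_j))$, and the Tschirnhausen coordinates at the point $(0,-\xi_{i\ell})$ of $E(P_i)$ are $$u=x_j,\qquad v=y_j^{c_{j+1}b_i}(y_j+\xi_{i\ell}+x_jR'(x_j,y_j)).$$ $f'[i,\ell](u,v)$ denotes $\Phi^*f$ expressed in $(u,v)$.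
   Formalization: For each i the reductions of the ξ_{iℓ} modulo the maximal ideal are assumed pairwise distinct, not only the ξ_{iℓ}; otherwise two of the integrals cover the same residue disc, as for f=(y²+x³)(y²+(1+π)x³), and the formula is false. *)

(* Defs.v *)
From HB Require Import structures.
From mathcomp Require Import all_boot all_order all_algebra.
From mathcomp Require Import all_classical all_reals all_analysis.
From mathcomp Require Import complex.

Set Implicit Arguments.
Unset Strict Implicit.
Unset Printing Implicit Defensive.

Import Order.TTheory GRing.Theory Num.Theory.
Import numFieldNormedType.Exports.

Local Open Scope classical_set_scope.
Local Open Scope ring_scope.
Local Open Scope complex_scope.

Record fps (A : Type) := Fps { coef_fps :> nat -> A }.

Lemma fpsP (A : Type) (F G : fps A) : F =1 G -> F = G.
Proof. by case: F G => [F] [G] /= /funext ->. Qed.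

HB.instance Definition _ (A : Type) := gen_eqMixin (fps A).
HB.instance Definition _ (A : Type) := gen_choiceMixin (fps A).

Section FpsRing.
Variable A : comNzRingType.
Implicit Types F G H : fps A.

Definition fps_zero : fps A := Fps (fun=> 0).
Definition fps_opp F : fps A := Fps (fun n => - F n).
Definition fps_add F G : fps A := Fps (fun n => F n + G n).
Definition fps_one : fps A := Fps (fun n => (n == 0)%:R).
Definition fps_mul F G : fps A := Fps (fun n => \sum_(i < n.+1) F i * G (n - i)%N).

Fact fps_addA : associative fps_add.
Proof. by move=> F G H; apply/fpsP => n /=; rewrite addrA. Qed.
Fact fps_addC : commutative fps_add.
Proof. by move=> F G; apply/fpsP => n /=; rewrite addrC. Qed.
Fact fps_add0 : left_id fps_zero fps_add.
Proof. by move=> F; apply/fpsP => n /=; rewrite add0r. Qed.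
Fact fps_addN : left_inverse fps_zero fps_opp fps_add.
Proof. by move=> F; apply/fpsP => n /=; rewrite addNr. Qed.

HB.instance Definition _ :=
  GRing.isZmodule.Build (fps A) fps_addA fps_addC fps_add0 fps_addN.

Let trunc N F : {poly A} := \poly_(i < N) F i.

Let fps_mul_trunc N F G n :
  (n < N)%N -> fps_mul F G n = (trunc N F * trunc N G)`_n.
Proof.
move=> nN; rewrite coefM; apply: eq_bigr => i _.
by rewrite !coef_poly (leq_ltn_trans _ nN) ?leq_ord// (leq_ltn_trans _ nN)// leq_subr.
Qed.

Fact fps_mulA : associative fps_mul.
Proof.
move=> F G H; apply/fpsP => n.
transitivity ((trunc n.+1 F * (trunc n.+1 G * trunc n.+1 H))`_n).
  rewrite coefM; apply: eq_bigr => i _; rewrite coef_poly ltn_ord.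
  by rewrite -(@fps_mul_trunc n.+1)// ltnS leq_subr.
rewrite mulrA coefM; apply: eq_bigr => i _; rewrite coef_poly ltnS leq_subr.
by rewrite -(@fps_mul_trunc n.+1).
Qed.
Fact fps_mulC : commutative fps_mul.
Proof.
by move=> F G; apply/fpsP => n; rewrite !(@fps_mul_trunc n.+1)// mulrC.
Qed.
Fact fps_mul1 : left_id fps_one fps_mul.
Proof.
move=> F; apply/fpsP => n /=; rewrite big_ord_recl /= mul1r subn0 big1 ?addr0//.
by move=> i _; rewrite mul0r.
Qed.
Fact fps_mulDl : left_distributive fps_mul fps_add.
Proof.
move=> F G H; apply/fpsP => n /=; rewrite -big_split /=.
by apply: eq_bigr => i _; rewrite mulrDl.
Qed.
Fact fps_one_neq0 : fps_one != 0.
Proof.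
apply/eqP => /(congr1 (fun F : fps A => F 0%N)) /= /eqP.
by rewrite oner_eq0.
Qed.

HB.instance Definition _ := GRing.Zmodule_isComNzRing.Build (fps A)
  fps_mulA fps_mulC fps_mul1 fps_mulDl fps_one_neq0.

Definition fps_monom (c : A) (m : nat) : fps A := Fps (fun n => c *+ (n == m)).

Definition fps_of_poly (p : {poly A}) : fps A := Fps (fun n => p`_n).

End FpsRing.

Definition map_fps (A B : Type) (g : A -> B) (F : fps A) : fps B :=
  Fps (fun n => g (F n)).

(* A[[x,y]] is fps (fps A) = A[[x]][[y]], which contains A[[x]][y] = {poly fps A}:
   the outer index is the exponent of y, the inner one that of x. *)
Notation fps2 A := (fps (fps A)).

Definition series2 (A : Type) (g : nat -> nat -> A) : fps2 A :=
  Fps (fun n => Fps (fun m => g m n)).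

Definition coef2 (A : Type) (F : fps2 A) (m n : nat) : A := (F n) m.

Definition monom2 (A : comNzRingType) (c : A) (m n : nat) : fps2 A :=
  fps_monom (fps_monom c m) n.

Definition map_fps2 (A B : Type) (g : A -> B) : fps2 A -> fps2 B :=
  map_fps (map_fps g).

Section Series2.
Variable A : comNzRingType.
Implicit Types F : fps2 A.

Definition derivx F : fps2 A := series2 (fun m n => coef2 F m.+1 n *+ m.+1).
Definition derivy F : fps2 A := series2 (fun m n => coef2 F m n.+1 *+ n.+1).

(* The multiplicities of F along {x = 0} and along {y = 0} (0 if F = 0). *)
Definition multx F : nat := xget 0%N [set N |
  (exists n, coef2 F N n <> 0) /\
  forall m n, (m < N)%N -> coef2 F m n = 0].
Definition multy F : nat := xget 0%N [set N |
  (exists m, coef2 F m N <> 0) /\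
  forall m n, (n < N)%N -> coef2 F m n = 0].

(* All monomials of F have weighted degree > d, for x of weight a and y of
   weight b. *)
Definition higher_terms (a b d : nat) F : Prop :=
  forall m n, coef2 F m n <> 0 -> (d < a * m + b * n)%N.

Definition non_smooth F : Prop :=
  [/\ coef2 F 0 0 = 0, coef2 F 1 0 = 0 & coef2 F 0 1 = 0].

End Series2.

Definition is_unit (A : comNzRingType) (g : A) : Prop := exists h, g * h = 1.

Definition irreducible_elt (A : comNzRingType) (g : A) : Prop :=
  [/\ g <> 0, ~ is_unit g &
      forall g1 g2, g = g1 * g2 -> is_unit g1 \/ is_unit g2].

Definition detv (P Q : nat * nat) : int :=
  P.1%:Z * Q.2%:Z - P.2%:Z * Q.1%:Z.

Definition vlt : rel (nat * nat) := fun P Q => 0 < detv P Q.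

Section Fan.
Variable T : seq (nat * nat).

(* T lists T_1, ..., T_m; ray j is T_j for 0 <= j <= m + 1, the last one being
   the default value of nth. *)
Definition ray (j : nat) : nat * nat := nth (0, 1)%N ((1, 0)%N :: T) j.

Definition cone (j : nat) : 'M[int]_2 := \matrix_(r < 2, e < 2)
  (let P := ray (j + e) in if r == 0 then P.1%:Z else P.2%:Z).

Definition regular_subdivision : Prop :=
  [/\ (0 < size T)%N,
      all (fun P => coprime P.1 P.2) T,
      sorted vlt T &
      forall j, (j <= size T)%N -> \det (cone j) = 1].

End Fan.

(* Phi_sigma for an integral, possibly negative, sigma is a rational map;
   [Phi_defined] is its domain of definition. *)
Definition Phi (F : fieldType) (sg : 'M[int]_2) (p : F * F) : F * F :=
  (p.1 ^ sg 0 0 * p.2 ^ sg 0 1, p.1 ^ sg 1 0 * p.2 ^ sg 1 1).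

Definition Phi_defined (F : fieldType) (sg : 'M[int]_2) (p : F * F) : bool :=
  [forall r : 'I_2, ((0 <= sg r 0) || (p.1 != 0)) &&
                    ((0 <= sg r 1) || (p.2 != 0))].

(* F(Phi_sigma(x, y)) as a formal series in (x, y), for sigma invertible with
   nonnegative entries (so that the sums have at most one term). *)
Definition pullback (A : comNzRingType) (sg : 'M[int]_2) (F : fps2 A) : fps2 A :=
  series2 (fun m n => \sum_(e \in [set e : nat * nat |
      e.1%:Z * sg 0 0 + e.2%:Z * sg 1 0 = m%:Z /\
      e.1%:Z * sg 0 1 + e.2%:Z * sg 1 1 = n%:Z]) coef2 F e.1 e.2).

(* Phi_sigma^* (dx /\ dy) = jacobian sigma * (dx_j /\ dy_j) *)
Definition jacobian (A : comNzRingType) (sg : 'M[int]_2) : fps2 A :=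
  let X := pullback sg (monom2 (1 : A) 1 0) in
  let Y := pullback sg (monom2 (1 : A) 0 1) in
  derivx X * derivy Y - derivy X * derivx Y.

(* The multiplicity along E(T_j), 0 <= j <= m + 1, of an object given by the
   series G (sigma_i) in the chart sigma_i. *)
Definition mult_along (A : comNzRingType) (T : seq (nat * nat))
    (G : 'M[int]_2 -> fps2 A) (j : nat) : nat :=
  if (j <= size T)%N then multx (G (cone T j)) else multy (G (cone T (size T))).

Definition Nmult (A : comNzRingType) T (f : fps2 A) (j : nat) : nat :=
  mult_along T (fun sg => pullback sg f) j.

Definition numult (A : comNzRingType) T (j : nat) : nat :=
  (mult_along T (@jacobian A) j).+1.

(* The F-points of the toric surface X_Sigma over a finite field F: the points
   of the charts sigma_0, ..., sigma_m modulo the relation [glued]. *)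
Section Strata.
Variables (F : finFieldType) (T : seq (nat * nat)) (f : fps2 F).

Definition chart_point : finType := ('I_(size T).+1 * (F * F))%type.

Definition glued : rel chart_point := fun p p' =>
  let sg := invmx (cone T p.1) *m cone T p'.1 in
  Phi_defined sg p'.2 && (p.2 == Phi sg p'.2).

Definition divisor (j : nat) : {set chart_point} := [set p : chart_point |
  ((p.1 == j :> nat) && (p.2.1 == 0)) || ((p.1.+1 == j) && (p.2.2 == 0))].

(* The pullback of f divided by the maximal powers of the equations of
   E(T_1), ..., E(T_m) in the i-th chart. *)
Definition strict_series (i : nat) : fps2 F :=
  let G := pullback (cone T i) f in
  let e1 := if (0 < i)%N then multx G else 0%N in
  let e2 := if (i < size T)%N then multy G else 0%N in
  series2 (fun m n => coef2 G (m + e1) (n + e2)).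

(* The value of the strict transform at a point of an exceptional divisor: only
   finitely many terms are nonzero there, since 0 ^+ m = 0 for m > 0. *)
Definition strict_value (p : chart_point) : F :=
  \sum_(e \in [set: nat * nat])
    coef2 (strict_series p.1) e.1 e.2 * p.2.1 ^+ e.1 * p.2.2 ^+ e.2.

Definition stratum (j : nat) : {set chart_point} := [set p in divisor j |
  [forall j' : 'I_(size T).+1,
     (0 < j')%N && (j' != j :> nat) ==> (p \notin divisor j')]
  && (strict_value p != 0)].

Definition card_stratum (j : nat) : nat :=
  #|equivalence_partition glued (stratum j)|.

End Strata.

(* Nonarchimedean local fields of characteristic 0, i.e. finite extensions of
   Q_p, with the normalized absolute value absK. [red] is the reduction
   O_K -> F_q; its values outside O_K are irrelevant. *)
Record padicField (R : realType) := PadicField {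
  pf_field :> fieldType;
  resfield : finFieldType;
  absK : pf_field -> R;
  red : pf_field -> resfield;
  pf_char0 : [pchar pf_field] =i pred0;
  absK_ge0 : forall x, 0 <= absK x;
  absK_eq0 : forall x, absK x = 0 <-> x = 0;
  absKM : forall x y, absK (x * y) = absK x * absK y;
  absKD : forall x y, absK (x + y) <= Num.max (absK x) (absK y);
  absK_uniformizer : exists pi, absK pi = (#|resfield|%:R)^-1;
  absK_discrete : forall x, x <> 0 -> exists n : int, absK x = #|resfield|%:R ^ n;
  absK_complete : forall u : nat -> pf_field,
    (forall e : R, 0 < e -> exists n0, forall m n,
       (n0 <= m)%N -> (n0 <= n)%N -> absK (u m - u n) < e) ->
    exists l, (fun n => absK (u n - l)) @ \oo --> (0 : R);
  redD : forall x y, absK x <= 1 -> absK y <= 1 -> red (x + y) = red x + red y;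
  redM : forall x y, absK x <= 1 -> absK y <= 1 -> red (x * y) = red x * red y;
  red1 : red 1 = 1;
  red_eq0 : forall x, absK x <= 1 -> red x = 0 <-> absK x < 1;
  red_surj : forall z, exists2 x, absK x <= 1 & red x = z
}.

Section Plane.
Variables (R : realType) (K : padicField R).

Definition OK : set K := [set x | absK x <= 1].
Definition MK : set K := [set x | absK x < 1].

Definition plane : Type := (K * K)%type.
HB.instance Definition _ := Choice.on plane.
HB.instance Definition _ := isPointed.Build plane ((0, 0) : K * K).

Definition MK2 : set plane := MK `*` MK.

Definition open_plane : set (set plane) := [set U | forall p, U p ->
  exists2 e : R, 0 < e & forall p' : plane,
    absK (p'.1 - p.1) < e -> absK (p'.2 - p.2) < e -> U p'].

Definition borel_plane := g_sigma_algebraType open_plane.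

Definition normalized_haar (mu : {measure set borel_plane -> \bar R}) : Prop :=
  (forall (t : K * K) (U : set borel_plane), measurable U ->
     mu [set p | U (p.1 + t.1, p.2 + t.2)] = mu U) /\
  mu (OK `*` OK) = 1%E.

Definition integral2 (F : fps2 K) : Prop := forall m n, OK (coef2 F m n).

Definition eval2 (F : fps2 K) (p : plane) : K := xget 0 [set z |
  (fun N => absK (\sum_(m < N) \sum_(n < N)
     coef2 F m n * p.1 ^+ m * p.2 ^+ n - z)) @ \oo --> (0 : R)].

(* The condition deg_y (g - h^N) < deg_y g - deg_y h reads [size _ <= _], also
   when N = 1, where it means g = h. *)
Definition tschirnhausen (g : {poly (fps K)}) (N : nat) (h : {poly (fps K)}) : Prop :=
  [/\ integral2 (fps_of_poly h), h \is monic,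
      ((size h).-1 * N)%N = (size g).-1 &
      (size (g - h ^+ N)%R <= (size g).-1 - (size h).-1)%N].

(* h = y^a + xi x^b + ... pulls back to x^(a b) y^(c' b) (y + xi + x R'), where
   c' is the upper right entry of sg. With d = a b, the Tschirnhausen coordinates
   (u, v) on M_K * (- xi + M_K) in the chart sg are u = x and
   v = (pullback of h) / x^d; [tschirnhausen_inv] is the inverse coordinate
   change, and [in_tschirnhausen] is the pullback of f expressed in (u, v). *)
Definition tschirnhausen_v (sg : 'M[int]_2) (d : nat) (h : {poly (fps K)}) : fps2 K :=
  series2 (fun m n => coef2 (pullback sg (fps_of_poly h)) (m + d) n).

Definition tschirnhausen_inv (sg : 'M[int]_2) (d : nat) (xi : K)
    (h : {poly (fps K)}) (w : plane) : plane :=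
  (w.1, xget 0 [set y | MK (y + xi) /\
                        eval2 (tschirnhausen_v sg d h) (w.1, y) = w.2]).

Definition in_tschirnhausen (sg : 'M[int]_2) (d : nat) (xi : K)
    (h : {poly (fps K)}) (f : fps2 K) (w : plane) : K :=
  eval2 (pullback sg f) (tschirnhausen_inv sg d xi h w).

End Plane.

Arguments OK {R} K _.
Arguments MK {R} K _.
Arguments MK2 {R} K _.

Section Complex.
Variable R : realType.

(* r^s for r >= 0, with 0^s = 0 *)
Definition cpow (r : R) (s : R[i]) : R[i] :=
  if r == 0 then 0 else
  (r `^ complex.Re s * cos (complex.Im s * ln r)) +i*
  (r `^ complex.Re s * sin (complex.Im s * ln r)).

Definition cintegral d (X : measurableType d) (mu : {measure set X -> \bar R})
    (D : set X) (g : X -> R[i]) : R[i] :=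
  Rintegral mu D (fun x => complex.Re (g x)) +i*
  Rintegral mu D (fun x => complex.Im (g x)).

End Complex.

Definition Zeta0 (R : realType) (K : padicField R)
    (mu : {measure set (borel_plane K) -> \bar R}) (f : fps2 K) (s : R[i]) : R[i] :=
  cintegral mu (MK2 K) (fun p => cpow (absK (eval2 f p)) s).

(* Q j = q^(N_j s + nu_j). The terms j = 0 and j = m of the second sum are
   omitted when alpha = 0, resp. beta = 0. *)
Definition toric_part (R : realType) (K : padicField R) (T : seq (nat * nat))
    (f : fps2 K) (alpha beta : nat) (s : R[i]) : R[i] :=
  let q := #|resfield K|%:R : R[i] in
  let m := size T in
  let Q j := cpow #|resfield K|%:R ((Nmult T f j)%:R * s + (numult K T j)%:R) in
  (q - 1) / q ^+ 2 *
  (\sum_(1 <= j < m.+1) (card_stratum T (map_fps2 (@red R K) f) j)%:R / (Q j - 1)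
   + \sum_(0 <= j < m.+1 | ~~ ((j == 0%N) && (alpha == 0%N)) &&
                           ~~ ((j == m) && (beta == 0%N)))
       (q - 1) / ((Q j - 1) * (Q j.+1 - 1))).

(* Main.v *)
Require Import Defs.
From HB Require Import structures.
From mathcomp Require Import all_boot all_order all_algebra.
From mathcomp Require Import all_classical all_reals all_analysis.
From mathcomp Require Import complex ring lra zify.

Set Implicit Arguments.
Unset Strict Implicit.
Unset Printing Implicit Defensive.

Import Order.TTheory GRing.Theory Num.Theory.
Import numFieldNormedType.Exports.

Local Open Scope classical_set_scope.
Local Open Scope ring_scope.
Local Open Scope complex_scope.

(* Off the coordinate axes, (v(x), v(y)) lies either inside a cone (T_j, T_{j+1}) or on
   a ray T_j. Inside a cone one monomial of f dominates, so |f| depends on the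
   valuations only and the integral is a product of two geometric series. On the ray
   T_j = (a, b), |f| is given by the initial form as soon as the latter does not vanish
   at the residue of y^a / x^b, i.e. as soon as that point of E(T_j) is not on the
   strict transform. By the factorization of f, the exceptional points are the -xi_il
   on E(P_i). There the weighted leading form of the Tschirnhausen polynomial h_il makes
   v a contracting perturbation of a unit multiple of y_j, so (u, v) are coordinates on
   the residue class, mapping small boxes to small boxes and multiplying the measure by
   |u|^(nu - 1).
   When alpha = 0 (or beta = 0), N and nu of the coordinate axis are 0 and 1, and the
   integral over the extreme cone becomes the contribution of one more point of the
   adjacent stratum. *)

(** * Formal power series and weighted orders *)

(** The leading form of a factor over the algebraic closure bounds orders, not degrees: its higher
    terms could contain higher powers of y. Irreducibility excludes this through Hensel's lemma.
    Each f_il then has the two Newton vertices y^(aS) and xi^S x^(bS), with unit coefficients, and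
    h_il has degree a; its leading form is found by dividing by S, in characteristic 0. As the
    residues of the xi_il are distinct for fixed i, each exceptional residue class carries one pair
    of Tschirnhausen coordinates. No change of variables formula is invoked. All integrands take
    countably many values, so integrals are sums over fibres, and fibres are compared by cutting
    them into boxes, whose areas come from translation invariance. The Jacobian is a ratio of areas:
    on the shell |u| = q^-k, a relative precision r in (x, y) means area r^2 q^(-k(a+b)), against
    r^2 q^-k in (u, v). The constants (1 - q^-1)^2 and (q - 1) q^-2 are the areas of all pairs of
    units, and of the pairs of units whose torus coordinate has a given residue. *)

Section FormalSeries.
Variable A : comNzRingType.
Implicit Types (f g : fps A) (F G : fps2 A).

Lemma fps_sumE I (r : seq I) (P : pred I) (f : I -> fps A) n :
  (\sum_(i <- r | P i) f i) n = \sum_(i <- r | P i) f i n.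
Proof. exact: (big_morph (fun h : fps A => h n)). Qed.

Lemma coef2D F G m n : coef2 (F + G) m n = coef2 F m n + coef2 G m n.
Proof. by []. Qed.
Lemma coef2B F G m n : coef2 (F - G) m n = coef2 F m n - coef2 G m n.
Proof. by []. Qed.

Lemma coef2M F G m n : coef2 (F * G) m n =
  \sum_(j < n.+1) \sum_(i < m.+1) coef2 F i j * coef2 G (m - i)%N (n - j)%N.
Proof. by rewrite /coef2 /= fps_sumE. Qed.

Lemma coef2_1 m n : coef2 (1 : fps2 A) m n = ((m == 0%N) && (n == 0%N))%:R.
Proof. by rewrite /coef2 /=; case: (n == 0%N); rewrite ?andbT ?andbF. Qed.

Lemma coef2_monom c M N m n :
  coef2 (monom2 (c : A) M N) m n = c *+ ((m == M) && (n == N)).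
Proof.
rewrite /coef2 /monom2 /=; case: (n == N); rewrite ?andbT ?andbF //=.
Qed.

Lemma fps2P F G : (forall m n, coef2 F m n = coef2 G m n) -> F = G.
Proof. by move=> h; apply/fpsP => n; apply/fpsP => m; exact: h. Qed.

Lemma monom2M c d M N M' N' : monom2 (c : A) M N * monom2 d M' N' =
  monom2 (c * d) (M + M') (N + N').
Proof.
apply: fps2P => m n; rewrite coef2M coef2_monom.
under eq_bigr => j _ do under eq_bigr => i _ do rewrite !coef2_monom.
case: (ltnP n N) => hn.
  have -> : ((m == M + M') && (n == N + N'))%N = false by apply/negbTE; lia.
  rewrite big1// => j _; rewrite big1// => i _.
  rewrite (_ : (nat_of_ord j == N) = false) ?andbF ?mul0r//.
  by apply/eqP => e; move: (ltn_ord j); lia.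
case: (ltnP m M) => hm.
  have -> : ((m == M + M') && (n == N + N'))%N = false by apply/negbTE; lia.
  rewrite big1// => j _; rewrite big1// => i _.
  rewrite (_ : (nat_of_ord i == M) = false) ?mul0r//.
  by apply/eqP => e; move: (ltn_ord i); lia.
rewrite (bigD1 (Ordinal (hn : N < n.+1)%N))//= [X in _ + X]big1 ?addr0; last first.
  move=> j /eqP hj; rewrite big1// => i _.
  rewrite (_ : (nat_of_ord j == N) = false) ?andbF ?mul0r//.
  by apply/eqP => e; apply: hj; apply: val_inj.
rewrite (bigD1 (Ordinal (hm : M < m.+1)%N))//= [X in _ + X]big1 ?addr0; last first.
  move=> j /eqP hj.
  rewrite (_ : (nat_of_ord j == M) = false) ?mul0r//.
  by apply/eqP => e; apply: hj; apply: val_inj.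
rewrite !eqxx/= mulr1n -mulrnAr; congr (_ * (_ *+ _)).
by congr nat_of_bool; lia.
Qed.

Fact fps_of_poly_is_zmod_morphism : zmod_morphism (@fps_of_poly A).
Proof. by move=> p q; apply/fpsP => n /=; rewrite coefB. Qed.
Fact fps_of_poly_is_monoid_morphism : monoid_morphism (@fps_of_poly A).
Proof.
split; first by apply/fpsP => n /=; rewrite coef1.
by move=> p q; apply/fpsP => n /=; rewrite coefM.
Qed.
HB.instance Definition _ := GRing.isZmodMorphism.Build {poly A} (fps A)
  (@fps_of_poly A) fps_of_poly_is_zmod_morphism.
HB.instance Definition _ := GRing.isMonoidMorphism.Build {poly A} (fps A)
  (@fps_of_poly A) fps_of_poly_is_monoid_morphism.

Lemma fps_of_polyD (p q : {poly A}) :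
  fps_of_poly (p + q) = fps_of_poly p + fps_of_poly q.
Proof. exact: rmorphD. Qed.
Lemma fps_of_polyB (p q : {poly A}) :
  fps_of_poly (p - q) = fps_of_poly p - fps_of_poly q.
Proof. exact: rmorphB. Qed.
Lemma fps_of_polyX (p : {poly A}) n : fps_of_poly (p ^+ n) = fps_of_poly p ^+ n.
Proof. exact: rmorphXn. Qed.
Lemma fps_of_poly_prod I (r : seq I) (P : pred I) (p : I -> {poly A}) :
  fps_of_poly (\prod_(i <- r | P i) p i) = \prod_(i <- r | P i) fps_of_poly (p i).
Proof. exact: rmorph_prod. Qed.

End FormalSeries.

Section MapSeries.
Variables (A B : comNzRingType) (g : {rmorphism A -> B}).

Fact map_fps_is_zmod_morphism : zmod_morphism (map_fps g).
Proof. by move=> p q; apply/fpsP => n /=; rewrite rmorphB. Qed.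
Fact map_fps_is_monoid_morphism : monoid_morphism (map_fps g).
Proof.
split; first by apply/fpsP => n /=; rewrite rmorph_nat.
move=> p q; apply/fpsP => n; rewrite /= rmorph_sum.
by apply: eq_bigr => i _; rewrite rmorphM.
Qed.
HB.instance Definition _ := GRing.isZmodMorphism.Build (fps A) (fps B)
  (map_fps g) map_fps_is_zmod_morphism.
HB.instance Definition _ := GRing.isMonoidMorphism.Build (fps A) (fps B)
  (map_fps g) map_fps_is_monoid_morphism.

End MapSeries.

Section MapSeries2.
Variables (A B : comNzRingType) (g : {rmorphism A -> B}).

Lemma coef2_map (F : fps2 A) m n : coef2 (map_fps2 g F) m n = g (coef2 F m n).
Proof. by []. Qed.

Lemma map_fps2_monom c M N : map_fps2 g (monom2 c M N) = monom2 (g c) M N.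
Proof.
by apply: fps2P => m n; rewrite coef2_map !coef2_monom rmorphMn.
Qed.

Lemma map_fps2M (F G : fps2 A) : map_fps2 g (F * G) = map_fps2 g F * map_fps2 g G.
Proof. exact: (rmorphM (map_fps (map_fps g))). Qed.
Lemma map_fps2_prod I (r : seq I) (P : pred I) (F : I -> fps2 A) :
  map_fps2 g (\prod_(i <- r | P i) F i) = \prod_(i <- r | P i) map_fps2 g (F i).
Proof. exact: (rmorph_prod (map_fps (map_fps g))). Qed.

Lemma map_fps2_of_poly (p : {poly fps A}) :
  map_fps2 g (fps_of_poly p) = fps_of_poly (map_poly (map_fps g) p).
Proof. by apply/fpsP => n /=; rewrite coef_map. Qed.

End MapSeries2.

Section WeightedOrder.
Variable A : comNzRingType.
Implicit Types (F G : fps2 A) (t E : nat * nat).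

Definition dot t E : nat := (t.1 * E.1 + t.2 * E.2)%N.

(* The weighted order of F is at least d, for x of weight t.1, y of weight t.2. *)
Definition wge t d F := forall m n, (dot t (m, n) < d)%N -> coef2 F m n = 0.

Lemma higher_termsP a b d F : higher_terms a b d F <-> wge (a, b) d.+1 F.
Proof.
split=> h m n; rewrite /dot /= ?ltnS.
  by move=> le; apply: contrapT => /h; rewrite ltnNge le.
by move=> ne; rewrite ltnNge; apply/negP => le; apply: ne; apply: h.
Qed.

Lemma wge0 t F : wge t 0 F. Proof. by []. Qed.

Lemma wge_le t d d' F : (d <= d')%N -> wge t d' F -> wge t d F.
Proof. by move=> le h m n lt; apply: h; apply: leq_trans lt le. Qed.

Lemma wgeD t d F G : wge t d F -> wge t d G -> wge t d (F + G).
Proof. by move=> hF hG m n lt; rewrite coef2D hF// hG// addr0. Qed.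

Lemma wgeM t d d' F G : wge t d F -> wge t d' G -> wge t (d + d') (F * G).
Proof.
move=> hF hG m n lt; rewrite coef2M big1// => j _; rewrite big1// => i _.
case: (ltnP (dot t (i : nat, j : nat)) d) => hd; first by rewrite hF// mul0r.
rewrite hG ?mulr0//; move: lt hd (ltn_ord i) (ltn_ord j); rewrite /dot/=.
move: (nat_of_ord i) (nat_of_ord j) => i' j' lt hd hi hj.
(* Writing m = i + (m - i) and n = j + (n - j) makes the weight additive over the two factors. *)
by move: lt; rewrite -[X in (_ * X + _ < _)%N](subnKC (hi : i' <= m)%N)
  -[X in (_ + _ * X < _)%N](subnKC (hj : j' <= n)%N); nia.
Qed.

Lemma wgeX t d F n : wge t d F -> wge t (d * n) (F ^+ n).
Proof.
move=> h; elim: n => [|n IH]; first by rewrite muln0; apply: wge0.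
by rewrite mulnS exprS; apply: wgeM.
Qed.

Lemma wge_monom t c M N : wge t (dot t (M, N)) (monom2 c M N).
Proof.
move=> m n lt; rewrite coef2_monom; case: eqP => //= e; case: eqP => //= e'.
by move: lt; rewrite e e' ltnn.
Qed.

Lemma wge_mul_lead t d d' F F0 G G0 : wge t d F -> wge t d' G0 ->
  wge t d.+1 (F - F0) -> wge t d'.+1 (G - G0) -> wge t (d + d').+1 (F * G - F0 * G0).
Proof.
move=> hF hG hFF hGG; have -> : F * G - F0 * G0 = F * (G - G0) + (F - F0) * G0.
  by rewrite mulrBr mulrBl addrA subrK.
by apply: wgeD; [rewrite -addnS|rewrite -addSn]; apply: wgeM.
Qed.

(* E is the common vertex of the Newton polygon of F for the weights t and t',
   with coefficient c. *)
Definition vertex t t' E c F :=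
  [/\ wge t (dot t E) F, wge t' (dot t' E) F & coef2 F E.1 E.2 = c].

(** Cramer's rule: the nonzero determinant of the two weights kills both differences of
    coordinates. *)
Lemma dot_inj t t' E E' : vlt t t' -> dot t E = dot t E' -> dot t' E = dot t' E' ->
  E = E'.
Proof.
case: t t' E E' => [a b] [c d] [m n] [m' n']; rewrite /vlt /detv /dot /= => lt e e'.
have {}e : a%:Z * m%:Z + b%:Z * n%:Z = a%:Z * m'%:Z + b%:Z * n'%:Z by lia.
have {}e' : c%:Z * m%:Z + d%:Z * n%:Z = c%:Z * m'%:Z + d%:Z * n'%:Z by lia.
have ne0 : a%:Z * d%:Z - b%:Z * c%:Z != 0 by rewrite gt_eqF.
have h1 : (a%:Z * d%:Z - b%:Z * c%:Z) * (m%:Z - m'%:Z) = 0.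
  have -> : (a%:Z * d%:Z - b%:Z * c%:Z) * (m%:Z - m'%:Z) =
    d%:Z * (a%:Z * m%:Z + b%:Z * n%:Z - (a%:Z * m'%:Z + b%:Z * n'%:Z)) -
    b%:Z * (c%:Z * m%:Z + d%:Z * n%:Z - (c%:Z * m'%:Z + d%:Z * n'%:Z)) by ring.
  by rewrite e e' !subrr !mulr0 subr0.
have h2 : (a%:Z * d%:Z - b%:Z * c%:Z) * (n%:Z - n'%:Z) = 0.
  have -> : (a%:Z * d%:Z - b%:Z * c%:Z) * (n%:Z - n'%:Z) =
    a%:Z * (c%:Z * m%:Z + d%:Z * n%:Z - (c%:Z * m'%:Z + d%:Z * n'%:Z)) -
    c%:Z * (a%:Z * m%:Z + b%:Z * n%:Z - (a%:Z * m'%:Z + b%:Z * n'%:Z)) by ring.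
  by rewrite e e' !subrr !mulr0 subr0.
move/eqP: h1; move/eqP: h2; rewrite !mulf_eq0 (negbTE ne0) /= !subr_eq0.
by move=> /eqP[->] /eqP[->].
Qed.

(** In a nonzero term of the convolution both exponents lie on or above the supporting lines of
    their factors, for both weights. Their sum lies on the supporting lines of the product, so both
    exponents lie on theirs, and two independent weights leave a single pair. *)
Lemma vertexM t t' E E' c c' F G : vlt t t' -> vertex t t' E c F ->
  vertex t t' E' c' G -> vertex t t' (E.1 + E'.1, E.2 + E'.2)%N (c * c') (F * G).
Proof.
move=> lt [hF hF' cF] [hG hG' cG].
have dE s : (dot s (E.1 + E'.1, E.2 + E'.2) = dot s E + dot s E')%N.
  by rewrite /dot /= !mulnDr; lia.
split; rewrite ?dE; [exact: wgeM|exact: wgeM|rewrite coef2M /=].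
have hsub (i : 'I_(E.1 + E'.1).+1) (j : 'I_(E.2 + E'.2).+1) s :
    (dot s (i : nat, j : nat) + dot s (E.1 + E'.1 - i, E.2 + E'.2 - j) =
     dot s E + dot s E')%N.
  rewrite -dE /dot /=; move: (ltn_ord i) (ltn_ord j).
  move: (E.1 + E'.1)%N (E.2 + E'.2)%N (nat_of_ord i) (nat_of_ord j) => m n i' j' hi hj.
  by rewrite -[X in (_ = _ * X + _)%N](subnKC (hi : i' <= m)%N)
    -[X in (_ = _ + _ * X)%N](subnKC (hj : j' <= n)%N) !mulnDr; lia.
have z (i : 'I_(E.1 + E'.1).+1) (j : 'I_(E.2 + E'.2).+1) :
    (i : nat, j : nat) <> E ->
    coef2 F i j * coef2 G (E.1 + E'.1 - i)%N (E.2 + E'.2 - j)%N = 0.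
  move=> ne; have := hsub i j t; have := hsub i j t'.
  case: (ltnP (dot t (i : nat, j : nat)) (dot t E)) => h1; first by rewrite hF// mul0r.
  case: (ltnP (dot t' (i : nat, j : nat)) (dot t' E)) => h2; first by rewrite hF'// mul0r.
  move=> e2 e1.
  case: (ltnP (dot t (E.1 + E'.1 - i, E.2 + E'.2 - j)) (dot t E'))%N => h3.
    by rewrite hG// mulr0.
  case: (ltnP (dot t' (E.1 + E'.1 - i, E.2 + E'.2 - j)) (dot t' E'))%N => h4.
    by rewrite hG'// mulr0.
  by case: ne; apply: (dot_inj lt); lia.
have l1 : (E.1 < (E.1 + E'.1).+1)%N by lia.
have l2 : (E.2 < (E.2 + E'.2).+1)%N by lia.
rewrite (bigD1 (Ordinal l2))//= [X in _ + X]big1 ?addr0; last first.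
  move=> j /eqP hj; rewrite big1// => i _; apply: z => e; apply: hj.
  by apply: val_inj; rewrite /= -[in RHS]e.
rewrite (bigD1 (Ordinal l1))//= [X in _ + X]big1 ?addr0; last first.
  move=> i /eqP hj; apply: (z _ (Ordinal l2)) => e; apply: hj.
  by apply: val_inj; rewrite /= -[in RHS]e.
by rewrite !addKn cF cG.
Qed.

Lemma vertex1 t t' : vertex t t' (0, 0)%N 1 1.
Proof. by split; rewrite ?coef2_1// /dot !muln0. Qed.

Lemma vertex_monom t t' c M N : vertex t t' (M, N) c (monom2 c M N).
Proof. by split; rewrite ?coef2_monom ?eqxx//; apply: wge_monom. Qed.

End WeightedOrder.

Section WeightedOrderLead.
Variable A : comNzRingType.

Lemma wge_lead t d (F F0 : fps2 A) :
  wge t d F0 -> wge t d.+1 (F - F0) -> wge t d F.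
Proof.
move=> h h'; rewrite -(subrK F0 F); apply: wgeD => //.
by apply: wge_le h'.
Qed.

Lemma wge_prod_lead t I (r : seq I) (P : pred I) (d : I -> nat) (F F0 : I -> fps2 A) :
  (forall i, P i -> wge t (d i) (F0 i)) ->
  (forall i, P i -> wge t (d i).+1 (F i - F0 i)) ->
  wge t (\sum_(i <- r | P i) d i) (\prod_(i <- r | P i) F0 i) /\
  wge t (\sum_(i <- r | P i) d i).+1 (\prod_(i <- r | P i) F i - \prod_(i <- r | P i) F0 i).
Proof.
move=> h0 h; elim: r => [|i r [IH0 IH]]; first by rewrite !big_nil subrr; split.
rewrite !big_cons; case: ifP => // Pi; split; first by apply: wgeM => //; apply: h0.
by apply: wge_mul_lead => //; [apply: wge_lead (h0 i Pi) (h i Pi)|apply: h].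
Qed.

Lemma wge_exp_lead t d n (F F0 : fps2 A) :
  wge t d F0 -> wge t d.+1 (F - F0) -> wge t (d * n).+1 (F ^+ n - F0 ^+ n).
Proof.
move=> h0 h; have [_] := @wge_prod_lead t _ (index_enum 'I_n) predT (fun=> d)
  (fun=> F) (fun=> F0) (fun _ _ => h0) (fun _ _ => h).
by rewrite sum_nat_const card_ord mulnC !prodr_const card_ord.
Qed.

End WeightedOrderLead.

(** * Degrees of the factors *)

Section Hensel.
Variable k : fieldType.
Implicit Types p q : {poly fps k}.

Local Ltac slia := simpl in *; lia.

(** The coefficient of x^m, as a polynomial in y. Hensel lifting becomes a recursion on m inside
    [{poly k}]. *)
Definition slice m p : {poly k} := \poly_(i < size p) (p`_i : fps k) m.

Lemma coef_slice m p i : (slice m p)`_i = (p`_i : fps k) m.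
Proof. by rewrite coef_poly; case: ltnP => // h; rewrite nth_default. Qed.

Lemma slice_inj p q : (forall m, slice m p = slice m q) -> p = q.
Proof.
by move=> h; apply/polyP => i; apply/fpsP => m; rewrite -!coef_slice h.
Qed.

Lemma sliceM m p q :
  slice m (p * q) = \sum_(l < m.+1) slice l p * slice (m - l) q.
Proof.
apply/polyP => i; rewrite coef_slice coefM fps_sumE coef_sum.
under [RHS]eq_bigr => l _ do rewrite coefM.
rewrite exchange_big /=; apply: eq_bigr => j _.
by apply: eq_bigr => l _; rewrite !coef_slice.
Qed.

(** The uniform bound [N] on degrees keeps the result polynomial in y, although infinitely many
    powers of x occur. *)
Definition unslice N (G : nat -> {poly k}) : {poly fps k} :=
  \poly_(i < N) Fps (fun m => (G m)`_i).

Lemma sliceK N (G : nat -> {poly k}) m : (size (G m) <= N)%N -> slice m (unslice N G) = G m.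
Proof.
move=> h; apply/polyP => i; rewrite coef_slice coef_poly; case: ltnP => // hi.
by rewrite nth_default// (leq_trans h).
Qed.

(** Given u G0 + v H0 = 1, the first component is R v reduced modulo G0, and the second is the exact
    quotient that remains. As G0 is monic, the degree of R bounds that of the quotient. *)
Lemma bezout_split (G0 H0 R : {poly k}) : G0 \is monic -> coprimep G0 H0 ->
  (0 < size H0)%N -> (size R <= (size G0).-1 + (size H0).-1)%N ->
  exists GH : {poly k} * {poly k},
  [/\ (size GH.1 <= (size G0).-1)%N, (size GH.2 <= (size H0).-1)%N
    & GH.1 * H0 + G0 * GH.2 = R].
Proof.
move=> mG /Bezout_eq1_coprimepP[[u v] /= uv] sH sR.
have G0n0 : G0 != 0 by apply: monic_neq0.
have sG : (0 < size G0)%N by rewrite size_poly_gt0.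
pose G : {poly k} := (R * v) %% G0.
have hG : (size G <= (size G0).-1)%N by rewrite -ltnS prednK// ltn_modp.
have dvd : G0 %| R - G * H0.
  rewrite /G; have -> : R - (R * v) %% G0 * H0 =
      G0 * (R * u + (R * v) %/ G0 * H0).
    transitivity (R * (u * G0 + v * H0) - (R * v) %% G0 * H0).
      by rewrite uv mulr1.
    have e : R * v = (R * v) %/ G0 * G0 + (R * v) %% G0 by apply: divp_eq.
    rewrite mulrDr [R * (v * H0)]mulrA [in R * v * H0]e.
    by ring.
  exact: dvdp_mulr.
pose Q : {poly k} := (R - G * H0) %/ G0.
have eH : G0 * Q = R - G * H0 by rewrite mulrC divpK.
exists (G, Q) => /=; split=> //; last by rewrite eH addrC subrK.
have : (size (G0 * Q)%R <= (size G0).-1 + (size H0).-1)%N.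
  have hM : (size (G * H0)%R <= (size G + size H0).-1)%N by apply: size_polyMleq.
  rewrite eH (leq_trans (size_polyD _ _))// size_polyN geq_max sR /=.
  by apply: leq_trans hM _; move: sG sH hG; clear; slia.
clearbody Q; have [->|ne] := eqVneq Q 0; first by rewrite size_poly0.
by rewrite size_monicM//; slia.
Qed.

(** The coefficients of x^(n+1) in the two factors solve a linear equation with coefficients G0 and
    H0, whose right side involves earlier coefficients only. The equality of sizes says that the
    degree in y does not drop modulo x. *)
Lemma hensel_factor p (G0 H0 : {poly k}) : p \is monic -> G0 \is monic ->
  coprimep G0 H0 -> slice 0 p = G0 * H0 -> size (G0 * H0) = size p ->
  exists g h, [/\ p = g * h, g \is monic & size g = size G0].
Proof.
move=> mp mG cop sl0 szp.
have sG : (0 < size G0)%N by rewrite size_poly_gt0 monic_neq0.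
have H0n0 : H0 != 0.
  by apply/eqP => H00; move: szp; rewrite H00 mulr0 size_poly0 => /esym/eqP;
    rewrite size_poly_eq0 (negbTE (monic_neq0 mp)).
have sH : (0 < size H0)%N by rewrite size_poly_gt0.
have sp : size p = ((size G0).-1 + (size H0).-1).+1.
  by rewrite -szp size_monicM//; slia.
have /choice[sol hsol] : forall R : {poly k}, exists s : {poly k} * {poly k},
    (size R <= (size G0).-1 + (size H0).-1)%N ->
    [/\ (size s.1 <= (size G0).-1)%N, (size s.2 <= (size H0).-1)%N
      & s.1 * H0 + G0 * s.2 = R].
  move=> R; case: (boolP (size R <= (size G0).-1 + (size H0).-1)%N) => [h|_].
    by have [x hx] := bezout_split mG cop sH h; exists x.
  by exists (0, 0).
(* Course-of-values recursion: [L n] stores the pairs of index at most n, and [rest n] subtracts the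
   products of two pairs of positive index. *)
pose rest n (L : seq ({poly k} * {poly k})) := slice n.+1 p -
  \sum_(l < n) (nth (0, 0) L l.+1).1 * (nth (0, 0) L (n - l)).2.
pose fix L n := if n is n'.+1 then rcons (L n') (sol (rest n' (L n')))
  else [:: (G0, H0)].
have sL n : size (L n) = n.+1 by elim: n => //= n IH; rewrite size_rcons IH.
pose gh n := nth (0, 0) (L n) n.
have Lgh n m : (m <= n)%N -> nth (0, 0) (L n) m = gh m.
  elim: n => [|n IH]; first by rewrite leqn0 => /eqP ->.
  rewrite leq_eqVlt => /orP[/eqP -> //|]; rewrite ltnS => le.
  by rewrite /= nth_rcons sL ltnS le IH.
have ghS n : gh n.+1 = sol (slice n.+1 p -
    \sum_(l < n) (gh l.+1).1 * (gh (n - l)%N).2).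
  rewrite {1}/gh /= nth_rcons sL ltnn eqxx /rest; congr (sol (_ - _)).
  by apply: eq_bigr => l _; rewrite !Lgh// ?leq_subr.
have ghP n : [/\ (size (gh n.+1).1 <= (size G0).-1)%N,
    (size (gh n.+1).2 <= (size H0).-1)%N &
    (gh n.+1).1 * H0 + G0 * (gh n.+1).2 = slice n.+1 p -
    \sum_(l < n) (gh l.+1).1 * (gh (n - l)%N).2].
  elim/ltn_ind: n => n IH; rewrite ghS; apply: hsol.
  rewrite (leq_trans (size_polyD _ _))// size_polyN geq_max; apply/andP; split.
    (* The leading coefficient 1 of p has no part in x^(n+1), so this slice has smaller degree than
       p. *)
    apply/leq_sizeP => i hi; rewrite coef_slice.
    have [->|ne] := eqVneq i (size p).-1; first by
      rewrite -[p`_ _]/(lead_coef p) (monicP mp).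
    by rewrite nth_default// sp; move: ne hi; rewrite sp /=; slia.
  apply/leq_sizeP => i hi; rewrite coef_sum big1// => l _.
  apply: nth_default; apply: leq_trans hi; rewrite (leq_trans (size_polyMleq _ _))//.
  have [h1 _ _] := IH _ (ltn_ord l).
  have hl : (n - l)%N = (n - l).-1.+1 by rewrite prednK// subn_gt0.
  have /IH[_ h2 _] : ((n - l).-1 < n)%N by rewrite -ltnS -hl ltnS leq_subr.
  have aux (a b c d : nat) : (0 < c)%N -> (0 < d)%N -> (a <= c.-1)%N ->
    (b <= d.-1)%N -> ((a + b).-1 <= c.-1 + d.-1)%N by clear; lia.
  by apply: aux => //; move: h2; rewrite -hl.
have szg n : (size (gh n).1 <= size G0)%N.
  by case: n => // n; have [h _ _] := ghP n; rewrite (leq_trans h)// leq_pred.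
have szh n : (size (gh n).2 <= size H0)%N.
  by case: n => // n; have [_ h _] := ghP n; rewrite (leq_trans h)// leq_pred.
pose g := unslice (size G0) (fun n => (gh n).1).
pose h := unslice (size H0) (fun n => (gh n).2).
have coefg : g`_(size G0).-1 = 1.
  rewrite coef_poly prednK// leqnn; apply/fpsP => -[|n] /=.
    by rewrite -[X in X = _]/(lead_coef G0) (monicP mG).
  by have [hs _ _] := ghP n; rewrite nth_default.
have szgE : size g = size G0.
  apply/eqP; rewrite eqn_leq size_poly /=.
  rewrite -(prednK sG) ltnNge; apply/negP => /leq_sizeP/(_ _ (leqnn _)).
  by rewrite coefg => /eqP; rewrite oner_eq0.
exists g, h; split=> //; last by rewrite monicE lead_coefE szgE coefg.
apply: slice_inj => m; rewrite sliceM.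
under eq_bigr => l _ do rewrite !sliceK//.
case: m => [|n]; first by rewrite big_ord1.
have [_ _ e] := ghP n.
rewrite big_ord_recl big_ord_recr /= subn0 /bump /= !add1n subnn.
under eq_bigr => l _ do rewrite add1n subSS.
rewrite -[slice _ _](subrK (\sum_(l < n) (gh l.+1).1 * (gh (n - l)%N).2)) -e.
by rewrite [in RHS](_ : gh 0%N = (G0, H0))//= -addrA [LHS]addrC -!addrA.
Qed.

Lemma monic_not_unit (A : comNzRingType) (g : {poly A}) :
  g \is monic -> (1 < size g)%N -> ~ is_unit g.
Proof.
move=> mg sg [h e].
have h0 : h != 0 by apply: contra_eq_neq e => ->; rewrite mulr0 eq_sym oner_eq0.
have := congr1 (fun p : {poly A} => size p) e.
rewrite /= size_monicM// size_poly1; move: h0; rewrite -size_poly_gt0; slia.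
Qed.

(* Otherwise p(0, y) = y^N u(y) with u(0) <> 0 and deg u > 0, and Hensel's lemma
   lifts this factorization to one of p. *)
Lemma irreducible_degree p N : p \is monic -> irreducible_elt p -> (0 < N)%N ->
  (forall n, (n < N)%N -> (p`_n : fps k) 0%N = 0) -> (p`_N : fps k) 0%N <> 0 ->
  size p = N.+1.
Proof.
move=> mp [_ _ irr] N0 low pN.
have lcp : (p`_(size p).-1 : fps k) 0%N = 1.
  by rewrite -[p`_ _]/(lead_coef p) (monicP mp).
have sp0 : (0 < size p)%N by rewrite size_poly_gt0 monic_neq0.
have Nsp : (N < size p)%N.
  by rewrite ltnNge; apply/negP => h; apply: pN; rewrite nth_default.
apply/eqP; rewrite eqn_leq Nsp andbT leqNgt; apply/negP => lt.
pose u := \poly_(i < size p - N) ((p`_(i + N) : fps k) 0%N).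
have su : slice 0 p = 'X^N * u.
  apply/polyP => i; rewrite coef_slice coefXnM coef_poly.
  case: ltnP => [/low //|hi]; rewrite subnK//.
  case: ltnP => // h; rewrite nth_default//.
  by move: h; rewrite leq_sub2rE// ltnW.
have u00 : u`_0 != 0 by rewrite coef_poly subn_gt0 Nsp; apply/eqP.
have cop : coprimep 'X^N u.
  apply: coprimep_expl; rewrite -[X in coprimep X _]subr0 -polyC0 coprimep_sym.
  by rewrite coprimep_XsubC rootE horner_coef0.
have szu : size u = (size p - N)%N.
  apply/eqP; rewrite eqn_leq size_poly /=.
  have e : (size p - N)%N = (size p - N).-1.+1 by rewrite prednK// subn_gt0.
  rewrite [leqLHS]e ltnNge; apply/negP => /leq_sizeP/(_ _ (leqnn _)).
  rewrite coef_poly -e leqnn (_ : _ + N = (size p).-1)%N; last by slia.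
  by rewrite lcp => /eqP; rewrite oner_eq0.
have u0 : u != 0 by apply: contraNneq u00 => ->; rewrite coef0.
have [g [h [e mg sg]]] := hensel_factor mp (monicXn _ N) cop su
  ltac:(rewrite size_monicM ?monicXn// size_polyXn szu; slia).
have mh : h \is monic.
  by move: mp; rewrite e !monicE lead_coef_monicM.
have sh : (1 < size h)%N.
  have szp : size p = (N.+1 + size h).-1.
    by rewrite {1}e size_monicM ?monic_neq0// sg size_polyXn.
  move: lt; rewrite szp; move: (size h); clear; lia.
case: (irr _ _ e); apply: monic_not_unit => //.
by rewrite sg size_polyXn ltnS.
Qed.

End Hensel.

(** * Leading forms *)

Section LeadingForm.

Definition binom_poly (A : comNzRingType) (a b : nat) (xi : A) : {poly fps A} :=
  'X^a + (fps_monom xi b)%:P.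

Lemma fps_mulrn (A : comNzRingType) (F : fps A) n m : (F *+ n) m = F m *+ n.
Proof. by elim: n => // n IH; rewrite mulrS /= IH mulrS. Qed.

Lemma monom2X (A : comNzRingType) (c : A) M N n :
  monom2 c M N ^+ n = monom2 (c ^+ n) (M * n) (N * n).
Proof.
elim: n => [|n IH]; last by rewrite !exprS IH monom2M !mulnS.
by rewrite !muln0 !expr0; apply: fps2P => i j; rewrite coef2_1.
Qed.

Lemma fps_of_binom (A : comNzRingType) a b (xi : A) :
  fps_of_poly (binom_poly a b xi) = monom2 1 0 a + monom2 xi b 0.
Proof.
rewrite /binom_poly fps_of_polyD; congr (_ + _).
  apply: fps2P => m n; rewrite coef2_monom /coef2 /= coefXn.
  by case: (n == a); rewrite ?andbF ?andbT.
apply: fps2P => m n; rewrite coef2_monom /coef2 /= coefC.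
by case: (n == 0%N); rewrite ?andbF ?andbT.
Qed.

Lemma binom_monic (A : comNzRingType) a b (xi : A) : (0 < a)%N ->
  binom_poly a b xi \is monic /\ size (binom_poly a b xi) = a.+1.
Proof.
move=> a0; have sl : (size (fps_monom xi b)%:P < size ('X^a : {poly fps A}))%N.
  by rewrite size_polyXn ltnS (leq_trans (size_polyC_leq1 _)).
by rewrite /binom_poly monicE lead_coefDl// lead_coefXn eqxx size_polyDl// size_polyXn.
Qed.

Lemma wge_binom (A : comNzRingType) a b (xi : A) :
  wge (a, b) (a * b) (fps_of_poly (binom_poly a b xi)).
Proof.
rewrite fps_of_binom; apply: wgeD.
  by have := @wge_monom A (a, b) 1 0 a; rewrite /dot /= muln0 add0n mulnC.
by have := @wge_monom A (a, b) xi b 0; rewrite /dot /= muln0 addn0.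
Qed.

(** Modulo x the higher terms contain no y^n with n at most a A, and the binomial becomes y^a. Hence
    ft(0, y) starts with y^(a A), and irreducibility leaves nothing beyond it. *)
Lemma factor_degree (k : fieldType) a b A (xi : k) (ft : {poly fps k}) :
  (0 < a)%N -> (0 < b)%N -> (0 < A)%N ->
  wge (a, b) (a * b * A).+1 (fps_of_poly (ft - binom_poly a b xi ^+ A)) ->
  ft \is monic -> irreducible_elt ft -> size ft = (a * A).+1.
Proof.
move=> a0 b0 A0 lead mft irr.
have ftE n : (n <= a * A)%N -> (ft`_n : fps k) 0%N = (n == (a * A)%N)%:R.
  move=> le; have := lead 0%N n; rewrite /dot /= muln0 add0n ltnS.
  rewrite (_ : a * b * A = b * (a * A))%N; last by rewrite mulnCA mulnA.
  rewrite leq_mul2l le orbT => /(_ isT).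
  (* The weights (1, 0) count powers of x; for them y^a is the leading part of the binomial. *)
  have := @wge_exp_lead k (1, 0)%N 0 A (fps_of_poly (binom_poly a b xi))
    (monom2 1 0 a) (@wge0 _ _ _).
  rewrite fps_of_binom addrC addKr => /(_ _ 0%N n).
  rewrite /dot /= mul0n !muln0 addn0 => /(_ _ isT); rewrite coef2B => h.
  rewrite fps_of_polyB fps_of_polyX fps_of_binom coef2B => e.
  have {}h : coef2 ((monom2 1 0 a + monom2 xi b 0) ^+ A) 0 n =
      coef2 (monom2 (1 : k) 0 a ^+ A) 0 n.
    apply/eqP; rewrite -subr_eq0 h// => m n'; rewrite /dot/= mul1n mul0n addn0 ltnS leqn0.
    by move=> /eqP ->; rewrite coef2_monom (ltn_eqF b0).
  move/eqP: e; rewrite h subr_eq0 => /eqP.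
  by rewrite monom2X expr1n mul0n coef2_monom eqxx.
have aA0 : (0 < a * A)%N by rewrite muln_gt0 a0.
apply: irreducible_degree => //; last by rewrite ftE// eqxx; apply/eqP; exact: oner_neq0.
by move=> n lt; rewrite ftE ?ltn_eqF// ltnW.
Qed.

Lemma monic_prod_size (A : comNzRingType) I (r : seq I) (P : pred I) (F : I -> {poly A}) :
  (forall i, P i -> F i \is monic) ->
  \prod_(i <- r | P i) F i \is monic /\
  (size (\prod_(i <- r | P i) F i)).-1 = (\sum_(i <- r | P i) (size (F i)).-1)%N.
Proof.
move=> h; split; first exact: monic_prod.
elim: r => [|i r IH]; first by rewrite !big_nil size_poly1.
rewrite !big_cons; case: ifP => // Pi; rewrite -IH.
have m := monic_prod r h.
rewrite size_monicM ?monic_neq0 ?h//.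
have : (0 < size (F i))%N by rewrite size_poly_gt0 monic_neq0 ?h.
have : (0 < size (\prod_(i <- r | P i) F i)%R)%N by rewrite size_poly_gt0 monic_neq0.
by move: (size (F i)) (size (\prod_(i <- r | P i) F i)) => x y; clear; lia.
Qed.

Lemma map_fps_inj (k k' : fieldType) (iota : {rmorphism k -> k'}) :
  injective (map_fps iota).
Proof.
by move=> f g e; apply/fpsP => n; apply: (fmorph_inj iota);
  have := congr1 (fun h : fps k' => h n) e.
Qed.

Lemma map_binom (A B : comNzRingType) (iota : {rmorphism A -> B}) a b xi :
  map_poly (map_fps iota) (binom_poly a b xi) = binom_poly a b (iota xi).
Proof.
rewrite /binom_poly rmorphD /= map_polyXn map_polyC; congr (_ + _%:P).
by apply/fpsP => n /=; rewrite rmorphMn.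
Qed.

(** The single factors live over the extension, where irreducibility gives their degrees. Their
    product is defined over the small field, and the injectivity of [iota] brings degree and leading
    form down to it. *)
Lemma group_lead (k k' : fieldType) (iota : {rmorphism k -> k'}) a b (xi : k)
    n (A : nat -> nat) (ft : nat -> {poly fps k'}) (fl : {poly fps k}) :
  (0 < a)%N -> (0 < b)%N -> (forall t, (t < n)%N -> (0 < A t)%N) ->
  (forall t, (t < n)%N -> wge (a, b) (a * b * A t).+1
     (fps_of_poly (ft t - binom_poly a b (iota xi) ^+ A t))) ->
  (forall t, (t < n)%N -> ft t \is monic /\ irreducible_elt (ft t)) ->
  fl \is monic -> map_poly (map_fps iota) fl = \prod_(t < n) ft t ->
  size fl = (a * \sum_(t < n) A t).+1 /\
  wge (a, b) (a * b * \sum_(t < n) A t).+1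
     (fps_of_poly (fl - binom_poly a b xi ^+ (\sum_(t < n) A t))).
Proof.
move=> a0 b0 A0 lead spec mfl fE.
have sz : (size fl).-1 = (a * \sum_(t < n) A t)%N.
  rewrite -(size_map_inj_poly (@map_fps_inj _ _ iota)) ?rmorph0// fE.
  have [_ ->] := @monic_prod_size _ _ (index_enum 'I_n) predT (fun t => ft t)
    (fun t _ => (spec t (ltn_ord t)).1).
  rewrite big_distrr /=; apply: eq_bigr => t _.
  have [m irr] := spec t (ltn_ord t).
  by rewrite (factor_degree a0 b0 (A0 _ (ltn_ord t)) (lead _ (ltn_ord t)) m irr).
split; first by rewrite -sz prednK// size_poly_gt0 monic_neq0.
have h0 (t : 'I_n) : true ->
    wge (a, b) (a * b * A t) (fps_of_poly (binom_poly a b (iota xi)) ^+ A t).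
  by move=> _; apply: wgeX; apply: wge_binom.
have h1 (t : 'I_n) : true -> wge (a, b) (a * b * A t).+1
    (fps_of_poly (ft t) - fps_of_poly (binom_poly a b (iota xi)) ^+ A t).
  by move=> _; rewrite -fps_of_polyX -fps_of_polyB; apply: lead.
have [_] := wge_prod_lead (index_enum 'I_n) h0 h1.
rewrite -big_distrr /= -fps_of_poly_prod -fE prodrXr -map_binom.
rewrite -fps_of_polyX -rmorphXn -!map_fps2_of_poly /=; set S := (\sum_(t < n) _)%N => h.
move=> i j lt; apply: (fmorph_inj iota); rewrite raddf0 -coef2_map -[RHS](h i j lt).
by rewrite fps_of_polyB !coef2B !coef2_map raddfB.
Qed.

Lemma coefM_top (A : nzRingType) (p q : {poly A}) n m :
  (size p <= n.+1)%N -> (size q <= m.+1)%N -> (p * q)`_(n + m) = p`_n * q`_m.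
Proof.
move=> sp sq; rewrite coefM.
have ln : (n < (n + m).+1)%N by rewrite ltnS leq_addr.
rewrite (bigD1 (Ordinal ln))//= addKn big1 ?addr0// => i /eqP ne.
case: (ltngtP n i) => h; first by rewrite nth_default ?mul0r// (leq_trans sp).
  rewrite [q`__]nth_default ?mulr0// (leq_trans sq)// ltn_subRL.
  by rewrite ltn_add2r.
by case: ne; apply: val_inj.
Qed.

(* Descending induction on the exponent n of y: comparing the coefficients of
   y^(a (A - 1) + n) in g and h^A determines the coefficient of y^n in h. *)
Lemma tschirnhausen_lead (k : fieldType) a b A (xi : k) (g h : {poly fps k}) :
  [pchar k] =i pred0 -> (0 < a)%N -> (0 < A)%N ->
  wge (a, b) (a * b * A).+1 (fps_of_poly (g - binom_poly a b xi ^+ A)) ->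
  h \is monic -> size h = a.+1 -> (size (g - h ^+ A)%R <= a * A - a)%N ->
  wge (a, b) (a * b).+1 (fps_of_poly (h - binom_poly a b xi)).
Proof.
move=> ch a0 A0 lead mh sh szgh; set P := binom_poly a b xi in lead *.
have [mP sP] := binom_monic b xi a0.
have AE : (a * A = a + a * A.-1)%N by rewrite -[in LHS](prednK A0) mulnS.
have szX (p : {poly fps k}) i : p \is monic -> size p = a.+1 -> size (p ^+ i) = (a * i).+1.
  move=> mp sp; elim: i => [|i IH]; first by rewrite muln0 expr0 size_poly1.
  by rewrite exprS size_monicM ?monic_neq0 ?monic_exp// IH sp mulnS; lia.
suff C j : forall m n, (a - j <= n)%N -> (dot (a, b) (m, n) <= a * b)%N ->
    ((h - P)`_n : fps k) m = 0.
  by move=> m n lt; apply: (C a); rewrite ?subnn.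
elim: j => [|j IH] m n.
  rewrite subn0 => le _; rewrite coefB.
  case: (eqVneq n a) => [->|ne].
    move: (monicP mh) (monicP mP); rewrite !lead_coefE sh sP /= => -> ->.
    by rewrite subrr.
  by rewrite !nth_default ?subrr// ?sh ?sP; lia.
case: (leqP (a - j) n) => [le _|lt le]; first exact: IH.
have {le lt} [nE na] : (a - j.+1 = n /\ n < a)%N by lia.
move=> dle; have {}IH : forall m n', (n < n')%N ->
    (dot (a, b) (m, n') <= a * b)%N -> ((h - P)`_n' : fps k) m = 0.
  by move=> m' n' lt; apply: IH; lia.
(* [P'] agrees with h in degrees above n and with P up to degree n. By induction it has the leading
   form of P, while [h - P'] has degree at most n. *)
pose E := \poly_(i < n.+1) (h - P)`_i; pose P' : {poly fps k} := h - E.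
have P'E : P' - P = h - P - E by rewrite /P' addrAC.
have hP : h - P' = E by rewrite /P' opprB addrC subrK.
have sE : (size E <= n.+1)%N by apply: size_poly.
have leadP' : wge (a, b) (a * b).+1 (fps_of_poly P' - fps_of_poly P).
  rewrite -fps_of_polyB P'E => m' n' lt; rewrite /coef2 /= coefB coef_poly.
  by case: ltnP => [_|h']; rewrite ?subrr ?subr0//; apply: IH.
have leadX := wge_exp_lead (n := A) (@wge_binom k a b xi) leadP'.
have sEh : (size (- E)%R < size h)%N by rewrite size_polyN sh (leq_ltn_trans sE).
have mP' : P' \is monic by rewrite monicE /P' lead_coefDl// (monicP mh).
have sP' : size P' = a.+1 by rewrite /P' size_polyDl.
(* The difference of powers is [E] times a sum of A monic polynomials of degree a (A - 1). *)
have top : (h ^+ A - P' ^+ A)`_(n + a * A.-1) = E`_n *+ A.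
  rewrite subrXX hP coefM_top//; last first.
    rewrite (leq_trans (size_sum _ _ _))//; apply/bigmax_leqP => i _.
    rewrite size_monicM ?monic_exp// ?monic_neq0 ?monic_exp// !szX//.
    rewrite addSn /= addnS ltnS -mulnDr leq_mul2l; apply/orP; right.
    by have := ltn_ord i; lia.
  rewrite coef_sum; under eq_bigr => i _.
    rewrite (_ : (h ^+ (A.-1 - i) * P' ^+ i)`_(a * A.-1) = 1); first over.
    have mm : h ^+ (A.-1 - i) * P' ^+ i \is monic by rewrite rpredM ?rpredX.
    have ss : size (h ^+ (A.-1 - i) * P' ^+ i) = (a * A.-1).+1.
      rewrite size_monicM ?monic_exp// ?monic_neq0 ?monic_exp// !szX//.
      rewrite addSn /= addnS -mulnDr subnK//.
      by have := ltn_ord i; lia.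
    by move/monicP: mm; rewrite lead_coefE ss.
  by rewrite sumr_const card_ord mulr_natr.
(* This degree is at least a A - a, where the Tschirnhausen condition leaves no term. *)
have gh : (g - h ^+ A)`_(n + a * A.-1) = 0.
  by apply: nth_default; rewrite (leq_trans szgh)// AE addKn leq_addl.
have z : (E`_n *+ A : fps k) m = 0.
  rewrite -top; have -> : h ^+ A - P' ^+ A = (g - P ^+ A) - (P' ^+ A - P ^+ A) -
      (g - h ^+ A) by ring.
  rewrite coefB gh subr0 coefB.
  have w : (dot (a, b) (m, n + a * A.-1) < (a * b * A).+1)%N.
    by move: dle; rewrite /dot /= -[in X in (_ < X)%N](prednK A0); nia.
  have := leadX m (n + a * A.-1)%N w; rewrite -!fps_of_polyX -fps_of_polyB => e2.
  by move: (lead m _ w) e2; rewrite /coef2 /= => -> ->; rewrite subrr.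
have : (h - P)`_n m *+ A = 0.
  by rewrite -fps_mulrn; move: z; rewrite /E coef_poly ltnSn.
(* Characteristic 0 allows the division by A. *)
move/eqP; rewrite -mulr_natr mulf_eq0 ((pcharf0P k).1 ch) => /orP[/eqP//|/eqP A00].
by move: A0; rewrite A00.
Qed.

End LeadingForm.

Section InitialForm.
Variable A : comNzRingType.
Implicit Types (F G : fps2 A) (X Y : A) (t : nat * nat).

(** The part of weighted degree d, evaluated at (X, Y). For positive weights, exponents up to d
    suffice. *)
Definition init t d F X Y : A :=
  \sum_(i < d.+1) \sum_(j < d.+1 | dot t (i : nat, j : nat) == d)
    coef2 F i j * (X ^+ i * Y ^+ j).

Lemma initE t d D F X Y : (0 < t.1)%N -> (0 < t.2)%N -> (d < D)%N ->
  init t d F X Y = \sum_(i < D) \sum_(j < D)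
    (coef2 F i j * (X ^+ i * Y ^+ j)) *+ (dot t (i : nat, j : nat) == d).
Proof.
move=> t1 t2 dD; rewrite /init.
under eq_bigr => i _ do rewrite big_mkcond.
rewrite (big_ord_widen D (fun i => \sum_(j < d.+1)
  if dot t (i, j : nat) == d then coef2 F i j * (X ^+ i * Y ^+ j) else 0))//.
rewrite big_mkcond /=; apply: eq_bigr => i _; case: ifP => hi; last first.
  rewrite big1// => j _; rewrite (_ : (dot _ _ == _) = false)//.
  by apply/negbTE; rewrite /dot /= neq_ltn; apply/orP; right; nia.
rewrite (big_ord_widen D (fun j =>
  if dot t (i : nat, j) == d then coef2 F i j * (X ^+ i * Y ^+ j) else 0))//.
rewrite big_mkcond /=; apply: eq_bigr => j _; case: ifP => hj.
  by case: ifP.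
rewrite (_ : (dot _ _ == _) = false)//.
by apply/negbTE; rewrite /dot /= neq_ltn; apply/orP; right; nia.
Qed.

Lemma initD t d F G X Y : init t d (F + G) X Y = init t d F X Y + init t d G X Y.
Proof.
rewrite /init -big_split; apply: eq_bigr => i _; rewrite -big_split.
by apply: eq_bigr => j _; rewrite coef2D mulrDl.
Qed.

Lemma init_eq0 t d F X Y : wge t d.+1 F -> init t d F X Y = 0.
Proof.
move=> h; rewrite /init big1// => i _; rewrite big1// => j /eqP e.
by rewrite h ?mul0r// e.
Qed.

Lemma init_lead t d F F0 X Y : wge t d.+1 (F - F0) ->
  init t d F X Y = init t d F0 X Y.
Proof. by move=> h; rewrite -[F in LHS](subrK F0) initD init_eq0// add0r. Qed.

Lemma sum_triangle D (phi : nat -> nat -> A) :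
  \sum_(m < D) \sum_(i < m.+1) phi i (m - i)%N =
  \sum_(i < D) \sum_(j < D) phi i j *+ (i + j < D)%N.
Proof.
have e (i j : 'I_D) : phi i j *+ (i + j < D)%N =
    \sum_(m < D) phi i j *+ (i + j == m)%N.
  case: ltnP => h.
    rewrite (bigD1 (Ordinal h))//= eqxx big1 ?addr0// => m /eqP ne.
    by rewrite (_ : (_ == _) = false)//; apply/eqP => e; apply: ne; apply: val_inj.
  rewrite big1// => m _; rewrite (_ : (_ == _) = false)//.
  by apply/eqP => e; move: h; rewrite e leqNgt ltn_ord.
under [RHS]eq_bigr => i _ do under eq_bigr => j _ do rewrite e.
under [RHS]eq_bigr => i _ do rewrite exchange_big.
rewrite exchange_big; apply: eq_bigr => m _.
rewrite (big_ord_widen D (fun i => phi i (m - i)%N))// big_mkcond /=.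
apply: eq_bigr => i _; case: ltnP => h.
  have l : (m - i < D)%N by rewrite (leq_ltn_trans (leq_subr _ _)).
  rewrite (bigD1 (Ordinal l))//= subnKC// eqxx big1 ?addr0// => j /eqP ne.
  rewrite (_ : (_ == _) = false)//; apply/eqP => e'; apply: ne; apply: val_inj.
  by rewrite /= -e' addKn.
rewrite big1// => j _; rewrite (_ : (_ == _) = false)//.
by apply/eqP => e'; move: h; rewrite -e' ltnNge leq_addr.
Qed.

(** Weighted degree is a grading, so parts of a product are convolutions. Lower bounds on the orders
    of the factors leave a single term, which is [initM]. *)
Lemma initM_sum t d F G X Y : (0 < t.1)%N -> (0 < t.2)%N ->
  init t d (F * G) X Y = \sum_(e < d.+1) init t e F X Y * init t (d - e) G X Y.
Proof.
move=> t1 t2; rewrite (initE _ _ _ t1 t2 (ltnSn d)).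
pose phi i i' j j' := (coef2 F i j * coef2 G i' j') * (X ^+ (i + i') * Y ^+ (j + j'))
  *+ (dot t (i + i', j + j')%N == d).
transitivity (\sum_(m < d.+1) \sum_(n < d.+1)
    \sum_(i < m.+1) \sum_(j < n.+1) phi i (m - i)%N j (n - j)%N).
  apply: eq_bigr => m _; apply: eq_bigr => n _; rewrite coef2M exchange_big.
  rewrite mulr_suml -sumrMnl; apply: eq_bigr => i _.
  rewrite mulr_suml -sumrMnl; apply: eq_bigr => j _.
  by rewrite /phi !subnKC// -ltnS.
transitivity (\sum_(i < d.+1) \sum_(i' < d.+1) \sum_(j < d.+1) \sum_(j' < d.+1)
    phi i i' j j').
  under eq_bigr => m _ do rewrite exchange_big.
  under eq_bigr => m _ do under eq_bigr => i _ do
    rewrite (sum_triangle d.+1 (phi i (m - i)%N)).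
  rewrite (sum_triangle d.+1 (fun i i' => \sum_(j < d.+1) \sum_(j' < d.+1)
    phi i i' j j' *+ (j + j' < d.+1)%N)).
  apply: eq_bigr => i _; apply: eq_bigr => i' _.
  rewrite -sumrMnl; apply: eq_bigr => j _; rewrite -sumrMnl; apply: eq_bigr => j' _.
  rewrite /phi; case: eqP => [|_]; last by rewrite !mul0rn.
  rewrite /dot /= => dE.
  have le p q D : (t.1 * p + t.2 * q = D)%N -> (p < D.+1)%N /\ (q < D.+1)%N by nia.
  by have [-> ->] := le _ _ _ dE.
transitivity (\sum_(e < d.+1)
    (\sum_(i < d.+1) \sum_(j < d.+1) (coef2 F i j * (X ^+ i * Y ^+ j))
       *+ (dot t (i : nat, j : nat) == e)) *
    (\sum_(i < d.+1) \sum_(j < d.+1) (coef2 G i j * (X ^+ i * Y ^+ j))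
       *+ (dot t (i : nat, j : nat) == d - e)%N)); last first.
  apply: eq_bigr => e _; rewrite -!(initE _ _ _ t1 t2)//.
  by rewrite ltnS leq_subr.
under [RHS]eq_bigr => e _.
  rewrite mulr_suml; under eq_bigr => i _.
    rewrite mulr_suml; under eq_bigr => j _.
      rewrite mulr_sumr; under eq_bigr => i' _ do rewrite mulr_sumr.
      over.
    rewrite exchange_big; over.
  over.
rewrite [RHS]exchange_big; apply: eq_bigr => i _.
rewrite [RHS]exchange_big; apply: eq_bigr => i' _.
rewrite [RHS]exchange_big; apply: eq_bigr => j _.
rewrite [RHS]exchange_big; apply: eq_bigr => j' _.
rewrite /phi; set x := coef2 F i j; set y := coef2 G i' j'.
have dE : dot t (i + i', j + j')%N = (dot t (i : nat, j : nat) +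
    dot t (i' : nat, j' : nat))%N by rewrite /dot /= !mulnDr; lia.
rewrite dE; set u := dot t _; set v := dot t _.
transitivity (\sum_(e < d.+1) (x * (X ^+ i * Y ^+ j) * (y * (X ^+ i' * Y ^+ j')))
    *+ ((u == e) && (v == d - e)%N)); last first.
  apply: eq_bigr => e _; rewrite mulrnAl mulrnAr -mulrnA.
  by case: (u == e); case: (v == _).
case: eqP => uv.
  have hu : (u < d.+1)%N by rewrite ltnS -uv leq_addr.
  have vE : v = (d - u)%N by rewrite -[in RHS]uv addKn.
  rewrite (bigD1 (Ordinal hu))//= eqxx {1}vE eqxx big1 ?addr0.
    by rewrite /= !mulr1n !exprD [RHS]mulrACA; congr (_ * _); rewrite mulrACA.
  move=> e /eqP ne; rewrite (_ : (u == e) = false)//.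
  by apply/eqP => e'; apply: ne; apply: val_inj.
rewrite big1// => e _; rewrite (_ : _ && _ = false)//.
apply/negbTE/andP => -[/eqP e1 /eqP e2]; apply: uv.
by rewrite e1 e2 subnKC// -ltnS.
Qed.

Lemma initM t d d' F G X Y : (0 < t.1)%N -> (0 < t.2)%N ->
  wge t d F -> wge t d' G ->
  init t (d + d') (F * G) X Y = init t d F X Y * init t d' G X Y.
Proof.
move=> t1 t2 hF hG; rewrite initM_sum//.
have l : (d < (d + d').+1)%N by rewrite ltnS leq_addr.
rewrite (bigD1 (Ordinal l))//= addKn big1 ?addr0// => e /eqP ne.
case: (ltngtP e d) => h.
- by rewrite init_eq0 ?mul0r//; apply: wge_le hF.
- rewrite [X in _ * X]init_eq0 ?mulr0//; apply: wge_le hG.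
  have := ltn_ord e; lia.
by case: ne; apply: val_inj.
Qed.

Lemma init1 t X Y : init t 0 1 X Y = 1.
Proof.
rewrite /init big_ord1 (bigD1 ord0)/=; last by rewrite /dot !muln0.
rewrite big1 ?addr0 => [|j]; first by rewrite coef2_1 !expr0 !mulr1.
by rewrite ord1 eqxx andbF.
Qed.

Lemma init_prod t I (r : seq I) (P : pred I) (d : I -> nat) (F : I -> fps2 A) X Y :
  (0 < t.1)%N -> (0 < t.2)%N -> (forall i, P i -> wge t (d i) (F i)) ->
  wge t (\sum_(i <- r | P i) d i) (\prod_(i <- r | P i) F i) /\
  init t (\sum_(i <- r | P i) d i) (\prod_(i <- r | P i) F i) X Y =
  \prod_(i <- r | P i) init t (d i) (F i) X Y.
Proof.
move=> t1 t2 h; elim: r => [|i r [IH1 IH2]]; first by rewrite !big_nil init1; split.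
rewrite !big_cons; case: ifP => // Pi; split; first by apply: wgeM => //; apply: h.
by rewrite initM// ?IH2//; apply: h.
Qed.

Lemma initX t d F n X Y : (0 < t.1)%N -> (0 < t.2)%N -> wge t d F ->
  init t (d * n) (F ^+ n) X Y = init t d F X Y ^+ n.
Proof.
move=> t1 t2 h; have [_] := init_prod (index_enum 'I_n) X Y t1 t2
  (fun (i : 'I_n) (_ : true) => h).
by rewrite sum_nat_const card_ord mulnC !prodr_const card_ord.
Qed.

Lemma init_single t d F E X Y : (0 < t.1)%N -> (0 < t.2)%N -> dot t E = d ->
  (forall m n, dot t (m, n) = d -> (m, n) <> E -> coef2 F m n = 0) ->
  init t d F X Y = coef2 F E.1 E.2 * (X ^+ E.1 * Y ^+ E.2).
Proof.
case: E => M N t1 t2 /= dE h; rewrite /init.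
have [hM hN] : (M < d.+1)%N /\ (N < d.+1)%N.
  by rewrite !ltnS -dE /dot /=; split; nia.
rewrite (bigD1 (Ordinal hM))//= (bigD1 (Ordinal hN))/=; last by rewrite dE.
rewrite [X in _ + X + _]big1 ?addr0; last first.
  move=> j /andP[/eqP e /eqP ne]; rewrite h ?mul0r//.
  by move=> [e']; apply: ne; apply: val_inj.
rewrite big1 ?addr0// => i /eqP ne; rewrite big1// => j /eqP e.
by rewrite h ?mul0r// => -[e' _]; apply: ne; apply: val_inj.
Qed.

Lemma init_monom t c M N X Y : (0 < t.1)%N -> (0 < t.2)%N ->
  init t (dot t (M, N)) (monom2 c M N) X Y = c * (X ^+ M * Y ^+ N).
Proof.
move=> t1 t2; rewrite (init_single _ _ t1 t2 (erefl _)) ?coef2_monom ?eqxx//=.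
move=> m n _ ne; rewrite coef2_monom; case: eqP => // em; case: eqP => // en.
by case: ne; rewrite em en.
Qed.

Lemma init_binom a b xi X Y : (0 < a)%N -> (0 < b)%N ->
  init (a, b) (a * b) (fps_of_poly (binom_poly a b xi)) X Y = Y ^+ a + xi * X ^+ b.
Proof.
move=> a0 b0; rewrite fps_of_binom initD.
have := @init_monom (a, b) 1 0 a X Y a0 b0.
rewrite /dot /= muln0 add0n mulnC => ->; rewrite !mul1r; congr (_ + _).
by have := @init_monom (a, b) xi b 0 X Y a0 b0; rewrite /dot /= muln0 addn0 => ->;
  rewrite mulr1.
Qed.

(** Moves a point along the one-parameter subgroup of weight t; the vanishing of [init] will
    therefore depend on the torus coordinate only. *)
Lemma init_homog t d F X Y z :
  init t d F (z ^+ t.1 * X) (z ^+ t.2 * Y) = z ^+ d * init t d F X Y.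
Proof.
rewrite /init mulr_sumr; apply: eq_bigr => i _.
rewrite mulr_sumr; apply: eq_bigr => j /eqP e.
rewrite [RHS]mulrCA; congr (_ * _).
rewrite -[X in _ = z ^+ X * _]e /dot /= exprD [RHS]mulrACA.
by rewrite !exprMn -!exprM.
Qed.

End InitialForm.

(** * Newton segment and initial forms of one factor f_il *)

Section FactorOrder.
Variables (A : comNzRingType) (a b S : nat) (xi : A) (fl : {poly fps A}).
Hypotheses (a0 : (0 < a)%N) (b0 : (0 < b)%N) (mfl : fl \is monic)
  (sfl : size fl = (a * S).+1)
  (lead : wge (a, b) (a * b * S).+1 (fps_of_poly (fl - binom_poly a b xi ^+ S))).

(** The minimum of the weight t on the segment from (b S, 0) to (0, a S), the Newton segment of the
    factor. *)
Definition factor_order (a b S : nat) (t : nat * nat) :=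
  (minn (t.1 * b) (t.2 * a) * S)%N.

Lemma factor_wge_ab : wge (a, b) (a * b * S) (fps_of_poly fl).
Proof.
apply: (@wge_lead _ _ _ _ (fps_of_poly (binom_poly a b xi ^+ S))).
  by rewrite fps_of_polyX; apply: wgeX; apply: wge_binom.
by rewrite -fps_of_polyB.
Qed.

(** If t.1 b < t.2 a, the vector a t dominates t.1 (a, b) entrywise, so the order for the weights
    (a, b) gives the one for t. The other case is symmetric, with b t and t.2 (a, b). *)
Lemma factor_wge t : wge t (factor_order a b S t) (fps_of_poly fl).
Proof.
move=> m n; rewrite /factor_order /dot /= => lt; apply: factor_wge_ab.
rewrite /dot /=; move: lt; rewrite /minn; case: (ltnP (t.1 * b) (t.2 * a)) => h lt.
  have h1 : (t.1 * (a * m + b * n) <= a * (t.1 * m + t.2 * n))%N.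
    by have := leq_mul (ltnW h) (leqnn n); nia.
  have h2 : (a * (t.1 * m + t.2 * n) < a * (t.1 * b * S))%N by rewrite ltn_pmul2l.
  have := leq_ltn_trans h1 h2; rewrite (_ : a * (t.1 * b * S) = t.1 * (a * b * S))%N.
    by rewrite ltn_mul2l => /andP[].
  by rewrite !mulnA [(a * t.1)%N]mulnC.
have h1 : (t.2 * (a * m + b * n) <= b * (t.1 * m + t.2 * n))%N.
  by have := leq_mul h (leqnn m); nia.
have h2 : (b * (t.1 * m + t.2 * n) < b * (t.2 * a * S))%N by rewrite ltn_pmul2l.
have := leq_ltn_trans h1 h2; rewrite (_ : b * (t.2 * a * S) = t.2 * (a * b * S))%N.
  by rewrite ltn_mul2l => /andP[].
by rewrite !mulnA [(b * t.2)%N]mulnC -[(t.2 * b * a)%N]mulnA [(b * a)%N]mulnC mulnA.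
Qed.

(** Rests on the exact degree a S in y, obtained from irreducibility. *)
Lemma factor_coef_y : coef2 (fps_of_poly fl) 0 (a * S) = 1.
Proof.
by rewrite /coef2 /= -[X in nth _ _ X]/((a * S).+1.-1) -sfl -lead_coefE (monicP mfl).
Qed.

Lemma factor_coef_x : coef2 (fps_of_poly fl) (b * S) 0 = xi ^+ S.
Proof.
have : coef2 (fps_of_poly (fl - binom_poly a b xi ^+ S)) (b * S) 0 = 0.
  by apply: lead; rewrite /dot /= muln0 addn0 mulnA.
rewrite fps_of_polyB coef2B => /eqP; rewrite subr_eq0 => /eqP ->.
(* Counting powers of y only, the leading part of the binomial is xi x^b. *)
have := @wge_exp_lead A (0, 1)%N 0 S (fps_of_poly (binom_poly a b xi))
  (monom2 xi b 0) (@wge0 _ _ _).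
rewrite fps_of_polyX fps_of_binom addrK => /(_ _ (b * S)%N 0%N).
rewrite /dot /= mul0n !muln0 addn0 => /(_ _ isT); rewrite coef2B => h.
have /eqP : coef2 ((monom2 1 0 a + monom2 xi b 0) ^+ S) (b * S) 0 -
    coef2 (monom2 xi b 0 ^+ S) (b * S) 0 = 0.
  apply: h => m n'; rewrite /dot/= mul1n mul0n add0n ltnS leqn0.
  by move=> /eqP ->; rewrite coef2_monom (ltn_eqF a0) andbF.
by rewrite subr_eq0 => /eqP ->; rewrite monom2X coef2_monom mul0n !eqxx.
Qed.

(** Weights up to (a, b) in the order of rays are minimal at the end of the segment on the y-axis;
    later ones, in [factor_vertex_hi], at the end on the x-axis. When (a, b) is a ray of the fan,
    both rays of a cone are on the same side of it. *)
Lemma factor_vertex_lo t t' : 0 <= detv t (a, b) -> 0 <= detv t' (a, b) ->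
  let E := (0, a * S)%N in vertex t t' E 1 (fps_of_poly fl) /\
  dot t E = factor_order a b S t /\ dot t' E = factor_order a b S t'.
Proof.
move=> ht ht' E.
have e u : 0 <= detv u (a, b) -> dot u E = factor_order a b S u.
  rewrite /detv /dot /factor_order /E /= => h.
  by rewrite (minn_idPr _) ?muln0 ?add0n ?mulnA//; lia.
split; last by rewrite !e.
by split; rewrite ?e//; [apply: factor_wge|apply: factor_wge|apply: factor_coef_y].
Qed.

Lemma factor_vertex_hi t t' : 0 <= detv (a, b) t -> 0 <= detv (a, b) t' ->
  let E := (b * S, 0)%N in vertex t t' E (xi ^+ S) (fps_of_poly fl) /\
  dot t E = factor_order a b S t /\ dot t' E = factor_order a b S t'.
Proof.
move=> ht ht' E.
have e u : 0 <= detv (a, b) u -> dot u E = factor_order a b S u.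
  rewrite /detv /dot /factor_order /E /= => h.
  by rewrite (minn_idPl _) ?muln0 ?addn0 ?mulnA//; lia.
split; last by rewrite !e.
by split; rewrite ?e//; [apply: factor_wge|apply: factor_wge|apply: factor_coef_x].
Qed.

Lemma factor_init_eq X Y : init (a, b) (factor_order a b S (a, b)) (fps_of_poly fl) X Y =
  (Y ^+ a + xi * X ^+ b) ^+ S.
Proof.
have -> : factor_order a b S (a, b) = (a * b * S)%N.
  by rewrite /factor_order /= [(b * a)%N]mulnC minnn.
rewrite (@init_lead _ _ _ _ (fps_of_poly (binom_poly a b xi ^+ S))) -?fps_of_polyB//.
by rewrite fps_of_polyX initX ?init_binom//; apply: wge_binom.
Qed.

(** Strictly before (a, b) one monomial is minimal: another exponent of the same weight t has a
    positive power of x, hence weight below a b S for (a, b), where coefficients vanish. *)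
Lemma factor_init_lo t X Y : (0 < t.1)%N -> (0 < t.2)%N -> vlt t (a, b) ->
  init t (factor_order a b S t) (fps_of_poly fl) X Y = Y ^+ (a * S).
Proof.
rewrite /vlt /detv /= => t1 t2 lt; have dE : dot t (0, a * S)%N = factor_order a b S t.
  by rewrite /dot /factor_order /= (minn_idPr _) ?muln0 ?add0n ?mulnA//; lia.
rewrite (init_single _ _ t1 t2 dE) /= ?factor_coef_y ?mul1r//.
move=> m n e ne; apply: factor_wge_ab.
have m0 : (0 < m)%N.
  case: m e ne => // e ne; exfalso; apply: ne; congr pair; move: e; rewrite -dE /dot /=.
  by rewrite !muln0 !add0n => /eqP; rewrite eqn_mul2l (gtn_eqF t2) => /eqP.
have lt' : (t.2 * a < t.1 * b)%N by lia.
by move: e; rewrite -dE /dot /= muln0 add0n; nia.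
Qed.

Lemma factor_init_hi t X Y : (0 < t.1)%N -> (0 < t.2)%N -> vlt (a, b) t ->
  init t (factor_order a b S t) (fps_of_poly fl) X Y = xi ^+ S * X ^+ (b * S).
Proof.
rewrite /vlt /detv /= => t1 t2 lt; have dE : dot t (b * S, 0)%N = factor_order a b S t.
  by rewrite /dot /factor_order /= (minn_idPl _) ?muln0 ?addn0 ?mulnA//; lia.
rewrite (init_single _ _ t1 t2 dE) /= ?factor_coef_x ?mulr1//.
move=> m n e ne; apply: factor_wge_ab.
have n0 : (0 < n)%N.
  case: n e ne => // e ne; exfalso; apply: ne; congr pair; move: e; rewrite -dE /dot /=.
  by rewrite !muln0 !addn0 => /eqP; rewrite eqn_mul2l (gtn_eqF t1) => /eqP.
have lt' : (t.1 * b < t.2 * a)%N by lia.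
by move: e; rewrite -dE /dot /= muln0 addn0; nia.
Qed.

End FactorOrder.

(** * The fan and the toric charts *)

Section FanGeometry.
Implicit Types P Q V : nat * nat.

Lemma det_mx2 (A : comPzRingType) (M : 'M[A]_2) :
  \det M = M 0 0 * M 1 1 - M 0 1 * M 1 0.
Proof.
rewrite (expand_det_row _ ord0) !big_ord_recl big_ord0 addr0 /cofactor !det_mx11 !mxE.
rewrite /= expr0 mul1r expr1 mulN1r mulrN.
by congr (_ * M _ _ - M _ _ * M _ _); apply: val_inj.
Qed.

Lemma ord2_cases (i : 'I_2) : i = 0 \/ i = 1.
Proof. by case: i => -[|[|]]// h; [left|right]; apply: val_inj. Qed.

Lemma detv_nn P Q : detv P Q = - detv Q P.
Proof. by rewrite /detv; lia. Qed.

(** The linear relation det(P,V) Q = det(Q,V) P + det(P,Q) V, paired with the form x + y. This form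
    is positive on nonzero vectors of the quadrant, which makes [vlt] transitive. *)
Lemma detv_cross P Q V : (detv P V) * (Q.1 + Q.2)%:Z =
  (detv Q V) * (P.1 + P.2)%:Z + (detv P Q) * (V.1 + V.2)%:Z.
Proof. by rewrite /detv !PoszD; ring. Qed.

Lemma detv_gt0 P Q : 0 < detv P Q -> (0 < P.1 + P.2)%N /\ (0 < Q.1 + Q.2)%N.
Proof.
case: P Q => [a b] [c d]; rewrite /detv /= => h; split; rewrite lt0n; apply/eqP => e.
  have [e1 e2] : a = 0%N /\ b = 0%N by lia.
  by move: h; rewrite e1 e2; lia.
have [e1 e2] : c = 0%N /\ d = 0%N by lia.
by move: h; rewrite e1 e2; lia.
Qed.

Lemma vlt_trans : transitive vlt.
Proof.
move=> Q P V; rewrite /vlt => h1 h2; have e := detv_cross P Q V.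
have [p0 q0] := detv_gt0 h1; have [_ v0] := detv_gt0 h2.
have: 0 < detv P V * (Q.1 + Q.2)%:Z by rewrite e addr_gt0// mulr_gt0// ltz_nat.
by rewrite pmulr_lgt0// ltz_nat.
Qed.

Variable T : seq (nat * nat).
Hypothesis reg : regular_subdivision T.

Lemma ray0 : ray T 0 = (1, 0)%N. Proof. by []. Qed.
Lemma rayE j : ray T j.+1 = nth (0, 1)%N T j. Proof. by []. Qed.
Lemma ray_last : ray T (size T).+1 = (0, 1)%N.
Proof. by rewrite rayE nth_default. Qed.

Lemma coneE j : [/\ cone T j 0 0 = (ray T j).1%:Z, cone T j 1 0 = (ray T j).2%:Z,
  cone T j 0 1 = (ray T j.+1).1%:Z & cone T j 1 1 = (ray T j.+1).2%:Z].
Proof. by split; rewrite mxE ?addn0 ?addn1. Qed.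

Lemma ray_det j : (j <= size T)%N -> detv (ray T j) (ray T j.+1) = 1.
Proof.
case: reg => _ _ _ h /h; rewrite det_mx2; have [-> -> -> ->] := coneE j => <-.
by rewrite /detv; lia.
Qed.

Lemma ray_vltS j : (j <= size T)%N -> vlt (ray T j) (ray T j.+1).
Proof. by move=> h; rewrite /vlt ray_det. Qed.

Lemma ray_vlt i j : (i < j)%N -> (j <= (size T).+1)%N -> vlt (ray T i) (ray T j).
Proof.
elim: j => // j IH; rewrite ltnS leq_eqVlt => /orP[/eqP ->|lt] h; first exact: ray_vltS.
by apply: vlt_trans (IH lt (ltnW h)) (ray_vltS _).
Qed.

Lemma ray_det_ge0 i j : (i <= j)%N -> (j <= (size T).+1)%N ->
  0 <= detv (ray T i) (ray T j).
Proof.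
rewrite leq_eqVlt => /orP[/eqP ->|lt] h; first by rewrite /detv; lia.
by apply: ltW; apply: ray_vlt.
Qed.

Lemma ray_pos j : (0 < j)%N -> (j <= size T)%N ->
  (0 < (ray T j).1)%N /\ (0 < (ray T j).2)%N.
Proof.
move=> j0 h; have := ray_vlt j0 (leq_trans h (leqnSn _)).
have := ray_vlt (h : j < (size T).+1)%N (leqnn _).
by rewrite ray_last ray0 /vlt /detv /=; lia.
Qed.

(* The index j such that V lies in the cone spanned by ray j and ray j.+1,
   outside ray j.+1. *)
Definition cell V : nat := find (fun P => detv P V < 0) T.

Lemma cell_le V : (cell V <= size T)%N. Proof. exact: find_size. Qed.

Lemma cellP V : (0 < V.1)%N -> (0 < V.2)%N ->
  0 <= detv (ray T (cell V)) V /\ detv (ray T (cell V).+1) V < 0.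
Proof.
move=> V1 V2; split.
  case e: (cell V) => [|j]; first by rewrite ray0 /detv /=; lia.
  rewrite rayE leNgt; apply/negP => h.
  have lt : (j < find (fun P => (detv P V < 0)%R) T)%N by rewrite -[find _ _]/(cell V) e.
  by have /= := before_find (0, 1)%N lt; rewrite h.
rewrite rayE; case: (boolP (has (fun P => detv P V < 0) T)) => h.
  by have := nth_find (0, 1)%N h.
rewrite nth_default; first by rewrite /detv /=; lia.
by rewrite leqNgt -has_find.
Qed.

Definition comb j (k l : nat) : nat * nat :=
  (k * (ray T j).1 + l * (ray T j.+1).1, k * (ray T j).2 + l * (ray T j.+1).2)%N.

(** Cramer's rule in the basis of the cone, whose determinant is 1: the coefficients are
    determinants, hence integers. That k is positive says that V is not on the second ray. *)
Lemma comb_cell V : (0 < V.1)%N -> (0 < V.2)%N -> exists k l : nat,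
  [/\ (0 < k)%N, V = comb (cell V) k l, l = `|detv (ray T (cell V)) V|%N
    & k = `|detv (ray T (cell V).+1) V|%N].
Proof.
move=> V1 V2; have [h1 h2] := cellP V1 V2; have d1 := ray_det (cell_le V).
exists `|detv (ray T (cell V).+1) V|%N, `|detv (ray T (cell V)) V|%N; split=> //.
  by lia.
have kE : `|detv (ray T (cell V).+1) V|%N%:Z = - detv (ray T (cell V).+1) V by lia.
have lE : `|detv (ray T (cell V)) V|%N%:Z = detv (ray T (cell V)) V by lia.
move: kE lE d1; rewrite /comb; set k := absz _; set l := absz _.
move: (ray T (cell V)) (ray T (cell V).+1) k l => [a b] [c d] k l.
case: V V1 V2 {h1 h2} => x y _ _; rewrite /detv /= => kE lE d1.
congr pair; apply/eqP; rewrite -eqz_nat PoszD !PoszM kE lE; apply/eqP.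
  by rewrite -[LHS]mul1r -d1; ring.
by rewrite -[LHS]mul1r -d1; ring.
Qed.

Lemma detv_comb Q j k l : detv Q (comb j k l) =
  k%:Z * detv Q (ray T j) + l%:Z * detv Q (ray T j.+1).
Proof. by rewrite /detv /comb /= !PoszD !PoszM; ring. Qed.

(** If the cell had another index, both generators of cone j would lie on one side of a ray bounding
    that cell, giving the determinant with it a sign that [cellP] excludes. *)
Lemma cell_comb j k l : (j <= size T)%N -> (0 < k)%N ->
  (0 < (comb j k l).1)%N -> (0 < (comb j k l).2)%N ->
  [/\ cell (comb j k l) = j, detv (ray T j) (comb j k l) = l%:Z
    & detv (ray T j.+1) (comb j k l) = - k%:Z].
Proof.
move=> hj k0 c1 c2; set V := comb j k l.
have d1 := ray_det hj.
have e1 : detv (ray T j) V = l%:Z.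
  by rewrite detv_comb d1 mulr1 /detv; lia.
have e2 : detv (ray T j.+1) V = - k%:Z.
  by rewrite detv_comb [detv (ray T j.+1) (ray T j)]detv_nn d1 /detv; lia.
have [h1 h2] := cellP c1 c2; split=> //; apply/eqP; rewrite eqn_leq; apply/andP; split.
  rewrite leqNgt; apply/negP => lt.
  move: h1; rewrite leNgt detv_comb => /negP; apply.
  have ge1 : 0 < detv (ray T j) (ray T (cell V)).
    by apply: ray_vlt => //; apply: leq_trans (cell_le V) _.
  have ge2 : 0 <= detv (ray T j.+1) (ray T (cell V)).
    by apply: ray_det_ge0 => //; apply: leq_trans (cell_le V) _.
  rewrite detv_nn [detv _ (ray T j.+1)]detv_nn !mulrN -opprD oppr_lt0.
  by rewrite ltr_pwDl ?mulr_gt0 ?mulr_ge0 ?ltz_nat.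
rewrite leqNgt; apply/negP => lt; move: h2; rewrite ltNge detv_comb => /negP; apply.
have ge1 : 0 <= detv (ray T (cell V).+1) (ray T j).
  by apply: ray_det_ge0 => //; apply: leq_trans hj _.
have ge2 : 0 <= detv (ray T (cell V).+1) (ray T j.+1).
  by apply: ray_det_ge0 => //; rewrite ltnW.
by rewrite addr_ge0 ?mulr_ge0.
Qed.

Lemma dot_ray_inj j E E' : (j <= size T)%N -> dot (ray T j) E = dot (ray T j) E' ->
  dot (ray T j.+1) E = dot (ray T j.+1) E' -> E = E'.
Proof. by move=> /ray_vltS; apply: dot_inj. Qed.

Lemma comb_dot j k l E : (dot (comb j k l) E =
  k * dot (ray T j) E + l * dot (ray T j.+1) E)%N.
Proof. by rewrite /dot /comb /= !mulnDr !mulnDl !mulnA; lia. Qed.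

(** The adjugate, which is the inverse since the determinant is 1. *)
Definition cone_inv j : 'M[int]_2 := \matrix_(r < 2, e < 2)
  (if r == 0 then (if e == 0 then (ray T j.+1).2%:Z else - (ray T j.+1).1%:Z)
   else (if e == 0 then - (ray T j).2%:Z else (ray T j).1%:Z)).

Lemma invmx_cone j : (j <= size T)%N -> invmx (cone T j) = cone_inv j.
Proof.
move=> hj; have [_ _ _ /(_ _ hj) d1] := reg.
have u : cone T j \in unitmx by rewrite unitmxE d1 unitr1.
have e : cone_inv j *m cone T j = 1%:M.
  have [e1 e2 e3 e4] := coneE j; have := ray_det hj; rewrite /detv => dt.
  have l1 : lift ord0 ord0 = 1 :> 'I_2 by apply: val_inj.
  apply/matrixP => r c; rewrite [LHS]mxE !big_ord_recl big_ord0 addr0 l1.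
  have [->|->] := ord2_cases r; have [->|->] := ord2_cases c;
    rewrite ?e1 ?e2 ?e3 ?e4 [cone_inv j _ _]mxE [cone_inv j _ _]mxE mxE /=; lia.
by rewrite -[LHS]mul1mx -e -mulmxA mulmxV// mulmx1.
Qed.

End FanGeometry.

Section Pullback.
Variables (A : comNzRingType) (T : seq (nat * nat)).
Hypothesis reg : regular_subdivision T.
Implicit Types (F : fps2 A).

Lemma pullback_set j m n : [set e : nat * nat |
      e.1%:Z * cone T j 0 0 + e.2%:Z * cone T j 1 0 = m%:Z /\
      e.1%:Z * cone T j 0 1 + e.2%:Z * cone T j 1 1 = n%:Z] =
  [set e | dot (ray T j) e = m /\ dot (ray T j.+1) e = n].
Proof.
have [-> -> -> ->] := coneE T j; rewrite /dot.
by apply/seteqP; split => e /= [h1 h2]; split; lia.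
Qed.

Lemma coef2_pullback j F e : (j <= size T)%N ->
  coef2 (pullback (cone T j) F) (dot (ray T j) e) (dot (ray T j.+1) e) =
  coef2 F e.1 e.2.
Proof.
move=> hj; rewrite /pullback /coef2 /= pullback_set.
rewrite (_ : [set _ | _] = [set e]) ?fsbig_set1//.
apply/seteqP; split => e' /=; last by move=> ->.
by move=> [h1 h2]; apply: (dot_ray_inj reg hj).
Qed.

Lemma coef2_pullback0 j F m n :
  (forall e, dot (ray T j) e = m -> dot (ray T j.+1) e = n -> coef2 F e.1 e.2 = 0) ->
  coef2 (pullback (cone T j) F) m n = 0.
Proof.
move=> h; rewrite /pullback /coef2 /= pullback_set fsbig1// => e /= [h1 h2].
exact: h.
Qed.

Lemma coef2_pullback_neq0 j F m n : coef2 (pullback (cone T j) F) m n <> 0 ->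
  exists e, [/\ dot (ray T j) e = m, dot (ray T j.+1) e = n & coef2 F e.1 e.2 <> 0].
Proof.
move=> ne; apply: contrapT => h; apply: ne; apply: coef2_pullback0 => e h1 h2.
by apply: contrapT => h3; apply: h; exists e.
Qed.

Lemma multxP F N : (exists n, coef2 F N n <> 0) ->
  (forall m n, (m < N)%N -> coef2 F m n = 0) -> multx F = N.
Proof.
move=> h1 h2; rewrite /multx; case: xgetP => [M _ [[n hn] low]|/(_ N)]; last by case.
case: (ltngtP M N) => // lt; first by case: hn; apply: h2.
by case: h1 => n' []; apply: low.
Qed.

Lemma multyP F N : (exists m, coef2 F m N <> 0) ->
  (forall m n, (n < N)%N -> coef2 F m n = 0) -> multy F = N.
Proof.
move=> h1 h2; rewrite /multy; case: xgetP => [M _ [[n hn] low]|/(_ N)]; last by case.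
case: (ltngtP M N) => // lt; first by case: hn; apply: h2.
by case: h1 => n' []; apply: low.
Qed.

(** The pullback turns an exponent into its two weights along the rays of the cone. The weighted
    orders thus become multiplicities, and the vertex attains both at once. *)
Lemma pullback_mult j F E c : (j <= size T)%N -> c <> 0 ->
  vertex (ray T j) (ray T j.+1) E c F ->
  multx (pullback (cone T j) F) = dot (ray T j) E /\
  multy (pullback (cone T j) F) = dot (ray T j.+1) E.
Proof.
move=> hj c0 [w w' cE]; split.
  apply: multxP; first by exists (dot (ray T j.+1) E); rewrite coef2_pullback// cE.
  by move=> m n lt; apply: coef2_pullback0 => -[x y] e1 e2; apply: w; rewrite e1.
apply: multyP; first by exists (dot (ray T j) E); rewrite coef2_pullback// cE.
by move=> m n lt; apply: coef2_pullback0 => -[x y] e1 e2; apply: w'; rewrite e2.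
Qed.

Lemma pullback_monom j M N : (j <= size T)%N ->
  pullback (cone T j) (monom2 (1 : A) M N) =
  monom2 1 (dot (ray T j) (M, N)) (dot (ray T j.+1) (M, N)).
Proof.
move=> hj; apply: fps2P => m n; rewrite coef2_monom.
case: eqP => [->|ne] /=.
  case: eqP => [->|ne] /=.
    by rewrite (@coef2_pullback j _ (M, N) hj) coef2_monom !eqxx.
  apply: coef2_pullback0 => -[x y] /= e1 e2; rewrite coef2_monom.
  case: eqP => //= ex; case: eqP => //= ey; case: ne.
  by rewrite -e2 ex ey.
apply: coef2_pullback0 => -[x y] /= e1 e2; rewrite coef2_monom.
case: eqP => //= ex; case: eqP => //= ey; case: ne.
by rewrite -e1 ex ey.
Qed.

Lemma derivx_monom M N : derivx (monom2 (1 : A) M N) = monom2 M%:R M.-1 N.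
Proof.
apply: fps2P => m n; rewrite -[LHS]/(coef2 (monom2 1 M N) m.+1 n *+ m.+1) !coef2_monom.
case: M => [|M] /=; first by rewrite mul0rn !mul0rn.
by rewrite eqSS; case: eqP => [->|_] /=; case: (n == N); rewrite ?mul0rn.
Qed.

Lemma derivy_monom M N : derivy (monom2 (1 : A) M N) = monom2 N%:R M N.-1.
Proof.
apply: fps2P => m n; rewrite -[LHS]/(coef2 (monom2 1 M N) m n.+1 *+ n.+1) !coef2_monom.
case: N => [|N] /=; first by rewrite andbF mul0rn !mul0rn.
by rewrite eqSS andbC; case: eqP => [->|_] /=; case: (m == M); rewrite ?mul0rn.
Qed.

(** The derivatives combine into ad - bc times one monomial, and regularity makes this coefficient 1
    over any ring. *)
Lemma jacobian_cone j : (j <= size T)%N -> @Defs.jacobian A (cone T j) =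
  monom2 1 ((ray T j).1 + (ray T j).2).-1 ((ray T j.+1).1 + (ray T j.+1).2).-1.
Proof.
move=> hj; have := ray_det reg hj; have [p1 p2] := detv_gt0 (ray_vltS reg hj).
rewrite /Defs.jacobian !pullback_monom// /dot /= !muln0 !muln1 !addn0 !add0n.
rewrite !derivx_monom !derivy_monom !monom2M /detv.
move: (ray T j) (ray T j.+1) p1 p2 => [a b] [c d] /= p1 p2 dt.
apply: fps2P => m n; rewrite coef2B !coef2_monom.
(* Where a predecessor is truncated at 0, the coefficient in front vanishes as well. *)
have e1 : ((a%:R * d%:R : A) *+ ((m == a.-1 + b) && (n == c + d.-1))%N =
    (a * d)%:R *+ ((m == (a + b).-1) && (n == (c + d).-1)))%N.
  rewrite -natrM; case: a {p1 dt} => [|a]; first by rewrite mul0n !mul0rn.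
  by case: d {p2} => [|d]; rewrite ?muln0 ?mul0rn// addnS.
have e2 : ((c%:R * b%:R : A) *+ ((m == a + b.-1) && (n == c.-1 + d))%N =
    (b * c)%:R *+ ((m == (a + b).-1) && (n == (c + d).-1)))%N.
  rewrite -natrM mulnC; case: b {p1 dt e1} => [|b]; first by rewrite mul0n !mul0rn.
  by case: c {p2} => [|c]; rewrite ?muln0 ?mul0rn// addnS.
rewrite e1 e2 -mulrnBl (_ : (a * d)%N = (b * c).+1)%N; last by lia.
by rewrite mulrS addrK.
Qed.

Lemma jacobian_multx j : (j <= size T)%N ->
  multx (@Defs.jacobian A (cone T j)) = ((ray T j).1 + (ray T j).2).-1.
Proof.
move=> hj; rewrite jacobian_cone//; apply: multxP.
  exists ((ray T j.+1).1 + (ray T j.+1).2).-1; rewrite coef2_monom !eqxx.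
  by apply/eqP; exact: oner_neq0.
by move=> m n lt; rewrite coef2_monom (ltn_eqF lt).
Qed.

Lemma jacobian_multy j : (j <= size T)%N ->
  multy (@Defs.jacobian A (cone T j)) = ((ray T j.+1).1 + (ray T j.+1).2).-1.
Proof.
move=> hj; rewrite jacobian_cone//; apply: multyP.
  exists ((ray T j).1 + (ray T j).2).-1; rewrite coef2_monom !eqxx.
  by apply/eqP; exact: oner_neq0.
by move=> m n lt; rewrite coef2_monom (ltn_eqF lt) andbF.
Qed.

Lemma numultE j : (j <= (size T).+1)%N ->
  numult A T j = ((ray T j).1 + (ray T j).2)%N.
Proof.
rewrite /numult /mult_along => hj.
case: (leqP j (size T)) => [h|lt]; first by
  rewrite jacobian_multx// prednK//; have [] := detv_gt0 (ray_vltS reg h).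
have -> : j = (size T).+1 by apply/eqP; rewrite eqn_leq hj.
rewrite jacobian_multy// prednK//.
by have [] := detv_gt0 (ray_vltS reg (leqnn _)).
Qed.

End Pullback.

(** * Local fields and double series *)

Section LocalField.
Variables (R : realType) (K : padicField R).
Implicit Types (x y z : K).

Definition rho : R := (#|resfield K|%:R)^-1.

Lemma card_res_gt1 : (1 < #|resfield K|)%N.
Proof. exact: card_finNzRing_gt1. Qed.

Lemma rho_gt0 : 0 < rho.
Proof. by rewrite invr_gt0 ltr0n ltnW// card_res_gt1. Qed.
Lemma rho_ge0 : 0 <= rho. Proof. exact: ltW rho_gt0. Qed.
Lemma rho_lt1 : rho < 1.
Proof. by rewrite invf_lt1 ?ltr0n ?ltr1n ?card_res_gt1// ltnW// card_res_gt1. Qed.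
Lemma rho_le1 : rho <= 1. Proof. exact: ltW rho_lt1. Qed.
Lemma rhoX_gt0 n : 0 < rho ^+ n. Proof. exact: exprn_gt0 rho_gt0. Qed.
Lemma rhoX_ge0 n : 0 <= rho ^+ n. Proof. exact: ltW (rhoX_gt0 n). Qed.
Lemma rhoX_le m n : (m <= n)%N -> rho ^+ n <= rho ^+ m.
Proof. by move=> h; rewrite ler_wiXn2l ?rho_ge0 ?rho_le1. Qed.
Lemma rhoX_ltE m n : (rho ^+ n < rho ^+ m) = (m < n)%N.
Proof. by rewrite ltr_iXn2l ?rho_gt0 ?rho_lt1. Qed.
Lemma rhoX_leE m n : (rho ^+ n <= rho ^+ m) = (m <= n)%N.
Proof. by rewrite ler_iXn2l ?rho_gt0 ?rho_lt1. Qed.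
Lemma rhoX_inj m n : rho ^+ m = rho ^+ n -> m = n.
Proof. by move=> e; apply/eqP; rewrite eqn_leq -!rhoX_leE e lexx. Qed.

Lemma rhoX_small e : 0 < e -> exists N, rho ^+ N < e.
Proof.
move=> e0; have /cvgrPdist_lt/(_ _ e0)[N _ /(_ N (leqnn N))] : (rho ^+ n @[n --> \oo] --> 0).
  by apply: cvg_expr; rewrite ger0_norm ?rho_ge0 ?rho_lt1.
by rewrite sub0r normrN ger0_norm ?rhoX_ge0// => h; exists N.
Qed.

Lemma abs0 : absK (0 : K) = 0. Proof. by apply/absK_eq0. Qed.
Lemma abs_gt0 x : x <> 0 -> 0 < absK x.
Proof.
by move=> x0; rewrite lt_neqAle absK_ge0 andbT eq_sym; apply/eqP => /absK_eq0.
Qed.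
Lemma abs1 : absK (1 : K) = 1.
Proof.
have h : absK (1 : K) != 0 by apply/eqP => /absK_eq0/eqP; rewrite oner_eq0.
by apply: (mulfI h); rewrite -absKM !mulr1.
Qed.
Lemma absN x : absK (- x) = absK x.
Proof.
have h : absK (-1 : K) = 1.
  apply/eqP; rewrite -(@eqrXn2 _ 2) ?absK_ge0// expr1n expr2 -absKM.
  by rewrite mulrNN mulr1 abs1.
by rewrite -mulN1r absKM h mul1r.
Qed.
Lemma absX x n : absK (x ^+ n) = absK x ^+ n.
Proof. by elim: n => [|n IH]; rewrite ?expr0 ?abs1// !exprS absKM IH. Qed.
Lemma absV x : absK x^-1 = (absK x)^-1.
Proof.
have [->|/eqP x0] := eqVneq x 0; first by rewrite invr0 abs0 invr0.
have h : absK x != 0 by rewrite gt_eqF// abs_gt0.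
apply: (mulfI h); rewrite mulfV// -absKM mulfV ?abs1//; exact/eqP.
Qed.
Lemma absM_div x y : absK (x / y) = absK x / absK y.
Proof. by rewrite absKM absV. Qed.
Lemma absD_le x y e : absK x <= e -> absK y <= e -> absK (x + y) <= e.
Proof. by move=> h1 h2; rewrite (le_trans (absKD _ _))// ge_max h1. Qed.
Lemma absD_lt x y e : absK x < e -> absK y < e -> absK (x + y) < e.
Proof. by move=> h1 h2; rewrite (le_lt_trans (absKD _ _))// gt_max h1. Qed.
Lemma absB_le x y e : absK x <= e -> absK y <= e -> absK (x - y) <= e.
Proof. by move=> h1 h2; apply: absD_le => //; rewrite absN. Qed.
Lemma absB_lt x y e : absK x < e -> absK y < e -> absK (x - y) < e.
Proof. by move=> h1 h2; apply: absD_lt => //; rewrite absN. Qed.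
Lemma absBC x y : absK (x - y) = absK (y - x).
Proof. by rewrite -absN opprB. Qed.
Lemma absD_dom x y : absK x < absK y -> absK (x + y) = absK y.
Proof.
move=> h; apply/eqP; rewrite eq_le absD_le ?(ltW h)//= leNgt; apply/negP => h2.
have : absK (x + y - x) < absK y by apply: absB_lt.
by rewrite addrAC subrr add0r ltxx.
Qed.
Lemma absB_dom x y : absK (x - y) < absK y -> absK x = absK y.
Proof. by move=> h; rewrite -{1}(subrK y x) absD_dom. Qed.

Lemma abs_sum_le I (r : seq I) (P : pred I) (F : I -> K) e : 0 <= e ->
  (forall i, P i -> absK (F i) <= e) -> absK (\sum_(i <- r | P i) F i) <= e.
Proof.
by move=> e0 h; elim/big_rec: _ => [|i x Pi hx]; rewrite ?abs0//; apply: absD_le (h i Pi) hx.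
Qed.

Lemma OK0 : OK K 0. Proof. by rewrite /OK /= abs0. Qed.
Lemma OK1 : OK K 1. Proof. by rewrite /OK /= abs1. Qed.
Lemma OKM x y : OK K x -> OK K y -> OK K (x * y).
Proof. by move=> h1 h2; rewrite /OK /= absKM mulr_ile1 ?absK_ge0. Qed.
Lemma OKD x y : OK K x -> OK K y -> OK K (x + y).
Proof. exact: absD_le. Qed.
Lemma OKN x : OK K x -> OK K (- x).
Proof. by rewrite /OK /= absN. Qed.
Lemma OKX x n : OK K x -> OK K (x ^+ n).
Proof. by move=> h; rewrite /OK /= absX exprn_ile1 ?absK_ge0. Qed.
Lemma OK_sum I (r : seq I) (P : pred I) (F : I -> K) :
  (forall i, P i -> OK K (F i)) -> OK K (\sum_(i <- r | P i) F i).
Proof. exact: abs_sum_le. Qed.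
Lemma MK_OK x : MK K x -> OK K x. Proof. exact: ltW. Qed.
Lemma unitK_OK x : absK x = 1 -> OK K x. Proof. by rewrite /OK /= => ->. Qed.
Lemma unit_setP x : (OK K `\` MK K) x <-> absK x = 1.
Proof.
rewrite /OK /MK /=; split=> [[h1 /negP]|->]; last by rewrite lexx ltxx.
by rewrite -leNgt => h2; apply/eqP; rewrite eq_le h1.
Qed.
Lemma abs1_neq0 x : absK x = 1 -> x != 0.
Proof. by move=> h; apply/eqP => e; move: h; rewrite e abs0 => /esym/eqP; rewrite oner_eq0. Qed.

Lemma red0 : red (0 : K) = 0.
Proof. by apply/red_eq0; rewrite abs0. Qed.
Lemma redN x : OK K x -> red (- x) = - red x.
Proof.
move=> h; apply/eqP; rewrite -subr_eq0 opprK -redD ?absN//.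
by rewrite addNr red0.
Qed.
Lemma redB x y : OK K x -> OK K y -> red (x - y) = red x - red y.
Proof. by move=> h1 h2; rewrite redD ?absN// redN. Qed.
Lemma redX x n : OK K x -> red (x ^+ n) = red x ^+ n.
Proof.
move=> h; elim: n => [|n IH]; rewrite ?expr0 ?red1// !exprS redM ?IH//.
exact: OKX.
Qed.
Lemma red_sum I (r : seq I) (P : pred I) (F : I -> K) :
  (forall i, P i -> OK K (F i)) ->
  red (\sum_(i <- r | P i) F i) = \sum_(i <- r | P i) red (F i).
Proof.
move=> h; elim: r => [|i r IH]; first by rewrite !big_nil red0.
rewrite !big_cons; case: ifP => // Pi.
by rewrite redD ?IH//; [exact: h|exact: OK_sum].
Qed.
Lemma red_prod I (r : seq I) (P : pred I) (F : I -> K) :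
  (forall i, P i -> OK K (F i)) ->
  red (\prod_(i <- r | P i) F i) = \prod_(i <- r | P i) red (F i) /\
  OK K (\prod_(i <- r | P i) F i).
Proof.
move=> h; elim: r => [|i r [IH1 IH2]]; first by rewrite !big_nil red1; split=> //; exact: OK1.
rewrite !big_cons; case: ifP => // Pi; split; last by apply: OKM => //; apply: h.
by rewrite redM ?IH1//; exact: h.
Qed.
Lemma red_neq0 x : OK K x -> red x <> 0 <-> absK x = 1.
Proof.
move=> h; split=> [ne|e]; last by move/(red_eq0 h); rewrite e ltxx.
apply/eqP; rewrite eq_le h /= leNgt; apply/negP => lt; apply: ne.
exact/red_eq0.
Qed.
Lemma red_eq x y : OK K x -> OK K y -> red x = red y <-> absK (x - y) < 1.
Proof.
move=> h1 h2; rewrite -red_eq0; last exact: absB_le.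
by rewrite redB//; split=> [->|/eqP]; rewrite ?subrr// subr_eq0 => /eqP.
Qed.

Lemma abs_vK x : OK K x -> x <> 0 -> exists n : nat, absK x = rho ^+ n.
Proof.
move=> h x0; have [n e] := absK_discrete x0; case: n e => n e; last first.
  exists n.+1; rewrite e NegzE /rho exprVn; exact: exprnN.
(* A nonnegative power of q is at least 1, so the absolute value equals 1. *)
exists 0%N; rewrite expr0; apply/eqP; rewrite eq_le h /= e.
by rewrite -exprnP exprn_ege1// ler1n ltnW// card_res_gt1.
Qed.

Definition vK x : nat := xget 0%N [set n | absK x = rho ^+ n].

Lemma vKP x : OK K x -> x <> 0 -> absK x = rho ^+ vK x.
Proof.
by move=> h x0; rewrite /vK; case: xgetP => // no; have [n /no] := abs_vK h x0.
Qed.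
Lemma vK_eq x n : absK x = rho ^+ n -> vK x = n.
Proof.
rewrite /vK => e; case: xgetP => [m _|/(_ n)//] /=.
by rewrite e => /rhoX_inj.
Qed.
Lemma rhoX_neq0 x n : absK x = rho ^+ n -> x <> 0.
Proof. by move=> e x0; move: (rhoX_gt0 n); rewrite -e x0 abs0 ltxx. Qed.

Lemma abs_ltX x n : absK x < rho ^+ n -> absK x <= rho ^+ n.+1.
Proof.
have [->|/eqP x0] := eqVneq x 0; first by rewrite abs0 rhoX_ge0.
move=> h; have o : OK K x.
  by apply: le_trans (ltW h) _; rewrite -[leRHS](expr0 rho) rhoX_le.
by move: h; rewrite (vKP o x0) rhoX_ltE rhoX_leE.
Qed.
Lemma MK_le x : MK K x <-> absK x <= rho.
Proof.
split=> [h|h]; last exact: le_lt_trans h rho_lt1.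
by rewrite -[rho]expr1; apply: abs_ltX; rewrite expr0.
Qed.

Definition unif : K := sval (cid (absK_uniformizer K)).
Lemma abs_unif : absK unif = rho.
Proof. by rewrite /unif; case: cid. Qed.
Lemma unif_neq0 : unif != 0.
Proof. by apply/eqP; apply: (@rhoX_neq0 _ 1); rewrite abs_unif expr1. Qed.
Lemma abs_unifX n : absK (unif ^+ n) = rho ^+ n.
Proof. by rewrite absX abs_unif. Qed.

(** Angular component: the residue of the unit part of x with respect to the chosen uniformizer. *)
Definition ac x : resfield K := red (x / unif ^+ vK x).

Lemma ac_unit x : OK K x -> x <> 0 -> absK (x / unif ^+ vK x) = 1.
Proof.
by move=> h x0; rewrite absM_div abs_unifX (vKP h x0) divff// gt_eqF// rhoX_gt0.
Qed.
Lemma ac_neq0 x : OK K x -> x <> 0 -> ac x != 0.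
Proof.
by move=> h x0; apply/eqP/red_neq0; [apply: unitK_OK|]; apply: ac_unit.
Qed.

Definition liftK (b : resfield K) : K := xget 0 [set x | absK x <= 1 /\ red x = b].
Lemma liftKP (b : resfield K) : OK K (liftK b) /\ red (liftK b) = b.
Proof.
rewrite /liftK; case: xgetP => [x _ []//|no].
by have [x h1 h2] := red_surj b; case: (no x).
Qed.

End LocalField.

Section DoubleSeries.
Variables (R : realType) (K : padicField R).
Implicit Types (a : nat -> nat -> K) (z : K).

Definition sqsum a N : K := \sum_(p : 'I_N * 'I_N) a p.1 p.2.

Lemma sqsumE a N : sqsum a N = \sum_(m < N) \sum_(n < N) a m n.
Proof. by rewrite pair_bigA. Qed.

(** Summation over growing squares, as in [eval2]. *)
Definition hassum a z := forall e : R, 0 < e ->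
  exists N, forall n, (N <= n)%N -> absK (sqsum a n - z) < e.

(** Uniform decay outside squares; over a complete ultrametric field it gives convergence and
    permits rearrangement. *)
Definition tends0 a := forall e : R, 0 < e ->
  exists N, forall m n, (N <= m)%N || (N <= n)%N -> absK (a m n) < e.

Lemma absK_cvgP (u : nat -> K) z :
  (fun n => absK (u n - z)) @ \oo --> (0 : R) <->
  (forall e : R, 0 < e -> exists N, forall n, (N <= n)%N -> absK (u n - z) < e).
Proof.
split=> [/cvgrPdist_lt h e e0|h].
  have [N _ hN] := h e e0; exists N => n /hN /=.
  by rewrite sub0r normrN ger0_norm ?absK_ge0.
apply/cvgrPdist_lt => e e0; have [N hN] := h e e0; exists N => // n /hN /=.
by rewrite sub0r normrN ger0_norm ?absK_ge0.
Qed.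

Lemma eq_of_small x y : (forall e : R, 0 < e -> absK (x - y) < e) -> x = y :> K.
Proof.
move=> h; apply/eqP; rewrite -subr_eq0; apply/eqP; apply: contrapT => /abs_gt0 /h.
by rewrite ltxx.
Qed.

Lemma hassum_unique a z z' : hassum a z -> hassum a z' -> z = z'.
Proof.
move=> h h'; apply: eq_of_small => e e0.
have [N hN] := h e e0; have [M hM] := h' e e0.
have -> : z - z' = (sqsum a (maxn N M) - z') - (sqsum a (maxn N M) - z) by ring.
by apply: absB_lt; [apply: hM|apply: hN]; rewrite ?leq_maxl ?leq_maxr.
Qed.

Lemma sqsumB a b N : sqsum (fun m n => a m n - b m n) N = sqsum a N - sqsum b N.
Proof. by rewrite /sqsum sumrB. Qed.

Lemma hassumB a b z w : hassum a z -> hassum b w ->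
  hassum (fun m n => a m n - b m n) (z - w).
Proof.
move=> h h' e e0; have [N hN] := h e e0; have [M hM] := h' e e0.
exists (maxn N M) => n; rewrite geq_max => /andP[h1 h2]; rewrite sqsumB.
have -> : sqsum a n - sqsum b n - (z - w) = (sqsum a n - z) - (sqsum b n - w) by ring.
by apply: absB_lt; [apply: hN|apply: hM].
Qed.

Lemma hassum_le a z B : 0 <= B -> hassum a z -> (forall m n, absK (a m n) <= B) ->
  absK z <= B.
Proof.
move=> B0 h hB; apply/ler_addgt0Pr => e e0; have [N hN] := h e e0.
have -> : z = sqsum a N - (sqsum a N - z) by ring.
apply: absB_le; last by rewrite (le_trans (ltW (hN N (leqnn N))))// lerDr.
by apply: le_trans (_ : B <= _); [apply: abs_sum_le|rewrite lerDl ltW].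
Qed.

Lemma hassum_fin a N : (forall m n, (N <= m)%N || (N <= n)%N -> a m n = 0) ->
  hassum a (sqsum a N).
Proof.
move=> h e e0; exists N => n le; rewrite (_ : sqsum a n = sqsum a N) ?subrr ?abs0//.
rewrite !sqsumE (big_ord_widen n (fun m => \sum_(j < N) a m j))// [RHS]big_mkcond.
apply: eq_bigr => m _; case: ltnP => hm; last first.
  by rewrite big1// => j _; rewrite h// hm.
rewrite [RHS](big_ord_widen n (fun j => a m j))// [RHS]big_mkcond.
by apply: eq_bigr => j _; case: ltnP => // hj; rewrite h// hj orbT.
Qed.

Lemma sqsum_tail a N m n e : 0 < e -> (N <= m)%N -> (m <= n)%N ->
  (forall i j, (N <= i)%N || (N <= j)%N -> absK (a i j) <= e) ->
  absK (sqsum a n - sqsum a m) <= e.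
Proof.
move=> e0 Nm mn h; pose b i j := if (i < m)%N && (j < m)%N then a i j else 0.
have -> : sqsum a m = sqsum b n.
  rewrite !sqsumE (big_ord_widen n (fun i => \sum_(j < m) a i j))// big_mkcond.
  apply: eq_bigr => i _; rewrite /b; case: ifP => hi; last by rewrite big1.
  by rewrite (big_ord_widen n (fun j => a i j))// big_mkcond.
rewrite -sqsumB; apply: abs_sum_le; first exact: ltW.
move=> [i j] _ /=; rewrite /b; case: ifP => [_|/negbT]; first by rewrite subrr abs0 ltW.
rewrite negb_and -!leqNgt subr0 => /orP[] h'; apply: h; rewrite (leq_trans Nm h') ?orbT//.
Qed.

Lemma tends0_hassum a : tends0 a -> exists z, hassum a z.
Proof.
move=> h; have [e e0|z /absK_cvgP hz] := @absK_complete _ K (sqsum a); last by exists z.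
have e20 : 0 < e / 2 by rewrite divr_gt0.
have e2 : e / 2 < e by rewrite ltr_pdivrMr// ltr_pMr// ltr1n.
have [N hN] := h _ e20; exists N => m n hm hn.
have hN' i j : (N <= i)%N || (N <= j)%N -> absK (a i j) <= e / 2 by move=> /hN/ltW.
apply: le_lt_trans e2; case: (leqP m n) => mn; last exact: (sqsum_tail _ hn (ltnW mn)).
by rewrite absBC; apply: (sqsum_tail _ hm mn).
Qed.

(** [phi] does not map squares to squares, but by the ultrametric inequality the terms outside the
    image of a large square contribute less than e in any order. It will be the exponent map of a
    toric chart. *)
Lemma hassum_reindex a a' z (phi : nat * nat -> nat * nat) :
  tends0 a -> hassum a z -> injective phi ->
  (forall e, a' (phi e).1 (phi e).2 = a e.1 e.2) ->
  (forall m n, (forall e, phi e <> (m, n)) -> a' m n = 0) ->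
  hassum a' z.
Proof.
move=> h0 hz inj hphi out e e0.
have [N1 hN1] := h0 _ e0; have [N2 hN2] := hz _ e0; pose N := maxn N1 N2.
pose ph (p : 'I_N * 'I_N) := phi (p.1 : nat, p.2 : nat).
pose M := (\max_(p : 'I_N * 'I_N) (maxn (ph p).1 (ph p).2)).+1.
have hM p : ((ph p).1 < M)%N /\ ((ph p).2 < M)%N.
  have := @leq_bigmax _ (fun p => maxn (ph p).1 (ph p).2) p.
  by rewrite /M geq_max !ltnS => /andP.
exists M => n Mn.
(* [b] is [a'] without the image of the square of side N; all its terms are smaller than e. *)
pose b m' n' := if [exists p, ph p == (m', n')] then 0 else a' m' n'.
have hb m' n' : absK (b m' n') < e.
  rewrite /b; case: ifPn; rewrite ?abs0// negb_exists => /forallP ne.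
  have [[[i j] eij]|no] := pselect (exists p, phi p = (m', n')); last first.
    by rewrite out ?abs0// => p ep; apply: no; exists p.
  have -> : a' m' n' = a i j by rewrite -(hphi (i, j)) eij.
  apply: hN1; case: (ltnP i N) => hi; last by rewrite (leq_trans _ hi) ?leq_maxl.
  case: (ltnP j N) => hj; last by rewrite (leq_trans _ hj) ?leq_maxl ?orbT.
  by move: (ne (Ordinal hi, Ordinal hj)); rewrite /ph /= eij eqxx.
have dec m' n' : a' m' n' = b m' n' +
    \sum_(p : 'I_N * 'I_N) a p.1 p.2 *+ (ph p == (m', n')).
  rewrite /b; case: ifPn => [/existsP[p /eqP ep]|].
    rewrite add0r (bigD1 p)//= ep eqxx big1 ?addr0.
      by rewrite mulr1n -(hphi (p.1 : nat, p.2 : nat)) -/(ph p) ep.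
    move=> p' /eqP ne; rewrite (_ : (_ == _) = false)//; apply/eqP => ep'; apply: ne.
    have /inj [e1 e2] : ph p' = ph p by rewrite ep ep'.
    by case: p p' e1 e2 {ep ep'} => [? ?] [? ?] /= /val_inj -> /val_inj ->.
  rewrite negb_exists => /forallP ne; rewrite big1 ?addr0// => p _.
  by rewrite (negbTE (ne p)).
have -> : sqsum a' n = sqsum b n + sqsum a N.
  rewrite /sqsum; under eq_bigr => p _ do rewrite dec.
  rewrite big_split /=; congr (_ + _); rewrite exchange_big; apply: eq_bigr => p _.
  have [h1 h2] := hM p.
  rewrite (bigD1 (Ordinal (leq_trans h1 Mn), Ordinal (leq_trans h2 Mn)))//=.
  rewrite -surjective_pairing eqxx big1 ?addr0// => p' /eqP ne.
  rewrite (_ : (_ == _) = false)//; apply/eqP => ep; apply: ne.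
  by case: p' ep => p1 p2 /= ep; congr pair; apply: val_inj; rewrite /= ep.
rewrite -addrA; apply: absD_lt; last by apply: hN2; rewrite leq_maxr.
apply: (@le_lt_trans _ _ (\big[Num.max/0]_(p : 'I_n * 'I_n) absK (b p.1 p.2))).
  apply: abs_sum_le => [|p _]; last exact: le_bigmax.
  exact: bigmax_ge_id.
by apply: bigmax_lt.
Qed.

End DoubleSeries.

(** * Evaluation of power series and of their toric pullbacks *)

Section Evaluation.
Variables (R : realType) (K : padicField R).
Implicit Types (F : fps2 K) (x y : K).

Definition term F x y (m n : nat) : K := coef2 F m n * x ^+ m * y ^+ n.

Lemma eval2P F x y z : hassum (term F x y) z -> eval2 F (x, y) = z.
Proof.
move=> h; rewrite /eval2.
have e (w : K) : ((fun N => absK (\sum_(m < N) \sum_(n < N)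
     coef2 F m n * x ^+ m * y ^+ n - w)) @ \oo --> (0 : R)) <-> hassum (term F x y) w.
  rewrite absK_cvgP /hassum; split=> h' d d0; have [N hN] := h' d d0; exists N => n /hN.
    by rewrite sqsumE.
  by rewrite sqsumE.
case: xgetP => [w _ /e hw|/(_ z)]; first exact: hassum_unique hw h.
by case; apply/e.
Qed.

(* The series F converges at (x, y) for |x| < 1 and |y| <= 1. *)
Definition tame F := exists k, forall m n, coef2 F m n <> 0 -> (n <= k * m + k)%N.

Lemma abs_term F x y m n : integral2 F -> absK (term F x y m n) <= absK x ^+ m * absK y ^+ n.
Proof.
move=> iF; rewrite /term !absKM !absX -mulrA ler_piMl ?mulr_ge0 ?exprn_ge0 ?absK_ge0//.
exact: iF.
Qed.

Lemma abs_term_rho F x y m n : integral2 F -> MK K x -> OK K y ->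
  absK (term F x y m n) <= rho K ^+ m.
Proof.
move=> iF /MK_le hx hy; apply: le_trans (abs_term _ _ _ _ iF) _.
rewrite -[leRHS]mulr1 ler_pM ?exprn_ge0 ?absK_ge0 ?exprn_ile1 ?absK_ge0//.
by rewrite lerXn2r ?nnegrE ?absK_ge0 ?rho_ge0.
Qed.

Lemma abs_term_rho2 F x y m n : integral2 F -> MK K x -> MK K y ->
  absK (term F x y m n) <= rho K ^+ (m + n).
Proof.
move=> iF /MK_le hx /MK_le hy; apply: le_trans (abs_term _ _ _ _ iF) _.
by rewrite exprD ler_pM ?exprn_ge0 ?absK_ge0// lerXn2r ?nnegrE ?absK_ge0 ?rho_ge0.
Qed.

Lemma tends0_rho (a : nat -> nat -> K) (w : nat -> nat -> nat) :
  (forall m n, a m n <> 0 -> absK (a m n) <= rho K ^+ w m n) ->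
  (forall k, exists N, forall m n, a m n <> 0 -> (N <= m)%N || (N <= n)%N -> (k <= w m n)%N) ->
  tends0 a.
Proof.
move=> h1 h2 e e0; have [k hk] := rhoX_small K e0; have [N hN] := h2 k.
exists N => m n h; have [->|/eqP ne] := eqVneq (a m n) 0; first by rewrite abs0.
by apply: le_lt_trans hk; apply: le_trans (h1 m n ne) _; rewrite rhoX_le// hN.
Qed.

Lemma term_neq0 F x y m n : term F x y m n <> 0 -> coef2 F m n <> 0.
Proof. by move=> h e; apply: h; rewrite /term e !mul0r. Qed.

Lemma tends0_MK F x y : integral2 F -> MK K x -> MK K y -> tends0 (term F x y).
Proof.
move=> iF hx hy; apply: (@tends0_rho _ (fun m n => (m + n)%N)).
  by move=> m n _; apply: abs_term_rho2.
by move=> k; exists k => m n _ /orP[] h; lia.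
Qed.

Lemma tends0_tame F x y : integral2 F -> tame F -> MK K x -> OK K y ->
  tends0 (term F x y).
Proof.
move=> iF [k tF] hx hy; apply: (@tends0_rho _ (fun m n => m)).
  by move=> m n _; apply: abs_term_rho.
move=> l; exists (k * l + k + l).+1%N => m n /term_neq0 /tF le /orP[] h; first by lia.
by rewrite leqNgt; apply/negP => lt; nia.
Qed.

Lemma eval2_MK F x y : integral2 F -> MK K x -> MK K y ->
  hassum (term F x y) (eval2 F (x, y)).
Proof.
move=> iF hx hy; have [z hz] := tends0_hassum (tends0_MK iF hx hy).
by rewrite (eval2P hz).
Qed.

Lemma eval2_tame F x y : integral2 F -> tame F -> MK K x -> OK K y ->
  hassum (term F x y) (eval2 F (x, y)).
Proof.
move=> iF tF hx hy; have [z hz] := tends0_hassum (tends0_tame iF tF hx hy).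
by rewrite (eval2P hz).
Qed.

Lemma eval2_OK F x y : integral2 F -> MK K x -> MK K y -> OK K (eval2 F (x, y)).
Proof.
move=> iF hx hy; apply: hassum_le (eval2_MK iF hx hy) _ => // m n.
by apply: le_trans (abs_term_rho2 _ _ iF hx hy) _; rewrite exprn_ile1 ?rho_ge0 ?rho_le1.
Qed.

Lemma absX_lip x x' m : OK K x -> OK K x' -> absK (x ^+ m - x' ^+ m) <= absK (x - x').
Proof.
move=> hx hx'; rewrite subrXX absKM ler_piMr ?absK_ge0//.
by apply: OK_sum => i _; apply: OKM; apply: OKX.
Qed.

Lemma absMX_lip x x' y y' m n e : OK K x -> OK K x' -> OK K y -> OK K y' ->
  absK (x - x') <= e -> absK (x' ^+ m * (y ^+ n - y' ^+ n)) <= e ->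
  absK (x ^+ m * y ^+ n - x' ^+ m * y' ^+ n) <= e.
Proof.
move=> hx hx' hy hy' h1 h2.
have -> : x ^+ m * y ^+ n - x' ^+ m * y' ^+ n =
  (x ^+ m - x' ^+ m) * y ^+ n + x' ^+ m * (y ^+ n - y' ^+ n).
  by rewrite mulrBl mulrBr addrA subrK.
apply: absD_le => //; rewrite absKM (le_trans _ h1)// -[leRHS]mulr1.
by rewrite ler_pM ?absK_ge0 ?absX_lip//; apply: OKX.
Qed.

Lemma eval2_lip F x x' y y' e : integral2 F -> MK K x -> MK K x' -> MK K y -> MK K y' ->
  absK (x - x') <= e -> absK (y - y') <= e ->
  absK (eval2 F (x, y) - eval2 F (x', y')) <= e.
Proof.
move=> iF hx hx' hy hy' h1 h2; have e0 : 0 <= e by apply: le_trans h1; apply: absK_ge0.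
apply: hassum_le e0 (hassumB (eval2_MK iF hx hy) (eval2_MK iF hx' hy')) _ => m n.
rewrite /term -!mulrA -mulrBr absKM -[leRHS]mul1r.
apply: ler_pM; rewrite ?absK_ge0//; first exact: iF.
apply: absMX_lip => //; try exact: MK_OK.
rewrite absKM -[leRHS]mul1r; apply: ler_pM; rewrite ?absK_ge0//.
  by apply: OKX; apply: MK_OK.
by apply: le_trans h2; apply: absX_lip; apply: MK_OK.
Qed.

(** Separates finitely many dominant terms from a remainder bounded by B. The set S will be one
    vertex inside a cone, the initial form on a ray, and the part y^(a'b) (y + xi) in Tschirnhausen
    coordinates. *)
Lemma hassum_dom (a : nat -> nat -> K) z (S : nat -> nat -> bool) D B :
  0 <= B -> hassum a z -> (forall m n, S m n -> (m < D)%N && (n < D)%N) ->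
  (forall m n, ~~ S m n -> absK (a m n) <= B) ->
  absK (z - \sum_(m < D) \sum_(n < D | S m n) a m n) <= B.
Proof.
move=> B0 hz hS hB; pose b m n := if S m n then a m n else 0.
have hb : hassum b (sqsum b D).
  apply: hassum_fin => m n h; rewrite /b; case: ifP => // /hS.
  by case/orP: h => h /andP[h1 h2]; [move: h1|move: h2]; rewrite ltnNge h.
have -> : \sum_(m < D) \sum_(n < D | S m n) a m n = sqsum b D.
  by rewrite sqsumE; apply: eq_bigr => m _; rewrite big_mkcond.
apply: (hassum_le B0 (hassumB hz hb)) => m n; rewrite /b; case: ifP => [_|/negbT/hB].
  by rewrite subrr abs0.
by rewrite subr0.
Qed.

(** For 0 < j <= m both entries of T_j are positive, so the image point lies in M_K^2 even when |y|
    = 1. The substitution is then a reindexing of the double series. *)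
Lemma eval2_pullback T j F x y : regular_subdivision T -> (0 < j <= size T)%N ->
  integral2 F -> MK K x -> OK K y ->
  [/\ integral2 (pullback (cone T j) F), tame (pullback (cone T j) F) &
   eval2 (pullback (cone T j) F) (x, y) = eval2 F (x ^+ (ray T j).1 * y ^+ (ray T j.+1).1,
     x ^+ (ray T j).2 * y ^+ (ray T j.+1).2)].
Proof.
move=> reg /andP[j0 hj] iF hx hy; have [p1 p2] := ray_pos reg j0 hj.
split.
- move=> m n; have [->|/eqP/coef2_pullback_neq0[e [<- <- _]]] :=
    eqVneq (coef2 (pullback (cone T j) F) m n) 0; first exact: OK0.
  by rewrite coef2_pullback//; apply: iF.
(* As T_j has positive entries, both exponents of F are at most m, which bounds n. *)
- exists ((ray T j.+1).1 + (ray T j.+1).2)%N => m n /coef2_pullback_neq0[[e1 e2] [<- <- _]].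
  by rewrite /dot /=; nia.
have hMX a : (0 < a)%N -> MK K (x ^+ a).
  by move=> a0; rewrite /MK /= absX exprn_ilt1 ?absK_ge0// -lt0n.
have hMy a b : (0 < a)%N -> MK K (x ^+ a * y ^+ b).
  move=> a0; rewrite /MK /= absKM; apply: le_lt_trans (hMX a a0).
  by rewrite ler_piMr ?absK_ge0//; apply: OKX.
apply: eval2P; apply: (@hassum_reindex _ _ _ _ _
    (fun e => (dot (ray T j) e, dot (ray T j.+1) e))).
- exact: (tends0_MK iF (hMy _ (ray T j.+1).1 p1) (hMy _ (ray T j.+1).2 p2)).
- exact: (eval2_MK iF (hMy _ _ p1) (hMy _ _ p2)).
- by move=> e e' [] h1 h2; apply: (dot_ray_inj reg hj).
- move=> e /=; rewrite /term coef2_pullback//= -!mulrA; congr (_ * _).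
  by rewrite /dot !exprMn !exprD !exprM mulrACA.
- move=> m n ne; rewrite /term coef2_pullback0 ?mul0r// => e h1 h2.
  by case: (ne e); rewrite h1 h2.
Qed.

End Evaluation.

(** * Values on the cells of the fan *)

Section NewtonData.
Variable A : comNzRingType.

(* N j is the order of F along ray j, and F has on each cone a vertex whose
   coefficient satisfies U. *)
Definition newton T (U : A -> Prop) (N : nat -> nat) (F : fps2 A) :=
  forall j, (j <= size T)%N -> exists E c,
  [/\ vertex (ray T j) (ray T j.+1) E c F, U c,
      dot (ray T j) E = N j & dot (ray T j.+1) E = N j.+1].

Lemma newton_wge T U N F : newton T U N F ->
  forall j, (j <= (size T).+1)%N -> wge (ray T j) (N j) F.
Proof.
move=> h [|j] hj; first by have [E [c [[w _ _] _ <- _]]] := h 0%N (leq0n _).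
by have [E [c [[_ w _] _ _ <-]]] := h j hj.
Qed.

Lemma newton_Nmult T U N F : regular_subdivision T -> (forall c, U c -> c <> 0) ->
  newton T U N F -> forall j, (j <= (size T).+1)%N -> Nmult T F j = N j.
Proof.
move=> reg U0 h j hj; rewrite /Nmult /mult_along; case: (leqP j (size T)) => h'.
  by have [E [c [v u <- _]]] := h j h'; have [] := pullback_mult reg h' (U0 _ u) v.
have -> : j = (size T).+1 by apply/eqP; rewrite eqn_leq hj.
have [E [c [v u _ <-]]] := h _ (leqnn _).
by have [] := pullback_mult reg (leqnn _) (U0 _ u) v.
Qed.

End NewtonData.

Section TorusCoordinate.
Variable F : fieldType.
Implicit Types (t : nat * nat) (X Y : F).

(** For a cone (t, t') of determinant 1 this is the second coordinate of the chart, hence a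
    coordinate on the divisor of t. *)
Definition tcoord t X Y : F := Y ^+ t.1 / X ^+ t.2.

Lemma tcoord_solve t t' X Y : detv t t' = 1 -> X != 0 -> Y != 0 ->
  let b := tcoord t X Y in let z := X ^+ t'.2 / Y ^+ t'.1 in
  X = z ^+ t.1 * b ^+ t'.1 /\ Y = z ^+ t.2 * b ^+ t'.2.
Proof.
case: t t' => [a b] [c d] /=; rewrite /detv /tcoord /= => dt X0 Y0.
have e : (a * d = (b * c).+1)%N by lia.
have aux (x u v : F) : u != 0 -> v != 0 -> x * u * v / (v * u) = x.
  by move=> u0 v0; rewrite [v * u]mulrC invfM mulrACA mulfK// divff// mulr1.
split; apply/esym; rewrite !expr_div_n -!exprM mulf_div.
  by rewrite [(d * a)%N]mulnC e exprS [(c * a)%N]mulnC aux ?expf_neq0.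
rewrite e [(d * b)%N]mulnC [(c * b)%N]mulnC exprS [X ^+ _ * _]mulrC.
by rewrite [X in _ / X]mulrC aux ?expf_neq0.
Qed.

Lemma tcoord_neq0 t X Y : X != 0 -> Y != 0 -> tcoord t X Y != 0.
Proof. by move=> X0 Y0; rewrite mulf_neq0 ?invr_eq0 ?expf_neq0. Qed.

Lemma tcoordE t t' z b : detv t t' = 1 -> z != 0 -> b != 0 ->
  tcoord t (z ^+ t.1 * b ^+ t'.1) (z ^+ t.2 * b ^+ t'.2) = b.
Proof.
case: t t' => [m n] [c d] /=; rewrite /detv /tcoord /= => dt z0 b0.
have e : (d * m = (c * n).+1)%N by lia.
rewrite !exprMn -!exprM e [(n * m)%N]mulnC invfM exprS mulrACA divff ?expf_neq0//.
by rewrite mul1r mulfK// expf_neq0.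
Qed.

Lemma init_tcoord t t' d f X Y : detv t t' = 1 -> X != 0 -> Y != 0 ->
  let b := tcoord t X Y in
  (init t d f X Y == 0) = (init t d f (b ^+ t'.1) (b ^+ t'.2) == 0).
Proof.
move=> dt X0 Y0 b; have [eX eY] := tcoord_solve dt X0 Y0.
have -> : init t d f X Y = init t d f
    ((X ^+ t'.2 / Y ^+ t'.1) ^+ t.1 * b ^+ t'.1)
    ((X ^+ t'.2 / Y ^+ t'.1) ^+ t.2 * b ^+ t'.2) by rewrite /b -eX -eY.
rewrite init_homog mulf_eq0 expf_eq0 mulf_eq0 invr_eq0 !expf_eq0.
by rewrite (negbTE X0) (negbTE Y0) !andbF.
Qed.

End TorusCoordinate.

Section CellValues.
Variables (R : realType) (K : padicField R) (T : seq (nat * nat)).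
Hypothesis reg : regular_subdivision T.
Variables (f : fps2 K) (N : nat -> nat).
Hypotheses (f_int : integral2 f)
  (f_newton : newton T (fun c => absK c = 1) N f).

Lemma abs_term_dot x y V m n : absK x = rho K ^+ V.1 -> absK y = rho K ^+ V.2 ->
  absK (term f x y m n) <= rho K ^+ dot V (m, n).
Proof.
move=> hx hy; apply: le_trans (abs_term _ _ _ _ f_int) _.
by rewrite hx hy /dot exprD !exprM.
Qed.

Lemma comb_MK x V : absK x = rho K ^+ V -> (0 < V)%N -> MK K x.
Proof. by move=> h V0; rewrite /MK /= h exprn_ilt1 ?rho_ge0 ?rho_lt1 ?gtn_eqF. Qed.

(** The vertex monomial dominates strictly: any other exponent has a larger weight for one of the
    two rays, and both multiplicities k and l are positive. *)
Lemma cone_abs j k l x y : (j <= size T)%N -> (0 < k)%N -> (0 < l)%N ->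
  MK K x -> MK K y ->
  absK x = rho K ^+ (comb T j k l).1 -> absK y = rho K ^+ (comb T j k l).2 ->
  absK (eval2 f (x, y)) = rho K ^+ (k * N j + l * N j.+1).
Proof.
move=> hj k0 l0 hx hy ax ay.
have [E [c [[w w' cE] c1 d d']]] := f_newton hj.
have dE e : dot (comb T j k l) e = (k * dot (ray T j) e + l * dot (ray T j.+1) e)%N.
  exact: comb_dot.
have aE : absK (term f x y E.1 E.2) = rho K ^+ (k * N j + l * N j.+1).
  rewrite /term !absKM cE c1 mul1r !absX ax ay -!exprM -exprD.
  by rewrite -d -d' -dE /dot.
pose S m n := (m, n) == E.
have := @hassum_dom _ K _ _ S (maxn E.1 E.2).+1 (rho K ^+ (k * N j + l * N j.+1).+1)
  (rhoX_ge0 _ _) (eval2_MK f_int hx hy).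
have -> : \sum_(m < (maxn E.1 E.2).+1) \sum_(n < (maxn E.1 E.2).+1 | S m n)
    term f x y m n = term f x y E.1 E.2.
  rewrite /S; have h1 : (E.1 < (maxn E.1 E.2).+1)%N by rewrite ltnS leq_maxl.
  have h2 : (E.2 < (maxn E.1 E.2).+1)%N by rewrite ltnS leq_maxr.
  rewrite (bigD1 (Ordinal h1))//= (bigD1 (Ordinal h2)) /=; last by rewrite -surjective_pairing.
  rewrite [X in _ + X + _]big1 ?addr0; last first.
    move=> n /andP[/eqP e /eqP ne]; exfalso; apply: ne; apply: val_inj.
    by rewrite /= -[in RHS]e.
  rewrite big1 ?addr0// => m /eqP ne; rewrite big1// => n /eqP e.
  by exfalso; apply: ne; apply: val_inj; rewrite /= -[in RHS]e.
have hS m n : S m n -> (m < (maxn E.1 E.2).+1)%N && (n < (maxn E.1 E.2).+1)%N.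
  by move=> /eqP <-; rewrite !ltnS leq_maxl leq_maxr.
have hB m n : ~~ S m n ->
    absK (term f x y m n) <= rho K ^+ (k * N j + l * N j.+1).+1.
  move=> /eqP ne.
  case: (ltnP (dot (ray T j) (m, n)) (dot (ray T j) E)) => h1.
    by rewrite /term w// !mul0r abs0 rhoX_ge0.
  case: (ltnP (dot (ray T j.+1) (m, n)) (dot (ray T j.+1) E)) => h2.
    by rewrite /term w'// !mul0r abs0 rhoX_ge0.
  apply: le_trans (abs_term_dot _ _ ax ay) _; rewrite rhoX_le// dE.
  have aux (u v p r p' r' : nat) : (0 < u)%N -> (p < p')%N -> (r <= r')%N ->
    (u * p + v * r < u * p' + v * r')%N by clear; nia.
  rewrite -d -d'.
  case: (ltngtP (dot (ray T j) (m, n)) (dot (ray T j) E)) => h3; first by lia.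
    exact: aux.
  case: (ltngtP (dot (ray T j.+1) (m, n)) (dot (ray T j.+1) E)) => h4; first by lia.
    by rewrite addnC [X in (_ < X)%N]addnC; apply: aux.
  by case: ne; apply: (dot_ray_inj reg hj).
move=> /(_ hS hB) h; rewrite -aE; apply: absB_dom; apply: le_lt_trans h _.
by rewrite aE rhoX_ltE.
Qed.

(** On a ray all monomials of minimal weight have comparable size and form the initial form; the
    others are smaller by a factor [rho]. Dividing by powers of the uniformizer makes the arguments
    units. *)
Lemma ray_eval j k x y : (0 < j <= size T)%N -> (0 < k)%N ->
  let V := comb T j k 0 in absK x = rho K ^+ V.1 -> absK y = rho K ^+ V.2 ->
  absK (eval2 f (x, y) - unif K ^+ (k * N j) *
    init (ray T j) (N j) f (x / unif K ^+ V.1) (y / unif K ^+ V.2)) <=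
  rho K ^+ (k * N j).+1.
Proof.
move=> /andP[j0 hj] k0 V ax ay; have [p1 p2] := ray_pos reg j0 hj.
have V1 : V.1 = (k * (ray T j).1)%N by rewrite /V /= mul0n addn0.
have V2 : V.2 = (k * (ray T j).2)%N by rewrite /V /= mul0n addn0.
have hx : MK K x by apply: comb_MK ax _; rewrite V1 muln_gt0 k0.
have hy : MK K y by apply: comb_MK ay _; rewrite V2 muln_gt0 k0.
pose S m n := dot (ray T j) (m, n) == N j.
have := @hassum_dom _ K _ _ S (N j).+1 (rho K ^+ (k * N j).+1)
  (rhoX_ge0 _ _) (eval2_MK f_int hx hy).
have -> : \sum_(m < (N j).+1) \sum_(n < (N j).+1 | S m n) term f x y m n =
    unif K ^+ (k * N j) *
    init (ray T j) (N j) f (x / unif K ^+ V.1) (y / unif K ^+ V.2).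
  rewrite /init mulr_sumr; apply: eq_bigr => m _.
  rewrite mulr_sumr; apply: eq_bigr => n /eqP e.
  have {}e : (k * N j = V.1 * m + V.2 * n)%N.
    by rewrite V1 V2 -!mulnA -mulnDr -[in LHS]e.
  rewrite e /term exprD !exprM [RHS]mulrCA -mulrA; congr (_ * _).
  have cancel (u v : K) : v != 0 -> v * (u / v) = u by move=> v0; rewrite mulrC divfK.
  by rewrite [RHS]mulrACA -!exprMn !cancel ?expf_neq0 ?unif_neq0.
apply=> [m n /eqP e|m n ne]; first by move: e; rewrite /dot /= => e; apply/andP; split; nia.
case: (ltnP (dot (ray T j) (m, n)) (N j)) => h1.
  by rewrite /term (newton_wge f_newton _ h1) ?mul0r ?abs0 ?rhoX_ge0// (leq_trans hj).
apply: le_trans (abs_term_dot _ _ ax ay) _; rewrite rhoX_le//.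
have -> : dot V (m, n) = (k * dot (ray T j) (m, n))%N.
  by rewrite /dot V1 V2 /= mulnDr !mulnA.
move: ne h1; rewrite /S; move: (dot _ _) => u /eqP ne h1.
by rewrite ltn_pmul2l//; move/eqP: ne h1; rewrite [in X in _ -> X]leq_eqVlt eq_sym => /negbTE ->.
Qed.

Lemma init_OK t d X Y : OK K X -> OK K Y -> OK K (init t d f X Y).
Proof.
move=> hX hY; apply: OK_sum => i _; apply: OK_sum => j _.
by apply: OKM; [exact: f_int|apply: OKM; exact: OKX].
Qed.

Lemma red_init t d X Y : OK K X -> OK K Y ->
  red (init t d f X Y) = init t d (map_fps2 (@red R K) f) (red X) (red Y).
Proof.
move=> hX hY; have h i j : OK K (coef2 f i j * (X ^+ i * Y ^+ j)).
  by apply: OKM; [exact: f_int|apply: OKM; exact: OKX].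
rewrite /init red_sum => [|i _]; last exact: OK_sum.
apply: eq_bigr => i _; rewrite red_sum//; apply: eq_bigr => j _.
by rewrite redM ?redM ?redX//; [exact: OKX|exact: OKX|exact: f_int|apply: OKM; exact: OKX].
Qed.

Lemma ray_abs j k x y : (0 < j <= size T)%N -> (0 < k)%N ->
  let V := comb T j k 0 in absK x = rho K ^+ V.1 -> absK y = rho K ^+ V.2 ->
  init (ray T j) (N j) (map_fps2 (@red R K) f) (ac x) (ac y) != 0 ->
  absK (eval2 f (x, y)) = rho K ^+ (k * N j).
Proof.
move=> hj k0 V ax ay; have := ray_eval hj k0 ax ay.
rewrite -/V; have o u n : absK u = rho K ^+ n -> OK K (u / unif K ^+ n).
  by move=> e; rewrite /OK /= absM_div abs_unifX e divff// gt_eqF// rhoX_gt0.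
rewrite /ac (vK_eq ax) (vK_eq ay) -/V; set X := x / _; set Y := y / _ => h.
have oX : OK K X by apply: o.
have oY : OK K Y by apply: o.
rewrite -red_init// => /eqP/(red_neq0 (init_OK _ _ oX oY)) e.
have e' : absK (unif K ^+ (k * N j) * init (ray T j) (N j) f X Y) = rho K ^+ (k * N j).
  by rewrite absKM e mulr1 abs_unifX.
by rewrite -e'; apply: absB_dom; apply: le_lt_trans h _; rewrite e' rhoX_ltE.
Qed.

(** Vertex coefficients are units, so they survive reduction and f has the same multiplicities as
    its reduction. *)
Lemma newton_red : newton T (fun c => c <> 0) N (map_fps2 (@red R K) f).
Proof.
move=> j /f_newton[E [c [[w w' cE] c1 d d']]]; exists E, (red c); split=> //.
  split; first by move=> m n lt; rewrite -[LHS]/(red (coef2 f m n)) w// red0.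
    by move=> m n lt; rewrite -[LHS]/(red (coef2 f m n)) w'// red0.
  by rewrite -cE.
by apply/red_neq0 => //; exact: unitK_OK.
Qed.

End CellValues.

(** * Points of the strata *)

Section RaySums.
Variables (A : comNzRingType) (T : seq (nat * nat)).
Hypothesis reg : regular_subdivision T.
Implicit Types (F : fps2 A).

(** This is the pullback divided by x_j^d, restricted to x_j = 0: an exponent of weight d for T_j
    leaves a power of y_j given by its weight for T_(j+1). The bound B covers all these powers. *)
Lemma init_pullback_left j d F y B : (0 < j <= size T)%N ->
  (((ray T j.+1).1 + (ray T j.+1).2) * d < B)%N ->
  \sum_(n < B) coef2 (pullback (cone T j) F) d n * y ^+ n =
  init (ray T j) d F (y ^+ (ray T j.+1).1) (y ^+ (ray T j.+1).2).
Proof.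
move=> /andP[j0 hj] hB; have [p1 p2] := ray_pos reg j0 hj.
have cE n : coef2 (pullback (cone T j) F) d n =
    \sum_(i < d.+1) \sum_(k < d.+1 | dot (ray T j) (i : nat, k : nat) == d)
      coef2 F i k *+ (dot (ray T j.+1) (i : nat, k : nat) == n).
  have [[[u v] [e1 e2]]|no] := pselect (exists e, dot (ray T j) e = d /\ dot (ray T j.+1) e = n).
    have [h1 h2] : (u < d.+1)%N /\ (v < d.+1)%N by move: e1; rewrite /dot /=; nia.
    rewrite -{1}e1 -{1}e2 coef2_pullback//= (bigD1 (Ordinal h1))//= (bigD1 (Ordinal h2)) /=;
      last by rewrite e1.
    rewrite e2 eqxx mulr1n [X in _ + X + _]big1 ?addr0; last first.
      move=> k /andP[/eqP e /eqP ne]; rewrite (_ : (_ == _) = false)//; apply/eqP => e'.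
      have := dot_ray_inj reg hj (etrans e (esym e1)) (etrans e' (esym e2)).
      by move=> [ek]; apply: ne; apply: val_inj.
    rewrite big1 ?addr0// => i /eqP ne; rewrite big1// => k /eqP e.
    rewrite (_ : (_ == _) = false)//; apply/eqP => e'.
    have := dot_ray_inj reg hj (etrans e (esym e1)) (etrans e' (esym e2)).
    by move=> [ek _]; apply: ne; apply: val_inj.
  rewrite coef2_pullback0 => [|e e1 e2]; last by case: no; exists e.
  rewrite big1// => i _; rewrite big1// => k /eqP e; case: eqP => // e'.
  by case: no; exists (i : nat, k : nat).
under eq_bigr => n _ do rewrite cE mulr_suml.
rewrite exchange_big /init; apply: eq_bigr => i _ /=.
under eq_bigr => n _ do rewrite mulr_suml.
rewrite exchange_big; apply: eq_bigr => k _ /=.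
have lt : (dot (ray T j.+1) (i : nat, k : nat) < B)%N.
  by apply: leq_ltn_trans hB; rewrite /dot /=; have := ltn_ord i; have := ltn_ord k; nia.
rewrite (bigD1 (Ordinal lt))//= eqxx mulr1n big1 ?addr0.
  by rewrite /dot exprD !exprM.
move=> n /eqP ne; rewrite (_ : (_ == _) = false) ?mul0r//.
by apply/eqP => e; apply: ne; apply: val_inj.
Qed.

Lemma init_pullback_right i d F x B : (i < size T)%N ->
  (((ray T i).1 + (ray T i).2) * d < B)%N ->
  \sum_(m < B) coef2 (pullback (cone T i) F) m d * x ^+ m =
  init (ray T i.+1) d F (x ^+ (ray T i).1) (x ^+ (ray T i).2).
Proof.
move=> hi hB; have [p1 p2] := ray_pos reg (ltn0Sn i) hi.
have hj := ltnW hi.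
have cE n : coef2 (pullback (cone T i) F) n d =
    \sum_(l < d.+1) \sum_(k < d.+1 | dot (ray T i.+1) (l : nat, k : nat) == d)
      coef2 F l k *+ (dot (ray T i) (l : nat, k : nat) == n).
  have [[[u v] [e1 e2]]|no] := pselect (exists e, dot (ray T i.+1) e = d /\ dot (ray T i) e = n).
    have [h1 h2] : (u < d.+1)%N /\ (v < d.+1)%N by move: e1; rewrite /dot /=; nia.
    rewrite -{1}e1 -{1}e2 coef2_pullback//= (bigD1 (Ordinal h1))//= (bigD1 (Ordinal h2)) /=;
      last by rewrite e1.
    rewrite e2 eqxx mulr1n [X in _ + X + _]big1 ?addr0; last first.
      move=> k /andP[/eqP e /eqP ne]; rewrite (_ : (_ == _) = false)//; apply/eqP => e'.
      have := dot_ray_inj reg hj (etrans e' (esym e2)) (etrans e (esym e1)).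
      by move=> [ek]; apply: ne; apply: val_inj.
    rewrite big1 ?addr0// => l /eqP ne; rewrite big1// => k /eqP e.
    rewrite (_ : (_ == _) = false)//; apply/eqP => e'.
    have := dot_ray_inj reg hj (etrans e' (esym e2)) (etrans e (esym e1)).
    by move=> [ek _]; apply: ne; apply: val_inj.
  rewrite coef2_pullback0 => [|e e1 e2]; last by case: no; exists e.
  rewrite big1// => l _; rewrite big1// => k /eqP e; case: eqP => // e'.
  by case: no; exists (l : nat, k : nat).
under eq_bigr => n _ do rewrite cE mulr_suml.
rewrite exchange_big /init; apply: eq_bigr => l _ /=.
under eq_bigr => n _ do rewrite mulr_suml.
rewrite exchange_big; apply: eq_bigr => k _ /=.
have lt : (dot (ray T i) (l : nat, k : nat) < B)%N.
  by apply: leq_ltn_trans hB; rewrite /dot /=; have := ltn_ord l; have := ltn_ord k; nia.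
rewrite (bigD1 (Ordinal lt))//= eqxx mulr1n big1 ?addr0.
  by rewrite /dot exprD !exprM.
move=> n /eqP ne; rewrite (_ : (_ == _) = false) ?mul0r//.
by apply/eqP => e; apply: ne; apply: val_inj.
Qed.

End RaySums.

Section StrataCount.
Variables (F : finFieldType) (T : seq (nat * nat)) (f : fps2 F) (N : nat -> nat).
Hypotheses (reg : regular_subdivision T)
  (f_newton : newton T (fun c => c <> 0) N f).

(* The strict transform does not pass through the point with torus coordinate b
   of E(T_j). *)
Definition off_strict j (b : F) : bool :=
  init (ray T j) (N j) f (b ^+ (ray T j.+1).1) (b ^+ (ray T j.+1).2) != 0.

Let wN j : (j <= (size T).+1)%N -> wge (ray T j) (N j) f.
Proof. exact: (newton_wge f_newton). Qed.

Lemma mult_strict i : (i <= size T)%N ->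
  multx (pullback (cone T i) f) = N i /\ multy (pullback (cone T i) f) = N i.+1.
Proof.
move=> hi; have [E [c [v c0 <- <-]]] := f_newton hi.
exact: (pullback_mult reg hi c0 v).
Qed.

Lemma coef2_strict (i : 'I_(size T).+1) m n :
  coef2 (strict_series T f i) m n = coef2 (pullback (cone T i) f)
    (m + if (0 < i)%N then N i else 0)%N (n + if (i < size T)%N then N i.+1 else 0)%N.
Proof.
have hi : (i <= size T)%N by rewrite -ltnS.
by rewrite /strict_series; have [-> ->] := mult_strict hi.
Qed.

(** The strict series is divided by y^(N_(j+1)) only if E(T_(j+1)) is exceptional, that is for j <
    m. Multiplying back recovers the initial form. *)
Lemma strict_value_left (j : 'I_(size T).+1) y : (0 < j)%N ->
  y ^+ (if (j < size T)%N then N j.+1 else 0) * @strict_value F T f (j, (0, y)) =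
  init (ray T j) (N j) f (y ^+ (ray T j.+1).1) (y ^+ (ray T j.+1).2).
Proof.
move=> j0; have hj : (j <= size T)%N by rewrite -ltnS.
set e2 := if _ then _ else _.
have [B hB] : exists B, (((ray T j.+1).1 + (ray T j.+1).2) * N j < B)%N.
  by eexists; apply: ltnSn.
have [p1 p2] := ray_pos reg j0 hj.
have big n : (B <= n)%N -> coef2 (pullback (cone T j) f) (N j) n = 0.
  move=> hn; apply: coef2_pullback0 => -[u v] e1 e2'; exfalso; move: hn.
  by apply/negP; rewrite -ltnNge; apply: leq_ltn_trans hB; rewrite -e2' -e1 /dot /=; nia.
rewrite -(@init_pullback_left _ _ reg j (N j) f y (e2 + B)) ?j0//; last first.
  exact: leq_trans hB (leq_addl _ _).
rewrite big_split_ord /= big1 ?add0r; last first.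
  move=> n _; rewrite coef2_pullback0 ?mul0r// => -[u v] _.
  move: (ltn_ord n); move: (nat_of_ord n) => n'; rewrite /e2.
  by case: ifP => // lt ltn e; rewrite (wN (j := j.+1))// e.
(* At x = 0 only the exponents (0, n) with n < B contribute, so the sum over all exponents is a
   finite one. *)
rewrite /strict_value (@fsbigE _ _ _ _ _ [seq (0%N, n) | n <- iota 0 B])/=; last 3 first.
- by rewrite map_inj_uniq ?iota_uniq// => n n' [].
- by [].
- move=> [[|m] n] _ /= h; last by rewrite exprS mul0r mulr0 mul0r.
  rewrite expr0 mulr1 coef2_strict j0 add0n -/e2 big ?mul0r//.
  rewrite leqNgt; apply: contra h => h.
  by apply/mapP; exists n => //; rewrite mem_iota /= (leq_ltn_trans (leq_addr _ _) h).
rewrite big_map [in LHS]big_mkcond /=.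
rewrite -[X in iota 0 X]subn0 -/(index_iota 0 B) big_mkord mulr_sumr.
apply: eq_bigr => n _.
rewrite (_ : (_ \in _) = true); last exact/mem_set.
by rewrite /= expr0 mulr1 coef2_strict j0 add0n -/e2 mulrCA exprD addnC.
Qed.

Lemma strict_value_right (i : 'I_(size T).+1) x : (i < size T)%N ->
  x ^+ (if (0 < i)%N then N i else 0) * @strict_value F T f (i, (x, 0)) =
  init (ray T i.+1) (N i.+1) f (x ^+ (ray T i).1) (x ^+ (ray T i).2).
Proof.
move=> hi; have hj := ltnW hi.
set e1 := if _ then _ else _.
have [B hB] : exists B, (((ray T i).1 + (ray T i).2) * N i.+1 < B)%N.
  by eexists; apply: ltnSn.
have [p1 p2] := ray_pos reg (ltn0Sn i) hi.
have big m : (B <= m)%N -> coef2 (pullback (cone T i) f) m (N i.+1) = 0.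
  move=> hn; apply: coef2_pullback0 => -[u v] e1' e2'; exfalso; move: hn.
  by apply/negP; rewrite -ltnNge; apply: leq_ltn_trans hB; rewrite -e2' -e1' /dot /=; nia.
rewrite -(@init_pullback_right _ _ reg i (N i.+1) f x (e1 + B)) ?j0//; last first.
  exact: leq_trans hB (leq_addl _ _).
rewrite big_split_ord /= big1 ?add0r; last first.
  move=> n _; rewrite coef2_pullback0 ?mul0r// => -[u v].
  move: (ltn_ord n); move: (nat_of_ord n) => n'; rewrite /e1.
  by case: ifP => // lt ltn e _; rewrite (wN (j := i))// ?e// ltnW.
rewrite /strict_value (@fsbigE _ _ _ _ _ [seq (m, 0%N) | m <- iota 0 B])/=; last 3 first.
- by rewrite map_inj_uniq ?iota_uniq// => n n' [].
- by [].
- move=> [m [|n]] _ /= h; last by rewrite exprS mul0r mulr0.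
  rewrite expr0 mulr1 coef2_strict hi add0n -/e1 big ?mul0r//.
  rewrite leqNgt; apply: contra h => h.
  by apply/mapP; exists m => //; rewrite mem_iota /= (leq_ltn_trans (leq_addr _ _) h).
rewrite big_map [in LHS]big_mkcond /=.
rewrite -[X in iota 0 X]subn0 -/(index_iota 0 B) big_mkord mulr_sumr.
apply: eq_bigr => n _.
rewrite (_ : (_ \in _) = true); last exact/mem_set.
by rewrite /= expr0 mulr1 coef2_strict hi add0n -/e1 mulrCA exprD addnC.
Qed.

Lemma coef2_pullback_N i m n : (i <= size T)%N ->
  coef2 (pullback (cone T i) f) m n <> 0 -> (N i <= m)%N /\ (N i.+1 <= n)%N.
Proof.
move=> hi /coef2_pullback_neq0[[u v] [<- <- ne]]; split; rewrite leqNgt; apply/negP => lt.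
  by apply: ne; apply: (wN _ lt); apply: leqW.
by apply: ne; apply: (wN _ lt).
Qed.

Lemma coef2_corner i : (i <= size T)%N -> coef2 (pullback (cone T i) f) (N i) (N i.+1) != 0.
Proof.
by move=> hi; have [E [c [[_ _ cE] c0 <- <-]]] := f_newton hi;
  rewrite coef2_pullback// cE; apply/eqP.
Qed.

(** The origin of chart j lies on E(T_(j+1)), hence outside the stratum, except for j = m, where
    that divisor is a coordinate axis. There the strict transform passes through it iff N_(m+1) >
    0. *)
Lemma stratum_left (j : 'I_(size T).+1) y : (0 < j)%N ->
  ((j, (0, y)) \in stratum T f j) =
  if y == 0 then (j == size T :> nat) && (N (size T).+1 == 0%N) else off_strict j y.
Proof.
move=> j0; have hj : (j <= size T)%N by rewrite -ltnS.
have := strict_value_left y j0; rewrite !inE /= !eqxx /=.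
have [->|y0] := eqVneq y 0.
  have [jm|jm] := eqVneq (j : nat) (size T).
    rewrite jm ltnn expr0 mul1r => ->.
    rewrite (_ : [forall _, _] = true) /=; last first.
      apply/forallP => j'; rewrite !inE /= jm eqxx andbT; apply/implyP => /andP[_ h].
      rewrite andbT negb_or eq_sym h; apply/eqP => e.
      by have := ltn_ord j'; rewrite -e ltnn.
    have [B hB] : exists B, (((ray T (size T).+1).1 + (ray T (size T).+1).2) * N (size T) < B.+1)%N.
      by eexists; apply: ltnSn.
    have st : (0 < size T <= size T)%N by rewrite leqnn -jm j0.
    rewrite -(@init_pullback_left _ _ reg (size T) (N (size T)) f 0 B.+1 st hB).
    rewrite big_ord_recl big1 ?addr0 => [|n _]; last by rewrite lift0 exprS mul0r mulr0.
    rewrite expr0 mulr1; apply/idP/eqP => [/eqP /coef2_pullback_N[//|_]|e].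
      by rewrite leqn0 => /eqP.
    by rewrite -[X in coef2 _ _ X]e coef2_corner.
  move=> _; apply/negbTE; rewrite negb_and; apply/orP; left; apply/forallPn.
  have lt : (j.+1 < (size T).+1)%N by rewrite ltnS ltn_neqAle jm.
  by exists (Ordinal lt); rewrite /= !inE /= !eqxx orbT /= neq_ltn ltnSn orbT.
rewrite /off_strict => <-; rewrite mulf_eq0 expf_eq0 (negbTE y0) andbF /=.
rewrite (_ : [forall _, _] = true)//.
apply/forallP => j'; rewrite !inE /= (negbTE y0) andbF orbF eqxx andbT.
by apply/implyP => /andP[_]; rewrite eq_sym.
Qed.

(** The same divisor seen from the preceding chart, where x is the inverse of the torus coordinate
    and the origin is the point at infinity. *)
Lemma stratum_right (i : 'I_(size T).+1) x : (i < size T)%N ->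
  ((i, (x, 0)) \in stratum T f i.+1) =
  if x == 0 then (i == 0%N :> nat) && (N 0 == 0%N) else off_strict i.+1 x^-1.
Proof.
move=> hi; have hj := ltnW hi.
have := strict_value_right x hi; rewrite !inE /= !eqxx orbT /=.
have [->|x0] := eqVneq x 0.
  have [im|im] := eqVneq (i : nat) 0%N.
    rewrite im ltnn expr0 mul1r => ->.
    rewrite (_ : [forall _, _] = true) /=; last first.
      apply/forallP => j'; rewrite !inE /= im eqxx !andbT; apply/implyP => /andP[h1 h2].
      by rewrite negb_or eq_sym -lt0n h1 eq_sym h2.
    have [B hB] : exists B, (((ray T 0).1 + (ray T 0).2) * N 1 < B.+1)%N.
      by eexists; apply: ltnSn.
    have st : (0 < size T)%N by rewrite -im.
    rewrite -(@init_pullback_right _ _ reg 0 (N 1) f 0 B.+1 st hB).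
    rewrite big_ord_recl big1 ?addr0 => [|n _]; last by rewrite lift0 exprS mul0r mulr0.
    rewrite expr0 mulr1; apply/idP/eqP => [/eqP /coef2_pullback_N[//|]|e].
      by rewrite leqn0 => /eqP.
    by rewrite -[X in coef2 _ X _]e coef2_corner.
  move=> _; apply/negbTE; rewrite negb_and; apply/orP; left; apply/forallPn.
  by exists i; rewrite /= !inE /= !eqxx /= lt0n im /= neq_ltn ltnSn.
have dt := ray_det reg hi.
have -> : off_strict i.+1 x^-1 =
    (init (ray T i.+1) (N i.+1) f (x ^+ (ray T i).1) (x ^+ (ray T i).2) != 0).
  rewrite /off_strict [in RHS](init_tcoord _ _ dt) ?expf_neq0//.
  suff -> : tcoord (ray T i.+1) (x ^+ (ray T i).1) (x ^+ (ray T i).2) = x^-1 by [].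
  rewrite /tcoord -!exprM; have := ray_det reg hj; rewrite /detv => d'.
  have -> : ((ray T i).1 * (ray T i.+1).2 = ((ray T i).2 * (ray T i.+1).1).+1)%N by lia.
  by rewrite exprS invfM mulrCA divff ?mulr1// expf_neq0.
move=> <-; rewrite mulf_eq0 expf_eq0 (negbTE x0) andbF /=.
rewrite (_ : [forall _, _] = true)//.
apply/forallP => j'; rewrite !inE /= (negbTE x0) andbF /= eqxx andbT.
by apply/implyP => /andP[_]; rewrite eq_sym.
Qed.

(* The coordinate y on E(T_j) = P^1 in the chart j; None is the point at infinity,
   which is the origin of the chart j - 1. *)
Definition divisor_coord j (p : chart_point F T) : option F :=
  if p.1 == j :> nat then Some p.2.2 else if p.2.1 == 0 then None else Some p.2.1^-1.

Definition coord_in_stratum j (b : option F) : bool :=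
  if b is Some y then
    if y == 0 then (j == size T) && (N (size T).+1 == 0%N) else off_strict j y
  else (j == 1%N) && (N 0 == 0%N).

Lemma mem_stratumP j (p : chart_point F T) : (0 < j <= size T)%N -> p \in stratum T f j ->
  (exists2 y, p = (inord j, (0, y)) & p.1 = j :> nat) \/
  (exists2 x, p = (inord j.-1, (x, 0)) & p.1 = j.-1 :> nat).
Proof.
case: p => i [x y] /andP[j0 hj]; rewrite !inE /= => /andP[+ _].
move=> /orP[/andP[/eqP ij /eqP ->]|/andP[/eqP ij /eqP ->]].
  by left; exists y => //; rewrite -ij inord_val.
by right; exists x => //; rewrite -ij //= inord_val.
Qed.

Lemma stratum_coord j (p : chart_point F T) : (0 < j <= size T)%N ->
  p \in stratum T f j -> coord_in_stratum j (divisor_coord j p).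
Proof.
move=> /andP[j0 hj] hp; have := mem_stratumP _ hp; rewrite j0 hj => /(_ isT).
case=> -[z pE ij]; move: hp ij; rewrite {}pE /divisor_coord /=.
  rewrite inordK// eqxx => hp _ /=.
  by have := @stratum_left (inord j) z; rewrite inordK// hp => /(_ j0) <-.
have hj1 : (j.-1 < (size T).+1)%N by rewrite prednK// ltnW.
rewrite inordK// => hp _; rewrite (_ : (j.-1 == j) = false); last first.
  by apply/negbTE; rewrite neq_ltn prednK// leqnn.
have := @stratum_right (inord j.-1) z; rewrite inordK// prednK// => /(_ hj).
rewrite hp; case: eqP => [_ /esym|/eqP z0 /esym] /=.
  by rewrite -(eqn_pmul2l (ltn0Sn 0)) !mul1n; case: (j) j0 => // -[].
by rewrite invr_eq0 (negbTE z0).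
Qed.

Lemma coord_stratum j b : (0 < j <= size T)%N -> coord_in_stratum j b ->
  exists2 p : chart_point F T, p \in stratum T f j & divisor_coord j p = b.
Proof.
move=> /andP[j0 hj]; case: b => [y|] /= h.
  exists (inord j, (0, y)); last by rewrite /divisor_coord /= inordK// eqxx.
  by have := @stratum_left (inord j) y; rewrite inordK// => ->.
case/andP: h => /eqP j1 h0; rewrite j1 in hj *.
exists (inord 0, (0, 0)).
  by have := @stratum_right (inord 0) 0; rewrite inordK// !eqxx h0 => ->.
by rewrite /divisor_coord /= inordK// eqxx.
Qed.

Lemma transition_entries i j : (i <= size T)%N ->
  let sg := invmx (cone T i) *m cone T j in
  [/\ sg 0 0 = detv (ray T j) (ray T i.+1), sg 0 1 = detv (ray T j.+1) (ray T i.+1),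
      sg 1 0 = detv (ray T i) (ray T j) & sg 1 1 = detv (ray T i) (ray T j.+1)].
Proof.
move=> hi /=; rewrite invmx_cone//.
have l1 : lift ord0 ord0 = 1 :> 'I_2 by apply: val_inj.
have [e1 e2 e3 e4] := coneE T j.
by split; rewrite mxE !big_ord_recl big_ord0 addr0 l1 ?e1 ?e2 ?e3 ?e4 !mxE /= /detv; lia.
Qed.

Lemma Phi_definedE (sg : 'M[int]_2) (p : F * F) : Phi_defined sg p =
  [&& (0 <= sg 0 0) || (p.1 != 0), (0 <= sg 0 1) || (p.2 != 0),
      (0 <= sg 1 0) || (p.1 != 0) & (0 <= sg 1 1) || (p.2 != 0)].
Proof.
apply/forallP/and4P => [h|[h1 h2 h3 h4] r].
  by have /andP[? ?] := h 0; have /andP[? ?] := h 1; split.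
by have [->|->] := ord2_cases r; apply/andP.
Qed.

(** Between the charts j - 1 and j the transition map restricts to inversion on E(T_j), and is
    undefined at the origins; within one chart it is the identity. So gluing is equality of
    coordinates on the projective line. *)
Lemma glued_coord j (p p' : chart_point F T) : (0 < j <= size T)%N ->
  p \in stratum T f j -> p' \in stratum T f j ->
  glued p p' = (divisor_coord j p == divisor_coord j p').
Proof.
move=> hj hp hp'; have := mem_stratumP hj hp; have := mem_stratumP hj hp'.
case/andP: hj => j0 hj.
have j1 : (j.-1 <= size T)%N by rewrite (leq_trans (leq_pred _)).
have jj : (j.-1 == j) = false by apply/negbTE; rewrite neq_ltn prednK// leqnn.
have self i : detv (ray T i) (ray T i) = 0 by rewrite /detv; lia.
have dt := ray_det reg hj; have dt1 := ray_det reg j1; rewrite prednK// in dt1.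
have k0 : 0 < detv (ray T j.-1) (ray T j.+1).
  by apply: (ray_vlt reg); rewrite ?ltnS// leq_pred.
(* Only its sign matters: the power with this exponent must be defined, and is multiplied by 0 in
   the transition maps. *)
have [k kE] : exists k : nat, detv (ray T j.-1) (ray T j.+1) = k.+1%:Z.
  by move: k0; case: (detv _ _) => // -[|n] // _; exists n.
have oSome (a b : F) : (Some a == Some b) = (a == b) by apply/eqP/eqP => [[->]|->].
have m1 : (0 <= -1 :> int) = false by [].
rewrite /glued /divisor_coord => -[] [z' -> /= e'] [] [z -> /= e].
all: rewrite Phi_definedE /Phi /= e ?e' ?eqxx ?jj /=.
- have [-> -> -> ->] := @transition_entries j j hj.
  by rewrite !self dt !lexx ler01 /= !expr0z !expr1z mulr1 mul1r xpair_eqE eqxx oSome.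
- have [-> -> -> ->] := @transition_entries j.-1 j j1.
  rewrite prednK// self [detv (ray T j.+1) _]detv_nn dt dt1 kE lexx ler01 m1 lez_nat /=.
  rewrite expr0z expr1z mul1r mul0r exprN1 xpair_eqE eqxx !andbT.
  have [->|z0] := eqVneq z 0; first by rewrite [0 == _]eq_sym invr_eq0 andNb.
  rewrite oSome; have [->|z0'] := eqVneq z' 0; first by rewrite /= invr_eq0 (negbTE z0).
  by rewrite /= -(inj_eq invr_inj) invrK.
- have [-> -> -> ->] := @transition_entries j j.-1 hj.
  rewrite prednK// self dt [detv (ray T j) (ray T j.-1)]detv_nn dt1 kE.
  rewrite lexx ler01 m1 lez_nat /= expr0z expr1z mulr0 mulr1 exprN1 xpair_eqE eqxx andbT.
  by have [->|z0] := eqVneq z' 0; rewrite /= ?oSome.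
- have [-> -> -> ->] := @transition_entries j.-1 j.-1 j1.
  rewrite prednK// !self dt1 lexx ler01 /= !expr0z !expr1z mulr1 mulr0 xpair_eqE eqxx andbT.
  case: (eqVneq z 0) => [->|z0]; case: (eqVneq z' 0) => [z'0|z0'] //=; rewrite ?eqxx//.
    by rewrite z'0 (negbTE z0).
  by rewrite oSome (inj_eq invr_inj).
Qed.

Lemma card_partition_by (U : finType) (V : finType) (r : rel U) (S : {set U}) (phi : U -> V) :
  {in S &, forall x y, r x y = (phi x == phi y)} ->
  #|equivalence_partition r S| = #|phi @: S|.
Proof.
move=> h; pose g v := finset (fun y => (y \in S) && (v == phi y)).
have -> : equivalence_partition r S = g @: (phi @: S).
  rewrite -imset_comp; apply: eq_in_imset => x xS.
  apply/setP => y; rewrite !inE; apply: andb_id2l => yS; exact: h.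
rewrite card_in_imset// => v w /imsetP[x xS ->] /imsetP[y yS ->] /setP/(_ x).
by rewrite !inE xS eqxx /= => /esym/eqP.
Qed.

(** Points of a projective line: those of the torus off the strict transform, then possibly the
    origin of chart m and the point at infinity of E(T_1), the two ends that lie on no other
    exceptional divisor. *)
Lemma card_stratumE j : (0 < j <= size T)%N -> card_stratum T f j =
  (#|[pred b : F | (b != 0%R) && off_strict j b]| +
   ((j == size T) && (N (size T).+1 == 0%N)) + ((j == 1%N) && (N 0 == 0%N)))%N.
Proof.
move=> hj; rewrite /card_stratum (@card_partition_by _ _ _ _ (divisor_coord j)); last first.
  by move=> p p' hp hp'; apply: glued_coord.
have -> : divisor_coord j @: stratum T f j = finset (coord_in_stratum j).
  apply/setP => b; rewrite inE; apply/imsetP/idP => [[p hp ->]|h].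
    exact: stratum_coord.
  by have [p hp <-] := coord_stratum hj h; exists p.
rewrite (cardsD1 None) inE /= addnC; congr (_ + _)%N.
have -> : finset (coord_in_stratum j) :\ None =
    Some @: finset (fun y : F => coord_in_stratum j (Some y)).
  apply/setP => -[y|]; rewrite !inE /=.
    by rewrite (mem_imset _ _ (@Some_inj _)) inE.
  by apply/esym/negbTE/negP => /imsetP[y].
rewrite card_imset; last exact: Some_inj.
rewrite (cardsD1 0) inE /= eqxx addnC; congr (_ + _)%N.
by apply: eq_card => y; rewrite !inE /=; case: eqP.
Qed.

End StrataCount.

Import Normc.

(** * Complex powers and integrals *)

Section ComplexPower.
Variable R : realType.
Implicit Types (z w s : R[i]) (r : R).

Lemma ReD z w : complex.Re (z + w) = complex.Re z + complex.Re w.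
Proof. by case: z w => [? ?] [? ?]. Qed.
Lemma ImD z w : complex.Im (z + w) = complex.Im z + complex.Im w.
Proof. by case: z w => [? ?] [? ?]. Qed.
Lemma Re_sum I (r : seq I) (P : pred I) (F : I -> R[i]) :
  complex.Re (\sum_(i <- r | P i) F i) = \sum_(i <- r | P i) complex.Re (F i).
Proof. by apply: (big_morph _ ReD). Qed.
Lemma Im_sum I (r : seq I) (P : pred I) (F : I -> R[i]) :
  complex.Im (\sum_(i <- r | P i) F i) = \sum_(i <- r | P i) complex.Im (F i).
Proof. by apply: (big_morph _ ImD). Qed.

Lemma abs_Re_le z : `|complex.Re z| <= normc z.
Proof.
by case: z => a b /=; rewrite -sqrtr_sqr ler_wsqrtr// lerDl sqr_ge0.
Qed.
Lemma abs_Im_le z : `|complex.Im z| <= normc z.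
Proof.
by case: z => a b /=; rewrite -sqrtr_sqr ler_wsqrtr// lerDr sqr_ge0.
Qed.
Lemma normc_ge0 z : 0 <= normc z.
Proof. by case: z => a b /=; apply: sqrtr_ge0. Qed.
Lemma normcX z n : normc (z ^+ n) = normc z ^+ n.
Proof. by elim: n => [|n IH]; rewrite ?expr0 ?normc1// !exprS normcM IH. Qed.
Lemma normc_real r : normc (r%:C) = `|r|.
Proof. by rewrite /= expr0n addr0 sqrtr_sqr. Qed.

Lemma cpow0 s : cpow 0 s = 0.
Proof. by rewrite /cpow eqxx. Qed.

Lemma cpow1 s : cpow (1 : R) s = 1.
Proof.
by rewrite /cpow oner_eq0 ln1 mulr0 cos0 sin0 powR1 mulr1 mulr0.
Qed.

Lemma cpowD r s t : r != 0 -> cpow r (s + t) = cpow r s * cpow r t.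
Proof.
move=> r0; rewrite /cpow (negbTE r0) ReD ImD powRD ?r0 ?implybT// mulrDl cosD sinD.
by apply/eqP; rewrite eq_complex /=; apply/andP; split; apply/eqP; ring.
Qed.

Lemma cpowM r r' s : 0 < r -> 0 < r' -> cpow (r * r') s = cpow r s * cpow r' s.
Proof.
move=> r0 r'0; rewrite /cpow mulf_eq0 !gt_eqF//= powRM ?ltW// lnM ?posrE//.
rewrite mulrDr cosD sinD.
by apply/eqP; rewrite eq_complex /=; apply/andP; split; apply/eqP; ring.
Qed.

Lemma cpowX r s n : 0 < r -> cpow (r ^+ n) s = cpow r s ^+ n.
Proof.
move=> r0; elim: n => [|n IH]; first by rewrite !expr0 cpow1.
by rewrite !exprS cpowM ?exprn_gt0// IH.
Qed.

Lemma cpow_nat r n : 0 < r -> cpow r (n%:R) = (r ^+ n)%:C.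
Proof.
move=> r0; elim: n => [|n IH].
  by rewrite /cpow gt_eqF//= powRr0 mul0r cos0 sin0 mulr0 mulr1 expr0.
rewrite -addn1 natrD cpowD ?gt_eqF// IH addn1 exprSr.
rewrite (_ : cpow r 1%:R = r%:C) ?rmorphM//.
by rewrite /cpow gt_eqF//= powRr1 ?ltW// mul0r cos0 sin0 mulr0 mulr1.
Qed.

Lemma cpow_natM r s n : 0 < r -> cpow r (n%:R * s) = cpow (r ^+ n) s.
Proof.
move=> r0; rewrite cpowX//; elim: n => [|n IH].
  by rewrite mul0r expr0 -[0]/(0%:R) cpow_nat// expr0.
by rewrite -addn1 natrD mulrDl mul1r cpowD ?gt_eqF// IH exprD expr1.
Qed.

Lemma cpow_neq0 r s : 0 < r -> cpow r s != 0.
Proof.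
move=> r0; apply/eqP => e; have := @cpowM r r^-1 s r0; rewrite invr_gt0 => /(_ r0).
by rewrite e mul0r divff ?gt_eqF// cpow1 => /eqP; rewrite oner_eq0.
Qed.

Lemma cpowV r s : 0 < r -> cpow r^-1 s = (cpow r s)^-1.
Proof.
move=> r0; apply: (mulfI (cpow_neq0 s r0)).
by rewrite -cpowM ?invr_gt0// !divff ?cpow1 ?cpow_neq0 ?gt_eqF.
Qed.

Lemma normc_cpow r s : 0 < r -> normc (cpow r s) = r `^ complex.Re s.
Proof.
move=> r0; rewrite /cpow gt_eqF//= !exprMn -mulrDr cos2Dsin2 mulr1 sqrtr_sqr.
by rewrite ger0_norm ?powR_ge0.
Qed.

Lemma normc_cpow_le1 r s : 0 <= r -> r <= 1 -> 0 < complex.Re s -> normc (cpow r s) <= 1.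
Proof.
rewrite le_eqVlt => /predU1P[<- _ _|r0 r1 s0]; first by rewrite cpow0 normc0 ler01.
rewrite normc_cpow// (_ : 1 = 1 `^ complex.Re s); last by rewrite powR1.
by apply: ge0_ler_powR; rewrite ?nnegrE// ltW.
Qed.

End ComplexPower.

(** * Complex integrals as sums over countable or finite fibres *)

Section ComplexIntegral.
Context d (X : measurableType d) (R : realType) (mu : {measure set X -> \bar R}).
Implicit Types (D : set X) (g : X -> R[i]).

Definition cintegrable D g :=
  mu.-integrable D (EFin \o (fun x => complex.Re (g x))) /\
  mu.-integrable D (EFin \o (fun x => complex.Im (g x))).

Lemma cintegrableS D E g : measurable D -> measurable E -> E `<=` D ->
  cintegrable D g -> cintegrable E g.
Proof. by move=> mD mE ED [h1 h2]; split; apply: (integrableS mD mE ED). Qed.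

Lemma cintegral_ext D g g' : (forall x, D x -> g x = g' x) ->
  cintegral mu D g = cintegral mu D g'.
Proof.
by move=> h; rewrite /cintegral; congr (_ +i* _); apply: eq_Rintegral => x;
  rewrite inE => /h ->.
Qed.

Lemma cintegral_set0 g : cintegral mu set0 g = 0.
Proof. by rewrite /cintegral !Rintegral_set0. Qed.

Lemma cintegral_cst D (z : R[i]) : measurable D ->
  cintegral mu D (fun=> z) = z * (fine (mu D))%:C.
Proof.
move=> mD; rewrite /cintegral !Rintegral_cst//; case: z => a b /=.
by apply/eqP; rewrite eq_complex /= !mulr0 subr0 add0r !eqxx.
Qed.

Lemma measurable_discrete D (g : X -> R) (phi : X -> nat) (c : nat -> R) :
  measurable D -> (forall k, measurable (D `&` phi @^-1` [set k])) ->
  (forall x, D x -> g x = c (phi x)) -> measurable_fun D g.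
Proof.
move=> mD mphi hg _ Y mY.
rewrite (_ : D `&` g @^-1` Y = \bigcup_(k in [set k | Y (c k)]) (D `&` phi @^-1` [set k])).
  exact: bigcup_measurable.
apply/seteqP; split => x /= => [[Dx Yx]|[k Yk [Dx e]]].
  by exists (phi x) => //=; rewrite -hg.
by split=> //; rewrite hg// e.
Qed.

(** Absolute values on K are discrete, so each integrand of the formula factors through a countable
    label and is bounded by 1. *)
Lemma cintegrable_discrete D g (phi : X -> nat) (c : nat -> R[i]) :
  measurable D -> (mu D < +oo)%E -> (forall k, measurable (D `&` phi @^-1` [set k])) ->
  (forall x, D x -> g x = c (phi x)) -> (forall x, D x -> normc (g x) <= 1) ->
  cintegrable D g.
Proof.
move=> mD fD mphi hg hb; split; apply: measurable_bounded_integrable => //.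
- apply: (@measurable_discrete _ _ phi (fun k => complex.Re (c k))) => // x Dx.
  by rewrite hg.
- exists 1; split=> // M M1 x Dx; rewrite /= (le_trans _ (ltW M1))//.
  by rewrite (le_trans _ (hb x Dx)) ?abs_Re_le.
- apply: (@measurable_discrete _ _ phi (fun k => complex.Im (c k))) => // x Dx.
  by rewrite hg.
- exists 1; split=> // M M1 x Dx; rewrite /= (le_trans _ (ltW M1))//.
  by rewrite (le_trans _ (hb x Dx)) ?abs_Im_le.
Qed.

Let fiber_cover D (V : Type) (phi : X -> V) :
  \bigcup_k (D `&` phi @^-1` [set k]) = D.
Proof.
apply/seteqP; split => x /=; first by case=> k _ [].
by move=> Dx; exists (phi x).
Qed.

Let fiber_triv D (V : choiceType) (phi : X -> V) (A : set V) :
  trivIset A (fun k => D `&` phi @^-1` [set k]).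
Proof. by move=> i j _ _ [x [[_ /= <-] [_ /= <-]]]. Qed.

(** Countable additivity, stated as convergence of partial sums so that real and imaginary parts can
    be recombined. *)
Lemma Rintegral_nat D (g : X -> R) (phi : X -> nat) :
  measurable D -> (forall k, measurable (D `&` phi @^-1` [set k])) ->
  mu.-integrable D (EFin \o g) ->
  (fun n => \sum_(k < n) Rintegral mu (D `&` phi @^-1` [set k : nat]) g) @ \oo -->
  Rintegral mu D g.
Proof.
move=> mD mphi ig; set F := fun k => D `&` phi @^-1` [set k].
have iF k : mu.-integrable (F k) (EFin \o g).
  by apply: (integrableS mD (mphi k)) => // x [].
have fin E : measurable E -> mu.-integrable E (EFin \o g) -> (\int[mu]_(x in E) (g x)%:E)%E =
    (Rintegral mu E g)%:E.
  by move=> mE h; rewrite /Rintegral fineK//; apply: integrable_fin_num.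
have tF : trivIset setT F by apply: fiber_triv.
have cF : \bigcup_k F k = D by apply: fiber_cover.
have igF : mu.-integrable (\bigcup_k F k) (EFin \o g) by rewrite cF.
have sm := integrable_summable tF mphi igF.
have := integral_bigcup tF mphi igF; rewrite cF => e.
pose a k := Rintegral mu (F k) g.
have aE k : (\int[mu]_(x in F k) (EFin \o g) x)%E = (a k)%:E.
  exact: fin (mphi k) (iF k).
have cva : cvgn (series a).
  apply: normed_cvg.
  pose P : pred nat := fun=> true.
  have eT : (P : nat -> Prop) = setT by apply/seteqP; split.
  have sm' : summable (P : nat -> Prop) (fun k => `|a k|%:E).
    rewrite eT; apply: le_lt_trans sm.
    by apply: le_esum => k _; rewrite aE /= normr_id.
  have := @summable_cvg R P (fun k => `|a k|%:E) _ sm'.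
  by apply => i _; rewrite lee_fin.
have lE : limn (series a) = Rintegral mu D g.
  apply: EFin_inj; rewrite -[RHS](fin D mD ig) e -EFin_lim//.
  apply: congr_lim; apply/funext => n /=.
  by rewrite /series /= -sumEFin; apply: eq_bigr => k _; rewrite aE.
have -> : (fun n => \sum_(k < n) Rintegral mu (F k) g) = series a.
  by apply/funext => n; rewrite /series /= big_mkord.
by rewrite -lE.
Qed.

(** Takes the place of a change of variables: the two domains are matched fibre by fibre. *)
Lemma cintegral_eq_fibers D E g g' (phi psi : X -> nat) :
  measurable D -> measurable E ->
  (forall k, measurable (D `&` phi @^-1` [set k])) ->
  (forall k, measurable (E `&` psi @^-1` [set k])) ->
  cintegrable D g -> cintegrable E g' ->
  (forall k, cintegral mu (D `&` phi @^-1` [set k]) g =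
             cintegral mu (E `&` psi @^-1` [set k]) g') ->
  cintegral mu D g = cintegral mu E g'.
Proof.
move=> mD mE mphi mpsi [ig1 ig2] [ig1' ig2'] h; rewrite /cintegral; congr (_ +i* _).
  have := Rintegral_nat mE mpsi ig1'; have := Rintegral_nat mD mphi ig1.
  have -> : (fun n => \sum_(k < n) Rintegral mu (D `&` phi @^-1` [set k : nat]) (fun x => complex.Re (g x))) =
    (fun n => \sum_(k < n) Rintegral mu (E `&` psi @^-1` [set k : nat]) (fun x => complex.Re (g' x))).
    by apply/funext => n; apply: eq_bigr => k _; have [] := h k.
  exact: cvg_unique.
have := Rintegral_nat mE mpsi ig2'; have := Rintegral_nat mD mphi ig2.
have -> : (fun n => \sum_(k < n) Rintegral mu (D `&` phi @^-1` [set k : nat]) (fun x => complex.Im (g x))) =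
  (fun n => \sum_(k < n) Rintegral mu (E `&` psi @^-1` [set k : nat]) (fun x => complex.Im (g' x))).
  by apply/funext => n; apply: eq_bigr => k _; have [] := h k.
exact: cvg_unique.
Qed.

Lemma normc_series_cvg (C w : R[i]) : normc w < 1 ->
  (fun n => complex.Re (\sum_(k < n) C * w ^+ k)) @ \oo --> complex.Re (C / (1 - w)) /\
  (fun n => complex.Im (\sum_(k < n) C * w ^+ k)) @ \oo --> complex.Im (C / (1 - w)).
Proof.
move=> w1; have w0 : 1 - w != 0.
  rewrite subr_eq0; apply/eqP => e; move: w1; rewrite -e (_ : normc 1 = 1) ?ltxx//.
  exact: normc1.
have sE n : \sum_(k < n) C * w ^+ k = C / (1 - w) - C / (1 - w) * w ^+ n.
  rewrite -mulr_sumr -[X in _ = X - _]mulr1 -mulrBr -mulrA; congr (_ * _).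
  by apply: (mulfI w0); rewrite mulrA mulfV// mul1r -[RHS]opprB subrX1 -mulNr opprB.
have small e : 0 < e -> \forall n \near \oo, normc (C / (1 - w) * w ^+ n) < e.
  move=> e0; have cv : (fun n => normc (C / (1 - w)) * normc w ^+ n) @ \oo --> (0 : R).
    rewrite -[X in _ --> X](mulr0 (normc (C / (1 - w)))); apply: cvgMr.
    by apply: cvg_expr; rewrite ger0_norm ?normc_ge0.
  move/cvgrPdist_lt : cv => /(_ e e0); apply: filterS => n /=.
  rewrite sub0r normrN ger0_norm; last by rewrite mulr_ge0 ?exprn_ge0 ?normc_ge0.
  by rewrite -normcX -normcM.
split; apply/cvgrPdist_lt => e e0; have := small e e0; apply: filterS => n hn.
  rewrite sE; apply: le_lt_trans hn; apply: le_trans (abs_Re_le _).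
  move: (C / (1 - w)) => z; move: (z * w ^+ n) => t; case: z t => [a b] [u v] /=.
  by rewrite (_ : a - (a - u) = u)//; ring.
rewrite sE; apply: le_lt_trans hn; apply: le_trans (abs_Im_le _).
move: (C / (1 - w)) => z; move: (z * w ^+ n) => t; case: z t => [a b] [u v] /=.
by rewrite (_ : b - (b - v) = v)//; ring.
Qed.

Lemma cintegral_geo D g (phi : X -> nat) (C w : R[i]) :
  measurable D -> (forall k, measurable (D `&` phi @^-1` [set k])) ->
  cintegrable D g -> normc w < 1 ->
  (forall k, cintegral mu (D `&` phi @^-1` [set k]) g = C * w ^+ k) ->
  cintegral mu D g = C / (1 - w).
Proof.
move=> mD mphi [ig1 ig2] w1 h; have [c1 c2] := normc_series_cvg C w1.
have := Rintegral_nat mD mphi ig1; have := Rintegral_nat mD mphi ig2.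
have -> : (fun n => \sum_(k < n) Rintegral mu (D `&` phi @^-1` [set k : nat]) (fun x => complex.Re (g x))) =
    (fun n => complex.Re (\sum_(k < n) C * w ^+ k)).
  by apply/funext => n; rewrite Re_sum; apply: eq_bigr => k _; rewrite -h.
have -> : (fun n => \sum_(k < n) Rintegral mu (D `&` phi @^-1` [set k : nat]) (fun x => complex.Im (g x))) =
    (fun n => complex.Im (\sum_(k < n) C * w ^+ k)).
  by apply/funext => n; rewrite Im_sum; apply: eq_bigr => k _; rewrite -h.
move=> /(cvg_unique _ c2) e2 /(cvg_unique _ c1) e1.
by apply/eqP; rewrite eq_complex /= -e1 -?e2 ?eqxx//.
Qed.

Lemma cintegral_fin D g (I : finType) (phi : X -> I) :
  measurable D -> (forall i, measurable (D `&` phi @^-1` [set i])) ->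
  cintegrable D g ->
  cintegral mu D g = \sum_(i : I) cintegral mu (D `&` phi @^-1` [set i]) g.
Proof.
move=> mD mphi [ig1 ig2].
have aux (u : X -> R) : mu.-integrable D (EFin \o u) ->
    Rintegral mu D u = \sum_(i : I) Rintegral mu (D `&` phi @^-1` [set i]) u.
  move=> iu; set F := fun i => D `&` phi @^-1` [set i].
  have DE : D = \big[setU/set0]_(i <- index_enum I) F i.
    rewrite -bigcup_seq /=; apply/seteqP; split => x /=.
      by move=> Dx; exists (phi x); rewrite /= ?mem_index_enum.
    by case=> i _ [].
  have tF : trivIset [set` index_enum I] F by apply: fiber_triv.
  have := @integral_bigsetU_EFin _ _ _ mu I F u (index_enum I) mphi
    (index_enum_uniq I) tF.
  rewrite /= -DE => /(_ (measurable_int mu iu)); rewrite /Rintegral => ->.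
  have fF i : (\int[mu]_(x in F i) (u x)%:E)%E = (Rintegral mu (F i) u)%:E.
    rewrite /Rintegral fineK//; apply: integrable_fin_num => //; first exact: mphi.
    by apply: (integrableS mD (mphi i)) => // x [].
  by under eq_bigr => i _ do rewrite fF; rewrite sumEFin.
rewrite {1}/cintegral aux// aux//.
by apply/eqP; rewrite eq_complex /= Re_sum Im_sum !eqxx.
Qed.

Lemma cintegral_null D N g : measurable D -> measurable N -> N `<=` D -> mu N = 0%E ->
  cintegrable D g -> cintegral mu D g = cintegral mu (D `\` N) g.
Proof.
move=> mD mN ND N0 [ig1 ig2].
have aux (u : X -> R) : mu.-integrable D (EFin \o u) ->
    Rintegral mu D u = Rintegral mu (D `\` N) u.
  by move=> iu; rewrite /Rintegral (negligible_integral mN mD).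
by rewrite /cintegral aux// aux.
Qed.

Lemma measure_fin D (I : finType) (phi : X -> I) :
  measurable D -> (forall i, measurable (D `&` phi @^-1` [set i])) ->
  mu D = (\sum_(i : I) mu (D `&` phi @^-1` [set i]))%E.
Proof.
move=> mD mphi; set F := fun i => D `&` phi @^-1` [set i].
have {1}-> : D = \bigcup_(i in [set: I]) F i by rewrite fiber_cover.
rewrite (measure_fin_bigcup _ finite_finset (@fiber_triv D _ phi _)) => [|i _];
  last exact: mphi.
rewrite (fsbigE (index_enum I)) ?index_enum_uniq// => [|i _]; last by rewrite mem_index_enum.
by apply: eq_bigl => i; apply/mem_set.
Qed.

End ComplexIntegral.

(** * Haar measure of boxes *)

Section PlaneMeasure.
Variables (R : realType) (K : padicField R).
Implicit Types (x y z : K) (p : plane K) (D U : set (plane K)).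

Local Notation rho := (rho K).

Lemma open_measurable U : open_plane U -> measurable (U : set (borel_plane K)).
Proof. by move=> h; apply: sub_sigma_algebra. Qed.

Lemma open_planeI D U : open_plane D -> open_plane U -> open_plane (D `&` U).
Proof.
move=> hD hU p [Dp Up]; have [e e0 he] := hD p Dp; have [d d0 hd] := hU p Up.
exists (Num.min e d); first by rewrite lt_min e0.
by move=> p'; rewrite !lt_min => /andP[h1 h2] /andP[h3 h4]; split; [apply: he|apply: hd].
Qed.

Definition box x i y j : set (plane K) :=
  [set p | absK (p.1 - x) <= rho ^+ i /\ absK (p.2 - y) <= rho ^+ j].

Lemma absB_close x x' z (r : R) : absK (x' - x) < r -> absK (x - z) <= r ->
  absK (x' - z) <= r.
Proof.
move=> h1 h2; have -> : x' - z = (x' - x) + (x - z) by rewrite addrA subrK.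
by apply: absD_le => //; apply: ltW.
Qed.

Lemma box_open x i y j : open_plane (box x i y j).
Proof.
move=> p [h1 h2]; exists (rho ^+ maxn i j); first exact: rhoX_gt0.
move=> p' h1' h2'; split.
  by apply: absB_close h1; apply: lt_le_trans h1' _; rewrite rhoX_le ?leq_maxl.
by apply: absB_close h2; apply: lt_le_trans h2' _; rewrite rhoX_le ?leq_maxr.
Qed.

Lemma box_measurable x i y j : measurable (box x i y j : set (borel_plane K)).
Proof. exact: (open_measurable (@box_open x i y j)). Qed.

Lemma box00 : box 0 0 0 0 = OK K `*` OK K.
Proof. by apply/seteqP; split => p; rewrite /box /OK /= !subr0 !expr0. Qed.

Lemma MK2E : MK2 K = box 0 1 0 1.
Proof.
apply/seteqP; split => p; rewrite /box /MK2 /= !subr0 !expr1; first by case=> /MK_le ? /MK_le.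
by case=> ? ?; split; apply/MK_le.
Qed.

Lemma MK2_open : open_plane (MK2 K).
Proof. by rewrite MK2E; apply: box_open. Qed.

Lemma axis1_measurable :
  measurable (MK2 K `&` [set p | p.1 = 0] : set (borel_plane K)).
Proof.
have -> : MK2 K `&` [set p | p.1 = 0] = MK2 K `\` (MK2 K `&` [set p | p.1 <> 0]).
  by apply/seteqP; split => p /= [h1 h2]; split=> //; [case|apply: contrapT => h3; apply: h2].
apply: measurableD; apply: open_measurable; first exact: MK2_open.
apply: open_planeI; first exact: MK2_open.
move=> p /= p0; exists (absK p.1); first exact: abs_gt0.
by move=> p' h _ e; move: h; rewrite e sub0r absN ltxx.
Qed.

Lemma axis2_measurable :
  measurable (MK2 K `&` [set p | p.2 = 0] : set (borel_plane K)).
Proof.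
have -> : MK2 K `&` [set p | p.2 = 0] = MK2 K `\` (MK2 K `&` [set p | p.2 <> 0]).
  by apply/seteqP; split => p /= [h1 h2]; split=> //; [case|apply: contrapT => h3; apply: h2].
apply: measurableD; apply: open_measurable; first exact: MK2_open.
apply: open_planeI; first exact: MK2_open.
move=> p /= p0; exists (absK p.2); first exact: abs_gt0.
by move=> p' _ h e; move: h; rewrite e sub0r absN ltxx.
Qed.

Lemma unif_red x i (b : resfield K) : OK K (x / unif K ^+ i) ->
  red (x / unif K ^+ i) = b <-> absK (x - unif K ^+ i * liftK b) <= rho ^+ i.+1.
Proof.
move=> hx; have [hb rb] := liftKP b; rewrite -{1}rb red_eq//.
have u0 : unif K ^+ i != 0 by rewrite expf_neq0 ?unif_neq0.
have -> : x - unif K ^+ i * liftK b = unif K ^+ i * (x / unif K ^+ i - liftK b).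
  by rewrite mulrBr mulrCA divff// mulr1.
rewrite absKM abs_unifX exprSr ler_pM2l ?rhoX_gt0//.
exact: MK_le.
Qed.

Lemma abs_div_unif x i : OK K (x / unif K ^+ i) <-> absK x <= rho ^+ i.
Proof. by rewrite /OK /= absM_div abs_unifX ler_pdivrMr ?mul1r ?rhoX_gt0. Qed.

Section Haar.
Variable mu : {measure set (borel_plane K) -> \bar R}.
Hypothesis haar_mu : normalized_haar mu.

Lemma box_translate x i y j : mu (box x i y j) = mu (box 0 i 0 j).
Proof.
have [inv _] := haar_mu; rewrite -(inv (- x, - y) _ (box_measurable 0 i 0 j)).
by congr (mu _); apply/seteqP; split => p; rewrite /box /= !subr0.
Qed.

Lemma box_fin i j : mu (box 0 i 0 j) \is a fin_num.
Proof.
rewrite ge0_fin_numE//; apply: (@le_lt_trans _ _ (mu (OK K `*` OK K))).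
  apply: le_measure; rewrite ?inE -?box00; [exact: box_measurable..|].
  by move=> p [h1 h2]; split; rewrite expr0; [apply: le_trans h1 _|apply: le_trans h2 _];
    rewrite exprn_ile1 ?rho_ge0 ?rho_le1.
by have [_ ->] := haar_mu; rewrite ltry.
Qed.

Lemma sume_cst (I : finType) (m : \bar R) : m \is a fin_num ->
  (\sum_(i : I) m)%E = (#|I|%:R%:E * m)%E.
Proof.
by move=> /fineK <-; rewrite sumEFin sumr_const -EFinM mulr_natl.
Qed.

Lemma haar_solve (m : \bar R) (r : R) : (0 <= m)%E ->
  (r%:E = #|resfield K|%:R%:E * m)%E -> m = (r * rho)%:E.
Proof.
have q0 : (0 : R) < #|resfield K|%:R by rewrite ltr0n ltnW// card_res_gt1.
case: m => [m| |]//= _; last by rewrite gt0_muley ?lte_fin.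
by rewrite -EFinM => -[->]; rewrite -[rho]/(#|resfield K|%:R^-1) mulrAC mulfV ?mul1r// gt_eqF.
Qed.

(** The next digit of the first coordinate cuts the box into q translates of a box one step
    smaller. *)
Lemma box_split_x i j : mu (box 0 i 0 j) = (#|resfield K|%:R%:E * mu (box 0 i.+1 0 j))%E.
Proof.
pose phi (p : borel_plane K) := red (p.1 / unif K ^+ i).
have fib b : box 0 i 0 j `&` phi @^-1` [set b] = box (unif K ^+ i * liftK b) i.+1 0 j.
  have [hb _] := liftKP b.
  apply/seteqP; split => p; rewrite /box /phi /= !subr0.
    by move=> [[h1 h2]] /unif_red e; split=> //; apply: e; apply/abs_div_unif.
  move=> [h1 h2].
  have h : absK p.1 <= rho ^+ i.
    rewrite -(subrK (unif K ^+ i * liftK b) p.1); apply: absD_le.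
      by apply: le_trans h1 _; rewrite rhoX_le.
    by rewrite absKM abs_unifX ler_piMr ?rhoX_ge0.
  by split=> //; apply/unif_red => //; apply/abs_div_unif.
rewrite (@measure_fin _ _ _ mu _ _ phi) => [||b]; last 2 first.
- exact: box_measurable.
- by rewrite fib; exact: box_measurable.
under eq_bigr => b _ do rewrite fib box_translate.
by rewrite sume_cst ?box_fin.
Qed.

Lemma box_split_y i j : mu (box 0 i 0 j) = (#|resfield K|%:R%:E * mu (box 0 i 0 j.+1))%E.
Proof.
pose phi (p : borel_plane K) := red (p.2 / unif K ^+ j).
have fib b : box 0 i 0 j `&` phi @^-1` [set b] = box 0 i (unif K ^+ j * liftK b) j.+1.
  have [hb _] := liftKP b.
  apply/seteqP; split => p; rewrite /box /phi /= !subr0.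
    by move=> [[h1 h2]] /unif_red e; split=> //; apply: e; apply/abs_div_unif.
  move=> [h1 h2].
  have h : absK p.2 <= rho ^+ j.
    rewrite -(subrK (unif K ^+ j * liftK b) p.2); apply: absD_le.
      by apply: le_trans h2 _; rewrite rhoX_le.
    by rewrite absKM abs_unifX ler_piMr ?rhoX_ge0.
  by split=> //; apply/unif_red => //; apply/abs_div_unif.
rewrite (@measure_fin _ _ _ mu _ _ phi) => [||b]; last 2 first.
- exact: box_measurable.
- by rewrite fib; exact: box_measurable.
under eq_bigr => b _ do rewrite fib box_translate.
by rewrite sume_cst ?box_fin.
Qed.

Lemma box_measure x i y j : mu (box x i y j) = (rho ^+ (i + j))%:E.
Proof.
rewrite box_translate; elim: j => [|j IH].
  elim: i => [|i IH]; first by rewrite box00 expr0; have [_ ->] := haar_mu.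
  rewrite addn0 exprSr -[i in rho ^+ i]addn0.
  by apply: haar_solve => //; rewrite -IH box_split_x.
rewrite addnS exprSr; apply: haar_solve => //.
by rewrite -IH box_split_y.
Qed.

Lemma null_x : mu (MK2 K `&` [set p | p.1 = 0]) = 0%E.
Proof.
have mN := axis1_measurable.
apply/eqP; rewrite eq_le measure_ge0 andbT; apply/lee_addgt0Pr => e e0.
have [n hn] := rhoX_small K e0; rewrite add0e.
apply: (@le_trans _ _ (mu (box 0 n 0 1))).
  apply: le_measure; rewrite ?inE//; first exact: box_measurable.
  move=> p /= [[_ h] e1]; rewrite /box /= e1 subrr abs0 rhoX_ge0 subr0 expr1; split=> //.
  exact/MK_le.
rewrite box_measure lee_fin; apply: le_trans (ltW hn).
by rewrite rhoX_le// leq_addr.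
Qed.

Lemma null_y : mu (MK2 K `&` [set p | p.2 = 0]) = 0%E.
Proof.
have mN := axis2_measurable.
apply/eqP; rewrite eq_le measure_ge0 andbT; apply/lee_addgt0Pr => e e0.
have [n hn] := rhoX_small K e0; rewrite add0e.
apply: (@le_trans _ _ (mu (box 0 1 0 n))).
  apply: le_measure; rewrite ?inE//; first exact: box_measurable.
  move=> p /= [[h _] e1]; rewrite /box /= e1 subrr abs0 rhoX_ge0 subr0 expr1; split=> //.
  exact/MK_le.
rewrite box_measure lee_fin; apply: le_trans (ltW hn).
by rewrite rhoX_le// leq_addl.
Qed.

End Haar.

(* [lev z] encodes |z|: 0 for z = 0 and e.+1 for |z| = rho ^+ e. *)
Definition lev z : nat := if z == 0 then 0%N else (vK z).+1.
Definition levabs (k : nat) : R := if k is e.+1 then rho ^+ e else 0.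

Lemma levabsK z : OK K z -> absK z = levabs (lev z).
Proof.
move=> h; rewrite /lev; case: eqP => [->|z0]; first by rewrite abs0.
by rewrite /= -vKP.
Qed.

Lemma lev_eq0 z : lev z = 0%N -> z = 0.
Proof. by rewrite /lev; case: eqP. Qed.

Lemma lev_near z z' : absK (z' - z) < absK z -> lev z' = lev z.
Proof.
move=> h; have e := absB_dom h.
have n0 (u : K) : 0 < absK u -> u != 0 by move=> h'; apply/eqP => u0; move: h'; rewrite u0 abs0 ltxx.
have z0 : 0 < absK z by apply: le_lt_trans h; apply: absK_ge0.
rewrite /lev (negbTE (n0 _ z0)) (negbTE (n0 z' _)) ?e//.
by congr _.+1; rewrite /vK; congr (xget _ _); apply/seteqP; split => n /=; rewrite e.
Qed.

(** By the ultrametric inequality the levels with F nonzero are open; the level F = 0 is what they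
    leave of D. *)
Lemma lev_measurable D (F : plane K -> K) : open_plane D ->
  (forall p, D p -> forall e : R, 0 < e -> exists2 d : R, 0 < d & forall p', D p' ->
    absK (p'.1 - p.1) < d -> absK (p'.2 - p.2) < d -> absK (F p' - F p) < e) ->
  forall k, measurable (D `&` (lev \o F) @^-1` [set k] : set (borel_plane K)).
Proof.
move=> oD cF.
have op k : open_plane (D `&` (lev \o F) @^-1` [set k.+1]).
  move=> p [Dp /= ek]; have F0 : 0 < absK (F p).
    by apply: abs_gt0 => e; move: ek; rewrite e /lev eqxx.
  have [d d0 hd] := cF p Dp _ F0; have [d' d'0 hd'] := oD p Dp.
  exists (Num.min d d'); first by rewrite lt_min d0.
  move=> p'; rewrite !lt_min => /andP[h1 h2] /andP[h3 h4].
  by have Dp' := hd' p' h2 h4; split=> //=; rewrite -ek; apply: lev_near; apply: hd.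
case=> [|k]; last exact: open_measurable.
have -> : D `&` (lev \o F) @^-1` [set 0%N] =
    D `\` \bigcup_k (D `&` (lev \o F) @^-1` [set k.+1]).
  apply/seteqP; split => p /= [Dp h]; split=> //; first by case=> k _ [_ /=]; rewrite h.
  by case e : (lev (F p)) => [|k]//; exfalso; apply: h; exists k.
apply: measurableD; first exact: open_measurable.
by apply: bigcup_measurable => k _; apply: open_measurable.
Qed.

Definition torus : set (plane K) := MK2 K `&` [set p | p.1 <> 0 /\ p.2 <> 0].

(** These data are locally constant on the torus, so any condition on them cuts out an open set. *)
Definition units_data p : (nat * nat) * (resfield K * resfield K) :=
  ((vK p.1, vK p.2), (ac p.1, ac p.2)).

Lemma vK_ac_near x x' : OK K x -> absK (x' - x) < absK x -> vK x' = vK x /\ ac x' = ac x.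
Proof.
move=> hx h; have e := absB_dom h.
have x0 : x <> 0 by move=> x0; move: h; rewrite x0 abs0 ltNge absK_ge0.
have ev : vK x' = vK x.
  by rewrite /vK; congr (xget _ _); apply/seteqP; split => n /=; rewrite e.
split=> //; rewrite /ac ev; apply/red_eq.
- by apply/abs_div_unif; rewrite e (vKP hx x0).
- by apply/abs_div_unif; rewrite (vKP hx x0).
by rewrite -mulrBl absM_div abs_unifX -(vKP hx x0) ltr_pdivrMr ?mul1r ?abs_gt0.
Qed.

Lemma torus_open (P : (nat * nat) * (resfield K * resfield K) -> Prop) :
  open_plane (torus `&` [set p | P (units_data p)]).
Proof.
move=> p [[Mp [x0 y0]] /= Pp]; have [d d0 hd] := MK2_open Mp.
exists (Num.min d (Num.min (absK p.1) (absK p.2))).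
  by rewrite !lt_min d0 !abs_gt0.
move=> p'; rewrite !lt_min => /andP[h1 /andP[h2 _]] /andP[h3 /andP[_ h4]].
have [Mx My] := Mp.
have [e1 e2] := vK_ac_near (MK_OK Mx) h2; have [e3 e4] := vK_ac_near (MK_OK My) h4.
split; last by rewrite /= /units_data e1 e2 e3 e4.
split; first exact: hd.
split=> e; [move: h2|move: h4]; rewrite e sub0r absN ltxx//.
Qed.

Lemma torus_fiber_measurable (V : Type) (phi : (nat * nat) * (resfield K * resfield K) -> V)
  (P : (nat * nat) * (resfield K * resfield K) -> Prop) k :
  measurable (torus `&` [set p | P (units_data p)] `&` (phi \o units_data) @^-1` [set k]
    : set (borel_plane K)).
Proof.
rewrite (_ : _ `&` _ = torus `&` [set p | (fun d => P d /\ phi d = k) (units_data p)]).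
  exact: (open_measurable (@torus_open (fun d => P d /\ phi d = k))).
by apply/seteqP; split => p /= => [[[h1 h2] h3]|[h1 [h2 h3]]].
Qed.

Lemma torus_box m n (b c : resfield K) : (0 < m)%N -> (0 < n)%N -> b != 0 -> c != 0 ->
  torus `&` [set p | units_data p = ((m, n), (b, c))] =
  box (unif K ^+ m * liftK b) m.+1 (unif K ^+ n * liftK c) n.+1.
Proof.
move=> m0 n0 b0 c0.
have one x i (d : resfield K) : d != 0 -> (0 < i)%N ->
    (MK K x /\ x <> 0 /\ vK x = i /\ ac x = d) <->
    absK (x - unif K ^+ i * liftK d) <= rho ^+ i.+1.
  move=> d0 i0; have [hd rd] := liftKP d.
  have ad : absK (liftK d) = 1 by apply/red_neq0 => //; rewrite rd; apply/eqP.
  split=> [[Mx [x0 [vx ax]]]|h].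
    have e := vKP (MK_OK Mx) x0; apply/unif_red; last by rewrite -ax /ac vx.
    by apply/abs_div_unif; rewrite e vx.
  have e : absK x = rho ^+ i.
    rewrite -[RHS]mulr1 -ad -abs_unifX -absKM; apply: absB_dom; apply: le_lt_trans h _.
    by rewrite absKM ad abs_unifX mulr1 rhoX_ltE.
  have vx := vK_eq e; split; first exact: comb_MK e i0.
  split; first exact: rhoX_neq0 e.
  by split=> //; rewrite /ac vx; apply/unif_red => //; apply/abs_div_unif; rewrite e.
apply/seteqP; split => p; rewrite /box /torus /MK2 /units_data /=.
  by move=> [[[h1 h2] [h3 h4]] [h5 h6 h7 h8]]; split; apply/one.
move=> [/(one _ _ _ b0 m0)[h1 [h2 [h3 h4]]] /(one _ _ _ c0 n0)[h5 [h6 [h7 h8]]]].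
by split; [split|rewrite h3 h4 h7 h8].
Qed.

(** A finite labelling of O_K modulo the n-th power of M_K, built one residue digit at a time. It
    serves to cut sets into finitely many boxes. *)
Lemma digits n : exists (I : finType) (dig : K -> I), forall x x', OK K x -> OK K x' ->
  dig x = dig x' <-> absK (x - x') <= rho ^+ n.
Proof.
elim: n => [|n [I [dig hI]]].
  by exists unit, (fun=> tt) => x x' hx hx'; rewrite expr0; split=> // _; apply: absB_le.
(* [r] picks a representative of each class, relative to which the next digit is read. *)
pose r (i : I) : K := xget 0 [set x | OK K x /\ dig x = i].
have rP x : OK K x -> OK K (r (dig x)) /\ absK (x - r (dig x)) <= rho ^+ n.
  move=> hx; rewrite /r; case: xgetP => [y _ [hy e]|/(_ x)[]//].
  by split=> //; apply/hI.
exists (I * resfield K)%type,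
  (fun x => (dig x, red ((x - r (dig x)) / unif K ^+ n))) => x x' hx hx'.
have [hr h] := rP x hx; have [hr' h'] := rP x' hx'.
have key (e : dig x = dig x') : red ((x - r (dig x)) / unif K ^+ n) =
    red ((x' - r (dig x')) / unif K ^+ n) <-> absK (x - x') <= rho ^+ n.+1.
  rewrite red_eq; [|exact/abs_div_unif|exact/abs_div_unif].
  rewrite -mulrBl -e opprB addrA subrK absM_div abs_unifX ltr_pdivrMr ?rhoX_gt0// mul1r.
  by split=> [/abs_ltX//|le]; apply: le_lt_trans le _; rewrite rhoX_ltE.
split=> [[e /key]|le]; first exact.
have e : dig x = dig x' by apply/hI => //; apply: le_trans le _; rewrite rhoX_le.
by congr pair => //; apply/key.
Qed.

End PlaneMeasure.

(** * Integrals over the cells *)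

Section CellIntegrals.
Variables (R : realType) (K : padicField R) (T : seq (nat * nat)).
Hypothesis reg : regular_subdivision T.
Variables (f : fps2 K) (N : nat -> nat).
Hypotheses (f_int : integral2 f)
  (f_newton : newton T (fun c => absK c = 1) N f).
Variable mu : {measure set (borel_plane K) -> \bar R}.
Hypothesis haar_mu : normalized_haar mu.
Variable s : R[i].
Hypothesis s_gt : 0 < complex.Re s.

Local Notation rho := (rho K).
Local Notation F := (resfield K).
Local Notation q := (#|F|).
Local Notation torus := (@torus R K).
Local Notation units_data := (@units_data R K).

(** Each pair of nonzero residues cuts out a box of radii rho^(m+1) and rho^(n+1), whence the
    exponent m + n + 2. *)
Lemma units_measure m n (A : pred (F * F)) : (0 < m)%N -> (0 < n)%N ->
  mu (torus `&` [set p | (vK p.1, vK p.2) = (m, n) /\ A (ac p.1, ac p.2)]) =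
  (#|[pred d : F * F | [&& d.1 != 0, d.2 != 0 & A d]]|%:R * rho ^+ (m + n + 2))%:E.
Proof.
move=> m0 n0; pose P (d : (nat * nat) * (F * F)) := d.1 = (m, n) /\ A d.2.
rewrite (_ : torus `&` _ = torus `&` [set p | P (units_data p)])//.
rewrite (@measure_fin _ _ _ mu _ _ (snd \o units_data)); last 2 first.
- exact: (open_measurable (@torus_open _ _ P)).
- by move=> d; apply: (@torus_fiber_measurable _ _ _ snd).
under eq_bigr => d _.
  rewrite (_ : mu _ = (if [&& d.1 != 0, d.2 != 0 & A d] then
      rho ^+ (m + n + 2) else 0)%:E); first over.
  case: d => b c /=; case: ifPn => [/and3P[d1 d2 Ad]|nA].
    rewrite [X in mu X](_ : _ = torus `&` [set p | units_data p = ((m, n), (b, c))]).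
      by rewrite torus_box// (box_measure haar_mu)//; congr (rho ^+ _)%:E; lia.
    apply/seteqP; split => p /=.
      by move=> [[hp [e1 e2]] e3]; split=> //; move: e1 e3; rewrite /units_data /= => -> ->.
    move=> [hp e]; split; last by have := congr1 snd e.
    by split=> //; rewrite -[X in P X]/(units_data p) e /P.
  rewrite [X in mu X](_ : _ = set0) ?measure0//.
  apply/seteqP; split => p //= [[[[Mx My] [x0 y0]] [_ Ap]] [e1 e2]].
  by move: nA; rewrite -e1 -e2 /= Ap !ac_neq0//; apply: MK_OK.
by rewrite sumEFin -big_mkcond /= sumr_const mulr_natl.
Qed.

Lemma card_units : #|[pred x : F | x != 0]| = q.-1.
Proof. by rewrite (cardC1 (0 : F)). Qed.

Lemma card_units2 : #|[pred d : F * F | [&& d.1 != 0, d.2 != 0 & true]]| = (q.-1 * q.-1)%N.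
Proof.
rewrite -card_units -cardX; apply: eq_card => d; rewrite !inE /=.
by rewrite andbT.
Qed.

(** The solutions form one orbit of the one-parameter subgroup of weight t, parametrized by z in
    F^*. *)
Lemma card_tcoord t t' (b : F) : detv t t' = 1 -> b != 0 ->
  #|[pred d : F * F | [&& d.1 != 0, d.2 != 0 & tcoord t d.1 d.2 == b]]| = q.-1.
Proof.
move=> dt b0; rewrite -card_units.
pose psi (z : F) := (z ^+ t.1 * b ^+ t'.1, z ^+ t.2 * b ^+ t'.2).
have psiK : {in [pred x : F | x != 0], cancel psi (fun d => d.1 ^+ t'.2 / d.2 ^+ t'.1)}.
  move=> z /= z0; rewrite !exprMn -!exprM.
  move: dt; rewrite /detv => dt.
  have e : (t.1 * t'.2 = (t.2 * t'.1).+1)%N by lia.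
  rewrite e [(t'.2 * t'.1)%N]mulnC exprS -mulf_div divff ?expf_neq0//.
  by rewrite mulr1 mulfK// expf_neq0.
rewrite -(card_in_imset (can_in_inj psiK)); apply: eq_card => d; rewrite !inE /=.
apply/and3P/imsetP => [[d1 d2 /eqP e]|[z]].
  exists (d.1 ^+ t'.2 / d.2 ^+ t'.1).
    by rewrite inE mulf_neq0 ?invr_eq0 ?expf_neq0.
  have [e1 e2] := tcoord_solve dt d1 d2; rewrite e in e1 e2.
  by rewrite /psi -e1 -e2 -surjective_pairing.
rewrite inE => z0 ->; split=> /=; rewrite ?mulf_neq0 ?expf_neq0//.
by rewrite tcoordE.
Qed.

Definition zeta_fun (p : plane K) : R[i] := cpow (absK (eval2 f p)) s.

Lemma eval2_MK2_OK p : MK2 K p -> OK K (eval2 f p).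
Proof. by case: p => x y [h1 h2]; apply: eval2_OK. Qed.

Lemma lev_f_measurable D : open_plane D -> D `<=` MK2 K ->
  forall k, measurable (D `&` (@lev R K \o eval2 f) @^-1` [set k] : set (borel_plane K)).
Proof.
move=> oD DM; apply: lev_measurable => // p Dp e e0; exists (e / 2).
  by rewrite divr_gt0.
move=> p' Dp' h1 h2; case: p p' Dp Dp' h1 h2 => [x y] [x' y'] /DM[/= m1 m2] /DM[/= m3 m4] h1 h2.
apply: (@le_lt_trans _ _ (e / 2)); last by rewrite ltr_pdivrMr// ltr_pMr// ltr1n.
by apply: eval2_lip => //; apply: ltW.
Qed.

Lemma MK2_finite : (mu (MK2 K) < +oo)%E.
Proof. by rewrite MK2E (box_measure haar_mu)// ltry. Qed.

Lemma zeta_integrable : cintegrable mu (MK2 K) zeta_fun.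
Proof.
have := @cintegrable_discrete _ (borel_plane K) R mu (MK2 K) zeta_fun (@lev R K \o eval2 f)
  (fun k => cpow (levabs K k) s).
apply.
- exact: (open_measurable (@MK2_open _ K)).
- exact: MK2_finite.
- by apply: lev_f_measurable => //; apply: MK2_open.
- by move=> p Mp; rewrite /zeta_fun (levabsK (eval2_MK2_OK Mp)).
- move=> p Mp; apply: normc_cpow_le1 => //; first exact: absK_ge0.
  exact: eval2_MK2_OK.
Qed.

Lemma zeta_integrable_torus P :
  cintegrable mu (torus `&` [set p | P (units_data p)]) zeta_fun.
Proof.
apply: cintegrableS zeta_integrable.
- exact: (open_measurable (@MK2_open _ K)).
- exact: (open_measurable (@torus_open _ _ P)).
- by move=> p [[]].
Qed.

(** The inverse of q^(N_j s + nu_j): the ratio of the geometric series in the direction T_j. *)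
Definition weight j : R[i] :=
  cpow (rho ^+ N j) s * (rho ^+ ((ray T j).1 + (ray T j).2))%:C.

Lemma weightX j k : weight j ^+ k =
  cpow (rho ^+ (k * N j)) s * (rho ^+ (k * ((ray T j).1 + (ray T j).2)))%:C.
Proof.
rewrite /weight exprMn -cpowX ?rhoX_gt0// -!exprM -rmorphXn /= -exprM.
by rewrite ![(_ * k)%N]mulnC.
Qed.

Lemma ray_nu_gt0 j : (j <= (size T).+1)%N -> (0 < (ray T j).1 + (ray T j).2)%N.
Proof.
case: (leqP j (size T)) => [h _|h1 h2]; first by have [] := detv_gt0 (ray_vltS reg h).
have -> : j = (size T).+1 by apply/eqP; rewrite eqn_leq h2.
by have [] := detv_gt0 (ray_vltS reg (leqnn _)).
Qed.

Lemma weight_lt1 j : (j <= (size T).+1)%N -> normc (weight j) < 1.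
Proof.
move=> hj; rewrite /weight normcM normc_real ger0_norm ?rhoX_ge0//.
apply: (@le_lt_trans _ _ (1 * rho ^+ ((ray T j).1 + (ray T j).2))).
  rewrite ler_wpM2r ?rhoX_ge0// normc_cpow_le1 ?rhoX_ge0//.
  by rewrite exprn_ile1 ?rho_ge0 ?rho_le1.
by rewrite mul1r exprn_ilt1 ?rho_ge0 ?rho_lt1// -lt0n ray_nu_gt0.
Qed.

Lemma weight_neq1 j : (j <= (size T).+1)%N -> 1 - weight j != 0.
Proof.
move=> /weight_lt1 h; rewrite subr_eq0; apply/eqP => e.
by move: h; rewrite -e (_ : normc 1 = 1) ?ltxx//; exact: normc1.
Qed.

Definition cone_set j (d : (nat * nat) * (F * F)) :=
  cell T d.1 = j /\ detv (ray T j) d.1 <> 0.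
Definition ray_set j (b : F) (d : (nat * nat) * (F * F)) :=
  [/\ cell T d.1 = j, detv (ray T j) d.1 = 0 & tcoord (ray T j) d.2.1 d.2.2 = b].

Lemma torus_vK p : torus p -> [/\ (0 < vK p.1)%N, (0 < vK p.2)%N,
  absK p.1 = rho ^+ vK p.1 & absK p.2 = rho ^+ vK p.2].
Proof.
case: p => x y [[/= Mx My] [x0 y0]].
have ex := vKP (MK_OK Mx) x0; have ey := vKP (MK_OK My) y0.
by split=> //; rewrite lt0n; apply/eqP => e; [move: Mx|move: My];
  rewrite /MK /= ?ex ?ey e expr0 ltxx.
Qed.

Lemma comb_pos j k l : (j <= size T)%N -> (0 < k)%N -> (0 < l)%N || (0 < j)%N ->
  (0 < (comb T j k l).1)%N /\ (0 < (comb T j k l).2)%N.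
Proof.
move=> hj k0; rewrite /comb /=; case: (posnP j) => [-> |j0 _].
  rewrite orbF => l0; have := ray_det reg (leq0n (size T)).
  rewrite ray0 /detv /=; nia.
have [p1 p2] := ray_pos reg j0 hj; nia.
Qed.

Lemma comb_nu j k l : ((comb T j k l).1 + (comb T j k l).2 =
  k * ((ray T j).1 + (ray T j).2) + l * ((ray T j.+1).1 + (ray T j.+1).2))%N.
Proof. by rewrite /comb /=; lia. Qed.

Lemma cone_fiber j k l : (j <= size T)%N ->
  torus `&` [set p | cone_set j (units_data p) /\
    (`|detv (ray T j.+1) (units_data p).1|%N = k.+1 /\
     `|detv (ray T j) (units_data p).1|%N = l.+1)] =
  torus `&` [set p | (vK p.1, vK p.2) = comb T j k.+1 l.+1 /\ true].
Proof.
move=> hj; have [c1 c2] := @comb_pos j k.+1 l.+1 hj isT isT.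
apply/seteqP; split => p /= [tp].
  move=> [[e ne] [e1 e2]]; split=> //; split=> //.
  have [v1 v2 _ _] := torus_vK tp;
  have [k' [l' [k0 + el ek]]] := comb_cell reg (V := (vK p.1, vK p.2)) v1 v2.
  by rewrite el ek -[cell T _]/(cell T (units_data p).1) e e1 e2.
have [ec e1 e2] := cell_comb reg hj (ltn0Sn k) c1 c2.
move=> [e _]; rewrite /cone_set /= !e ec e1 e2; split=> //; split=> //; split=> //.
Qed.

(** The integrand is constant where the valuations are (k+1) T_j + (l+1) T_(j+1), so this is a
    double geometric series. The factor (1 - rho)^2 counts (q - 1)^2 pairs of residues of area rho^2
    each. *)
Lemma cone_integral j : (j <= size T)%N ->
  cintegral mu (torus `&` [set p | cone_set j (units_data p)]) zeta_fun =
  ((1 - rho) ^+ 2)%:C * (weight j / (1 - weight j)) *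
    (weight j.+1 / (1 - weight j.+1)).
Proof.
move=> hj; set D := torus `&` _.
(* Up to sign these determinants are the coefficients along T_j and T_(j+1), positive in the open
   cone; the predecessors start both series at 0. *)
pose phi (d : (nat * nat) * (F * F)) := (`|detv (ray T j.+1) d.1|%N).-1.
pose psi (d : (nat * nat) * (F * F)) := (`|detv (ray T j) d.1|%N).-1.
have cellneg p : torus p -> cone_set j (units_data p) ->
    (0 < `|detv (ray T j.+1) (units_data p).1|)%N /\
    (0 < `|detv (ray T j) (units_data p).1|)%N.
  move=> tp [e ne]; have [v1 v2 _ _] := torus_vK tp.
  have [_] := cellP T (V := (units_data p).1) v1 v2; rewrite e => lt.
  by rewrite !absz_gt0 lt_eqF//; split=> //; apply/eqP.
have meas k : measurable (D `&` (phi \o units_data) @^-1` [set k] : set (borel_plane K)).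
  exact: torus_fiber_measurable.
have base k l : cintegral mu (D `&` (phi \o units_data) @^-1` [set k] `&`
    (psi \o units_data) @^-1` [set l]) zeta_fun =
    (((1 - rho) ^+ 2)%:C * weight j ^+ k.+1 * weight j.+1) * weight j.+1 ^+ l.
  rewrite (_ : D `&` _ `&` _ =
      torus `&` [set p | (vK p.1, vK p.2) = comb T j k.+1 l.+1 /\ predT (ac p.1, ac p.2)]).
    have [c1 c2] := @comb_pos j k.+1 l.+1 hj isT isT.
    rewrite (@cintegral_ext _ _ _ _ _ _
        (fun=> cpow (rho ^+ (k.+1 * N j + l.+1 * N j.+1)) s)) => [|p].
      rewrite cintegral_cst; last first.
        exact: (open_measurable (@torus_open _ _ (fun d => d.1 = comb T j k.+1 l.+1 /\ predT d.2))).
      rewrite [comb T j k.+1 l.+1]surjective_pairing.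
      rewrite units_measure//= card_units2 -mulrA -exprS !weightX.
      rewrite exprD cpowM ?rhoX_gt0// comb_nu.
      set a := cpow _ s; set b := cpow _ s.
      have -> : (q.-1 * q.-1)%:R * rho ^+ (k.+1 * ((ray T j).1 + (ray T j).2) +
          l.+1 * ((ray T j.+1).1 + (ray T j.+1).2) + 2) =
          (1 - rho) ^+ 2 * rho ^+ (k.+1 * ((ray T j).1 + (ray T j).2)) *
          rho ^+ (l.+1 * ((ray T j.+1).1 + (ray T j.+1).2)).
        rewrite !exprD; set u := rho ^+ (_ * _); set v := rho ^+ (_ * _).
        have e : q.-1%:R * rho = 1 - rho :> R.
          rewrite -subn1 natrB ?(ltnW (card_res_gt1 K))// mulrBl mul1r mulfV//.
          by rewrite pnatr_eq0 -lt0n ltnW// card_res_gt1.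
        by rewrite -e natrM; ring.
      by rewrite !rmorphM /=; ring.
    move=> [tp [e _]]; have [v1 v2 a1 a2] := torus_vK tp; have [[Mx My] _] := tp.
    rewrite /zeta_fun [p]surjective_pairing (cone_abs reg f_int f_newton hj (ltn0Sn k) (ltn0Sn l))//.
      by rewrite a1 -e.
    by rewrite a2 -e.
  rewrite -cone_fiber//; apply/seteqP; split => p /=.
    move=> [[[tp hc] <-] <-]; split=> //; split=> //.
    by have [h1 h2] := cellneg p tp hc; rewrite /phi /psi /= !prednK.
  by move=> [tp [hc [e1 e2]]]; rewrite /phi /psi /= e1 e2.
have inner k : cintegral mu (D `&` (phi \o units_data) @^-1` [set k]) zeta_fun =
    (((1 - rho) ^+ 2)%:C * weight j * (weight j.+1 / (1 - weight j.+1))) * weight j ^+ k.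
  rewrite (@cintegral_geo _ _ _ mu _ _ (psi \o units_data)
    (((1 - rho) ^+ 2)%:C * weight j ^+ k.+1 * weight j.+1) (weight j.+1)) //.
  - rewrite [weight j ^+ k.+1]exprS; move: ((1 - weight j.+1)^-1) => i.
    by move: (weight j) (weight j.+1) (_%:C) => u v c; ring.
  - move=> l; rewrite -setIA (_ : D `&` _ = torus `&` [set p | (fun d => cone_set j d /\
        phi d = k) (units_data p)] `&` (psi \o units_data) @^-1` [set l]).
      exact: (@torus_fiber_measurable _ _ _ psi (fun d => cone_set j d /\ phi d = k) l).
    by apply/seteqP; split => p /= => [[[h1 h2] [h3 h4]]|[[h1 [h2 h3]] h4]].
  - apply: (cintegrableS _ _ _ (@zeta_integrable_torus (cone_set j))) => //.
      exact: (open_measurable (@torus_open _ _ (cone_set j))).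
  - exact: weight_lt1.
rewrite (@cintegral_geo _ _ _ mu _ _ (phi \o units_data) _ (weight j) _ meas _ _ inner).
- move: ((1 - weight j.+1)^-1) ((1 - weight j)^-1) => i i'.
  by move: (weight j) (weight j.+1) (_%:C) => u v c; ring.
- exact: (open_measurable (@torus_open _ _ (cone_set j))).
- exact: zeta_integrable_torus.
- by apply: weight_lt1; apply: leqW.
Qed.

Lemma ray_fiber j b k : (0 < j <= size T)%N ->
  torus `&` [set p | ray_set j b (units_data p) /\
    `|detv (ray T j.+1) (units_data p).1|%N = k.+1] =
  torus `&` [set p | (vK p.1, vK p.2) = comb T j k.+1 0 /\
    tcoord (ray T j) (ac p.1, ac p.2).1 (ac p.1, ac p.2).2 == b].
Proof.
move=> /andP[j0 hj]; have [c1 c2] : (0 < (comb T j k.+1 0).1)%N /\ (0 < (comb T j k.+1 0).2)%N.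
  by apply: comb_pos => //; rewrite j0 orbT.
apply/seteqP; split => p /= [tp].
  move=> [[e d0 tc] e1]; split=> //; split; last exact/eqP.
  have [v1 v2 _ _] := torus_vK tp.
  have [k' [l' [k0 + el ek]]] := comb_cell reg (V := (vK p.1, vK p.2)) v1 v2.
  by rewrite el ek -[cell T _]/(cell T (units_data p).1) e e1 d0.
have [ec e1 e2] := cell_comb reg hj (ltn0Sn k) c1 c2.
move=> [e /eqP tc]; rewrite /ray_set /= !e ec e1 e2; split=> //.
Qed.

Lemma ray_fiber_measurable j b k : measurable (torus `&` [set p | ray_set j b (units_data p)] `&`
  ((fun d => (`|detv (ray T j.+1) d.1|%N).-1) \o units_data) @^-1` [set k]
  : set (borel_plane K)).
Proof. exact: torus_fiber_measurable. Qed.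

Lemma ray_fiberE j b k : (0 < j <= size T)%N ->
  torus `&` [set p | ray_set j b (units_data p)] `&`
    ((fun d => (`|detv (ray T j.+1) d.1|%N).-1) \o units_data) @^-1` [set k] =
  torus `&` [set p | (vK p.1, vK p.2) = comb T j k.+1 0 /\
    tcoord (ray T j) (ac p.1, ac p.2).1 (ac p.1, ac p.2).2 == b].
Proof.
move=> hj; rewrite -ray_fiber//; apply/seteqP; split => p /=.
  move=> [[tp hr] <-]; split=> //; split=> //.
  have [v1 v2 _ _] := torus_vK tp; case: hr => e _ _.
  have [_] := cellP T (V := (units_data p).1) v1 v2; rewrite e => lt.
  by rewrite prednK// absz_gt0 lt_eqF.
by move=> [tp [hr e]]; rewrite e.
Qed.

(** Off the strict transform |f| depends on the valuations only, and the multiples of T_j give one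
    geometric series. Each term has q - 1 pairs of residues with torus coordinate b. *)
Lemma ray_integral j b : (0 < j <= size T)%N -> b != 0 ->
  off_strict T (map_fps2 (@red R K) f) N j b ->
  cintegral mu (torus `&` [set p | ray_set j b (units_data p)]) zeta_fun =
  (q.-1%:R * rho ^+ 2)%:C * (weight j / (1 - weight j)).
Proof.
move=> hj0 b0 off; have /andP[j0 hj] := hj0.
have dt := ray_det reg hj.
pose phi (d : (nat * nat) * (F * F)) := (`|detv (ray T j.+1) d.1|%N).-1.
have base k : cintegral mu (torus `&` [set p | ray_set j b (units_data p)] `&`
    (phi \o units_data) @^-1` [set k]) zeta_fun =
    ((q.-1%:R * rho ^+ 2)%:C * weight j) * weight j ^+ k.
  rewrite ray_fiberE//.
  have [c1 c2] : (0 < (comb T j k.+1 0).1)%N /\ (0 < (comb T j k.+1 0).2)%N.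
    by apply: comb_pos => //; rewrite j0 orbT.
  rewrite (@cintegral_ext _ _ _ _ _ _ (fun=> cpow (rho ^+ (k.+1 * N j)) s)) => [|p].
    rewrite cintegral_cst; last first.
      exact: (open_measurable (@torus_open _ _ (fun d => d.1 = comb T j k.+1 0 /\
        tcoord (ray T j) d.2.1 d.2.2 == b))).
    rewrite [comb T j k.+1 0]surjective_pairing.
    rewrite (@units_measure _ _ (fun d => tcoord (ray T j) d.1 d.2 == b))//=.
    rewrite (card_tcoord dt b0) -mulrA -exprS weightX -[cpow _ _ * _ in RHS]mulrC.
    rewrite [cpow _ _ * _ in LHS]mulrC mulrA; congr (_ * _).
    rewrite comb_nu mul0n addn0 -rmorphM /= exprD; congr (_%:C).
    by rewrite mulrA mulrAC.
  move=> [tp [e /eqP tc]]; have [v1 v2 a1 a2] := torus_vK tp; have [[Mx My] [x0 y0]] := tp.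
  rewrite /zeta_fun [p]surjective_pairing (ray_abs reg f_int f_newton hj0 (ltn0Sn k))//.
  - by rewrite a1 -e.
  - by rewrite a2 -e.
  - rewrite (init_tcoord _ _ dt) ?ac_neq0//; try exact: MK_OK.
    by rewrite /= in tc; rewrite tc.
rewrite (@cintegral_geo _ _ _ mu _ _ (phi \o units_data) _ (weight j) _ _ _ _ base).
- by rewrite mulrA.
- exact: (open_measurable (@torus_open _ _ (ray_set j b))).
- exact: ray_fiber_measurable.
- exact: zeta_integrable_torus.
- by apply: weight_lt1; apply: leqW.
Qed.

Lemma ray_set_j0 b : torus `&` [set p | ray_set 0 b (units_data p)] = set0.
Proof.
apply/seteqP; split => p //= [tp [_ + _]]; have [v1 v2 _ _] := torus_vK tp.
by rewrite ray0 /detv /=; lia.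
Qed.

Lemma ray_set_b0 j : torus `&` [set p | ray_set j 0 (units_data p)] = set0.
Proof.
apply/seteqP; split => p //= [[[Mx My] [x0 y0]] [_ _]] /eqP.
by rewrite (negbTE (tcoord_neq0 _ _ _)) ?ac_neq0//; apply: MK_OK.
Qed.

Lemma zeta_torus : cintegral mu (MK2 K) zeta_fun = cintegral mu torus zeta_fun.
Proof.
have mM : measurable (MK2 K : set (borel_plane K)) by exact: (open_measurable (@MK2_open _ K)).
have mT : measurable (torus : set (borel_plane K)).
  rewrite -[torus]setIT; exact: (open_measurable (@torus_open _ K (fun=> True))).
pose Nu : set (borel_plane K) := MK2 K `\` torus.
have mN : measurable Nu by apply: measurableD.
have N0 : mu Nu = 0%E.
  apply/eqP; rewrite eq_le measure_ge0 andbT.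
  apply: (@le_trans _ _ (mu ((MK2 K `&` [set p | p.1 = 0]) `|` (MK2 K `&` [set p | p.2 = 0])))).
    apply: le_measure; rewrite ?inE//.
      by apply: measurableU; [exact: axis1_measurable|exact: axis2_measurable].
    move=> p [Mp nt]; apply: contrapT => h; apply: nt; split=> //.
    by split=> e; apply: h; [left|right].
  apply: le_trans (measureU2 _ _ _) _; [exact: axis1_measurable|exact: axis2_measurable|].
  have le0 (m : \bar R) : m = 0%E -> (m <= 0)%E by move=> ->.
  by rewrite -[leRHS]adde0; apply: leeD; apply: le0; [exact: null_x|exact: null_y].
rewrite (@cintegral_null _ _ _ mu (MK2 K) Nu zeta_fun mM mN _ N0); first last.
- exact: zeta_integrable.
- by move=> p [].
by congr (cintegral mu _ _); rewrite setDD; apply/seteqP; split => p; [case|move=> tp; split=> //; case: tp].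
Qed.

Lemma zeta_decomposition : cintegral mu (MK2 K) zeta_fun =
  \sum_(j < (size T).+1) cintegral mu (torus `&` [set p | cone_set j (units_data p)]) zeta_fun +
  \sum_(j < (size T).+1) \sum_(b : F)
    cintegral mu (torus `&` [set p | ray_set j b (units_data p)]) zeta_fun.
Proof.
rewrite zeta_torus.
(* A label with finitely many values: the cell, together with [None] inside the open cone or the
   torus coordinate on the ray. *)
pose phi (d : (nat * nat) * (F * F)) : 'I_(size T).+1 * option F :=
  (inord (cell T d.1), if detv (ray T (cell T d.1)) d.1 == 0
    then Some (tcoord (ray T (cell T d.1)) d.2.1 d.2.2) else None).
have tE : torus = torus `&` [set p | (fun=> True) (units_data p)] by rewrite [RHS]setIT.
rewrite {1}tE (@cintegral_fin _ _ _ mu _ _ _ (phi \o units_data)); last 3 first.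
- exact: (open_measurable (@torus_open _ _ (fun=> True))).
- by move=> i; apply: (@torus_fiber_measurable _ _ _ phi (fun=> True)).
- exact: (@zeta_integrable_torus (fun=> True)).
rewrite -tE; pose G j o := cintegral mu (torus `&` (phi \o units_data) @^-1` [set (j, o)]) zeta_fun.
rewrite (eq_bigr (fun i => G i.1 i.2)) => [|[j o] _]//.
rewrite -(pair_bigA _ G) /= -big_split /=.
apply: eq_bigr => j _; rewrite /G.
have cj d : inord (cell T d) = j <-> cell T d = j.
  split=> [<-|->]; last exact: inord_val.
  by rewrite inordK// ltnS cell_le.
rewrite (bigD1 None)//=; congr (_ + _).
  congr (cintegral mu _ _); apply/seteqP; split => p /= [tp].
    by rewrite /phi => -[/cj e]; rewrite e; case: eqP => // ne _; split.
  move=> [e ne]; split=> //; by rewrite /phi e inord_val; case: eqP.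
rewrite (reindex_omap Some id); last by case.
apply: eq_big => [b|b _]; first by rewrite eqxx.
congr (cintegral mu _ _); apply/seteqP; split => p /= [tp].
  by rewrite /phi => -[/cj e]; rewrite e; case: eqP => // e0 [tc]; split.
by move=> [e e0 tc]; split=> //; rewrite /phi e inord_val e0 eqxx tc.
Qed.

End CellIntegrals.

(** * Tschirnhausen coordinates *)

Section TschirnhausenMap.
Variables (R : realType) (K : padicField R) (T : seq (nat * nat)) (j : nat).
Hypotheses (reg : regular_subdivision T) (hj : (0 < j <= size T)%N).
Local Notation a := (ray T j).1.
Local Notation b := (ray T j).2.
Local Notation a' := (ray T j.+1).1.
Local Notation b' := (ray T j.+1).2.
Variables (h : {poly (fps K)}) (xi : K).
Hypotheses (h_int : integral2 (fps_of_poly h)) (xi_unit : absK xi = 1)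
  (h_lead : wge (ray T j) (a * b).+1 (fps_of_poly (h - binom_poly a b xi))).
Implicit Types (u v x y z : K) (w : plane K).

Local Notation rho := (rho K).
Local Notation V := (tschirnhausen_v (cone T j) (a * b) h).

Let hjT : (j <= size T)%N. Proof. by case/andP: hj. Qed.
Let a_gt0 : (0 < a)%N. Proof. by case/andP: hj => j0 hT; case: (ray_pos reg j0 hT). Qed.
Let b_gt0 : (0 < b)%N. Proof. by case/andP: hj => j0 hT; case: (ray_pos reg j0 hT). Qed.
Let ab_det : (b' * a = (a' * b).+1)%N.
Proof. by have := ray_det reg hjT; rewrite /detv; lia. Qed.

Lemma coef2_tschirnhausen_v m n : coef2 V m n = coef2 (pullback (cone T j) (fps_of_poly h)) (m + a * b) n.
Proof. by []. Qed.

Lemma tschirnhausen_v_int : integral2 V.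
Proof.
move=> m n; rewrite coef2_tschirnhausen_v.
have [->|/eqP/(coef2_pullback_neq0)[e [<- <- _]]] := eqVneq
  (coef2 (pullback (cone T j) (fps_of_poly h)) (m + a * b) n) 0; first exact: OK0.
by rewrite coef2_pullback//; apply: h_int.
Qed.

Lemma tschirnhausen_v_tame : tame V.
Proof.
exists ((a' + b') * (a * b).+1)%N => m n; rewrite coef2_tschirnhausen_v => /coef2_pullback_neq0[[e1 e2] [+ <- _]].
rewrite /dot /= => e.
have h1 : (e1 <= m + a * b)%N by rewrite -e; move: a_gt0; clear; nia.
have h2 : (e2 <= m + a * b)%N by rewrite -e; move: b_gt0; clear; nia.
by move: h1 h2; clear; move: (a * b)%N => d; nia.
Qed.

(** At u = 0 only the leading form of h remains, and it gives y^(a'b) (y + xi). *)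
Lemma coef2_tschirnhausen_v0 n : coef2 V 0 n =
  (n == (a' * b).+1)%:R + xi *+ (n == a' * b)%N.
Proof.
have lead e : dot (ray T j) e = (a * b)%N ->
    coef2 (fps_of_poly h) e.1 e.2 = coef2 (fps_of_poly (binom_poly a b xi)) e.1 e.2.
  move=> e0; have /= := @h_lead e.1 e.2.
  rewrite -surjective_pairing e0 => /(_ (ltnSn _)).
  by rewrite fps_of_polyB coef2B => /eqP; rewrite subr_eq0 => /eqP.
have binE e : coef2 (fps_of_poly (binom_poly a b xi)) e.1 e.2 =
    (e == (0, a)%N)%:R + xi *+ (e == (b, 0)%N).
  rewrite fps_of_binom coef2D !coef2_monom; case: e => m k /=.
  by rewrite !xpair_eqE -mulr_natr mul1r.
rewrite coef2_tschirnhausen_v add0n.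
have e1 : dot (ray T j) (0, a)%N = (a * b)%N by rewrite /dot /= muln0 add0n mulnC.
have e2 : dot (ray T j) (b, 0)%N = (a * b)%N by rewrite /dot /= muln0 addn0.
have f1 : dot (ray T j.+1) (0, a)%N = (a' * b).+1 by rewrite /dot /= muln0 add0n.
have f2 : dot (ray T j.+1) (b, 0)%N = (a' * b)%N by rewrite /dot /= muln0 addn0.
case: eqP => [->|n1].
  rewrite -{1}f1 -{1}e1 coef2_pullback// lead// binE eqxx.
  by rewrite xpair_eqE [(a == 0)%N]gtn_eqF// andbF [((_).+1 == _)%N]gtn_eqF.
case: eqP => [->|n2].
  rewrite -{1}f2 -{1}e2 coef2_pullback// lead// binE eqxx.
  by rewrite xpair_eqE [(b == 0)%N]gtn_eqF// add0r.
rewrite /= !mulr0n addr0; apply: coef2_pullback0 => e h1 h2; rewrite lead// binE.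
case: eqP => [ee|_]; first by case: n1; rewrite -h2 ee.
by case: eqP => [ee|_]; [case: n2; rewrite -h2 ee|rewrite addr0].
Qed.

Lemma eval2_tschirnhausen_v u y : MK K u -> OK K y -> hassum (term V u y) (eval2 V (u, y)).
Proof. exact: (eval2_tame tschirnhausen_v_int tschirnhausen_v_tame). Qed.

Definition principal (m n : nat) := (m == 0%N) && ((n == a' * b) || (n == (a' * b).+1))%N.

Lemma term_tschirnhausen_v0 u y n : term V u y 0 n =
  if n == (a' * b).+1 then y ^+ (a' * b).+1 else
  if n == (a' * b)%N then xi * y ^+ (a' * b) else 0.
Proof.
rewrite /term coef2_tschirnhausen_v0 expr0 mulr1; case: eqP => [->|_].
  by rewrite gtn_eqF// addr0 mul1r.
by case: eqP => [->|_]; rewrite add0r ?mul0r.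
Qed.

Lemma principal_sum u y : \sum_(m < (a' * b).+2) \sum_(n < (a' * b).+2 | principal m n)
  term V u y m n = y ^+ (a' * b) * (y + xi).
Proof.
rewrite big_ord_recl [X in _ + X]big1 ?addr0 => [|i _]; last by apply: big_pred0.
rewrite (big_mkcond (fun n : 'I_(a' * b).+2 => principal _ n)) !big_ord_recr /= big1 => [|n _].
  rewrite /principal !eqxx !orbT /= !term_tschirnhausen_v0 !eqxx ltn_eqF// add0r exprSr.
  by rewrite mulrDr addrC [xi * _]mulrC.
by rewrite /principal /= !ltn_eqF// ltnS ltnW.
Qed.

Lemma principal_lt m n : principal m n -> (m < (a' * b).+2)%N && (n < (a' * b).+2)%N.
Proof. by rewrite /principal => /andP[/eqP -> /orP[]/eqP ->]; rewrite /= !ltnS. Qed.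

Lemma principal_out u y m n : ~~ principal m n -> m = 0%N -> term V u y m n = 0.
Proof.
move=> + m0; rewrite /principal m0 term_tschirnhausen_v0 /= negb_or => /andP[h1 h2].
by rewrite (negbTE h1) (negbTE h2).
Qed.

Lemma tschirnhausen_v_near u y : MK K u -> OK K y ->
  absK (eval2 V (u, y) - y ^+ (a' * b) * (y + xi)) <= rho.
Proof.
move=> hu hy; rewrite -(principal_sum u).
apply: (hassum_dom (rho_ge0 K) (eval2_tschirnhausen_v hu hy) principal_lt) => m n ne.
case: m ne => [|m] ne; first by rewrite (principal_out _ _ ne)// abs0 rho_ge0.
apply: le_trans (abs_term_rho _ _ tschirnhausen_v_int hu hy) _.
by rewrite -[leRHS]expr1 rhoX_le.
Qed.

Lemma near_xi_unit y : MK K (y + xi) -> absK y = 1.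
Proof. by have := @absB_dom _ K y (- xi); rewrite opprK absN xi_unit; apply. Qed.

Lemma tschirnhausen_v_MK u y : MK K u -> MK K (y + xi) -> MK K (eval2 V (u, y)).
Proof.
move=> hu hy; have oy := unitK_OK (near_xi_unit hy).
rewrite -(subrK (y ^+ (a' * b) * (y + xi)) (eval2 V (u, y))); apply: absD_lt.
  by apply: le_lt_trans (tschirnhausen_v_near hu oy) (rho_lt1 K).
by rewrite absKM absX (near_xi_unit hy) expr1n mul1r.
Qed.

(* V(u, y) - (- xi) ^ (a' b) y varies rho times slower than y. *)
Lemma tschirnhausen_v_diff u u' y y' e : MK K u -> MK K u' -> MK K (y + xi) -> MK K (y' + xi) ->
  absK (u - u') <= e -> rho * absK (y - y') <= e ->
  absK (eval2 V (u, y) - eval2 V (u', y') - (- xi) ^+ (a' * b) * (y - y')) <= e.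
Proof.
move=> hu hu' hy hy' h1 h2; have e0 : 0 <= e by apply: le_trans h1; apply: absK_ge0.
have oy := unitK_OK (near_xi_unit hy); have oy' := unitK_OK (near_xi_unit hy').
have oxi : OK K (- xi) by apply: OKN; apply: unitK_OK.
set D := (a' * b)%N.
have := hassum_dom e0 (hassumB (eval2_tschirnhausen_v hu oy) (eval2_tschirnhausen_v hu' oy')) principal_lt.
have -> : \sum_(m < (a' * b).+2) \sum_(n < (a' * b).+2 | principal m n)
    (term V u y m n - term V u' y' m n) =
    y ^+ D * (y + xi) - y' ^+ D * (y' + xi).
  rewrite -(principal_sum u) -(principal_sum u') -sumrB; apply: eq_bigr => i _.
  by rewrite sumrB.
move=> hd; have /hd {}hd : forall m n, ~~ principal m n ->
    absK (term V u y m n - term V u' y' m n) <= e.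
  case=> [|m] n ne; first by rewrite !(principal_out _ _ ne)// subrr abs0.
  rewrite /term -!mulrA -mulrBr absKM -[leRHS]mul1r ler_pM ?absK_ge0//; first exact: tschirnhausen_v_int.
  apply: absMX_lip => //; try exact: MK_OK.
  rewrite absKM; apply: le_trans h2; rewrite ler_pM ?absK_ge0//; last exact: absX_lip.
  rewrite absX exprS; apply: le_trans (_ : rho * 1 <= _); last by rewrite mulr1.
  rewrite ler_pM ?exprn_ge0 ?absK_ge0//; first exact/MK_le.
  by rewrite exprn_ile1 ?absK_ge0//; apply: MK_OK.
set z := eval2 V (u, y) - _ in hd *.
(* The nonlinear part of y^D (y + xi) is a sum of two products: one factor is at most rho, by way of
   y + xi or y' + xi, and the other at most |y - y'|. *)
have -> : z - (- xi) ^+ D * (y - y') =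
    (z - (y ^+ D * (y + xi) - y' ^+ D * (y' + xi))) +
    ((y ^+ D - y' ^+ D) * (y + xi) + (y' ^+ D - (- xi) ^+ D) * (y - y')) by ring.
apply: absD_le => //; apply: absD_le; apply: le_trans h2; rewrite absKM.
  by rewrite mulrC ler_pM ?absK_ge0//; [exact/MK_le|exact: absX_lip].
rewrite ler_pM ?absK_ge0//; apply: le_trans (absX_lip _ oy' oxi) _.
by rewrite opprK; apply/MK_le.
Qed.

Let abs_lead z : absK ((- xi) ^+ (a' * b) * z) = absK z.
Proof. by rewrite absKM absX absN xi_unit expr1n mul1r. Qed.

Lemma tschirnhausen_v_lip u u' y y' e : MK K u -> MK K u' -> MK K (y + xi) -> MK K (y' + xi) ->
  absK (u - u') <= e -> absK (y - y') <= e ->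
  absK (eval2 V (u, y) - eval2 V (u', y')) <= e.
Proof.
move=> hu hu' hy hy' h1 h2.
rewrite -(subrK ((- xi) ^+ (a' * b) * (y - y')) (_ - _)); apply: absD_le; last by rewrite abs_lead.
apply: tschirnhausen_v_diff => //; apply: le_trans h2.
by rewrite ler_piMl ?absK_ge0 ?rho_le1.
Qed.

(** If |y - y'| exceeded e, the linear term, whose coefficient is a unit, would dominate both the
    change in u and the remainder. The case e = 0 gives uniqueness of y. *)
Lemma tschirnhausen_v_expand u u' y y' e : MK K u -> MK K u' -> MK K (y + xi) -> MK K (y' + xi) ->
  absK (u - u') <= e -> absK (eval2 V (u, y) - eval2 V (u', y')) <= e ->
  absK (y - y') <= e.
Proof.
move=> hu hu' hy hy' h1 h2; rewrite leNgt; apply/negP => lt.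
have y0 : 0 < absK (y - y') by apply: le_lt_trans lt; apply: le_trans h1; apply: absK_ge0.
have := @tschirnhausen_v_diff u u' y y' (Num.max e (rho * absK (y - y'))) hu hu' hy hy'.
rewrite !le_max h1 lexx orbT => /(_ isT isT) h3.
have : absK ((- xi) ^+ (a' * b) * (y - y')) <= Num.max e (rho * absK (y - y')).
  set z := eval2 V _ - _ in h2 h3.
  have -> : (- xi) ^+ (a' * b) * (y - y') = z - (z - (- xi) ^+ (a' * b) * (y - y')) by ring.
  by apply: absB_le; rewrite le_max ?h2.
by rewrite abs_lead leNgt gt_max lt /= gtr_pMl ?rho_lt1.
Qed.

(** Fixed point of [G], a Newton step with constant slope c = (-xi)^(a'b). By [tschirnhausen_v_diff]
    it contracts by rho, and the iteration starts at -xi. *)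
Lemma tschirnhausen_v_solve u v : MK K u -> MK K v -> exists2 y, MK K (y + xi) & eval2 V (u, y) = v.
Proof.
move=> hu hv; pose c := (- xi) ^+ (a' * b).
have c1 : absK c = 1 by rewrite -[c]mulr1 abs_lead abs1.
have c0 := abs1_neq0 c1.
pose G y := y - (eval2 V (u, y) - v) / c.
have GM y : MK K (y + xi) -> MK K (G y + xi).
  move=> hy; rewrite /G addrAC; apply: absB_lt => //.
  by rewrite absM_div c1 divr1; apply: absB_lt => //; apply: tschirnhausen_v_MK.
have Gdiff y y' : MK K (y + xi) -> MK K (y' + xi) ->
    absK (G y - G y') <= rho * absK (y - y').
  move=> hy hy'; rewrite -[leLHS]mul1r -c1 -absKM.
  have -> : c * (G y - G y') = - (eval2 V (u, y) - eval2 V (u, y') - c * (y - y')).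
    by rewrite /G; field.
  by rewrite absN; apply: tschirnhausen_v_diff => //; rewrite subrr abs0 mulr_ge0 ?rho_ge0 ?absK_ge0.
pose ys n := iter n G (- xi).
have ysM n : MK K (ys n + xi).
  by elim: n => [|n IH]; [rewrite /= addNr /MK /= abs0|apply: GM].
have ysS n : absK (ys n.+1 - ys n) <= rho ^+ n.
  elim: n => [|n IH].
    rewrite expr0 -(addrK xi (ys 1%N)) -addrA -opprD [xi + _]addrC.
    by apply: absB_le; apply: MK_OK.
  by apply: le_trans (Gdiff _ _ (ysM n.+1) (ysM n)) _; rewrite exprS ler_wpM2l ?rho_ge0.
have ysC m n : (m <= n)%N -> absK (ys n - ys m) <= rho ^+ m.
  elim: n => [|n IH]; first by rewrite leqn0 => /eqP ->; rewrite subrr abs0 rhoX_ge0.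
  rewrite leq_eqVlt => /predU1P[->|lt]; first by rewrite subrr abs0 rhoX_ge0.
  rewrite -(subrK (ys n) (ys n.+1)) -addrA; apply: absD_le; last exact: IH.
  by apply: le_trans (ysS n) _; rewrite rhoX_le.
have [|l /absK_cvgP hl] := @absK_complete _ K ys.
  move=> e e0; have [M hM] := rhoX_small K e0; exists M => m n hm hn.
  apply: le_lt_trans hM; case: (leqP m n) => [mn|/ltnW nm].
    by rewrite absBC; apply: le_trans (ysC _ _ mn) _; rewrite rhoX_le.
  by apply: le_trans (ysC _ _ nm) _; rewrite rhoX_le.
have lM : MK K (l + xi).
  have [M /(_ M (leqnn M)) hM] := hl 1 ltr01.
  have -> : l + xi = (ys M + xi) - (ys M - l) by ring.
  by apply: absB_lt => //; apply: ysM.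
exists l => //; suff Gl : G l = l.
  move: Gl; rewrite /G => /eqP; rewrite subr_eq addrC -subr_eq subrr eq_sym mulf_eq0 invr_eq0.
  by rewrite (negbTE c0) orbF subr_eq0 => /eqP.
apply: eq_of_small => e e0; have [M hM] := hl e e0.
have -> : G l - l = (ys M.+1 - l) - (G (ys M) - G l) by rewrite /ys iterS; ring.
apply: absB_lt; first by apply: hM.
apply: le_lt_trans (Gdiff _ _ (ysM M) lM) _; apply: le_lt_trans (hM M (leqnn M)).
by rewrite ler_piMl ?absK_ge0 ?rho_le1.
Qed.

Local Notation inv := (tschirnhausen_inv (cone T j) (a * b) xi h).

Lemma tschirnhausen_invP w : MK2 K w -> MK K ((inv w).2 + xi) /\ eval2 V (w.1, (inv w).2) = w.2.
Proof.
case: w => u v [/= hu hv]; case: xgetP => [y _ []//|no].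
by have [y h1 h2] := tschirnhausen_v_solve hu hv; case: (no y).
Qed.

Lemma tschirnhausen_inv_unique u y : MK K u -> MK K (y + xi) -> (inv (u, eval2 V (u, y))).2 = y.
Proof.
move=> hu hy; have [h1 /= h2] := tschirnhausen_invP (conj hu (tschirnhausen_v_MK hu hy) : MK2 K (u, eval2 V (u, y))).
have := tschirnhausen_v_expand hu hu h1 hy (e := 0); rewrite h2 !subrr abs0 lexx => /(_ isT isT) le.
apply/eqP; rewrite -subr_eq0; apply/eqP/absK_eq0/eqP.
by rewrite eq_le le absK_ge0.
Qed.

(** From (u, v) to (x, y): the inverse Tschirnhausen change followed by the toric chart. *)
Definition chart_map w : plane K :=
  (w.1 ^+ a * (inv w).2 ^+ a', w.1 ^+ b * (inv w).2 ^+ b').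

Lemma chart_map_abs w : MK2 K w ->
  absK (chart_map w).1 = absK w.1 ^+ a /\ absK (chart_map w).2 = absK w.1 ^+ b.
Proof.
move=> hw; have [/near_xi_unit hy _] := tschirnhausen_invP hw.
by split; rewrite absKM !absX hy expr1n mulr1.
Qed.

Lemma chart_map_MK w : MK2 K w -> MK2 K (chart_map w).
Proof.
move=> hw; have [e1 e2] := chart_map_abs hw; case: hw => hu _.
have lt n : (0 < n)%N -> absK w.1 ^+ n < 1.
  by move=> n0; rewrite exprn_ilt1 ?absK_ge0// -lt0n.
by split; [rewrite -[MK K _]/(is_true (absK _ < 1)) e1|
           rewrite -[MK K _]/(is_true (absK _ < 1)) e2]; apply: lt.
Qed.

Lemma in_tschirnhausenE f w : integral2 f -> MK2 K w ->
  in_tschirnhausen (cone T j) (a * b) xi h f w = eval2 f (chart_map w).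
Proof.
move=> f_int hw; have [/near_xi_unit/unitK_OK hy _] := tschirnhausen_invP hw; case: hw => hu _.
by have [_ _] := eval2_pullback reg hj f_int hu hy.
Qed.

Lemma chart_map_lip w w' e : MK2 K w -> MK2 K w' ->
  absK (w.1 - w'.1) <= e -> absK (w.2 - w'.2) <= e ->
  absK ((chart_map w).1 - (chart_map w').1) <= e /\
  absK ((chart_map w).2 - (chart_map w').2) <= e.
Proof.
move=> hw hw' h1 h2; have [m1 e1] := tschirnhausen_invP hw; have [m2 e2] := tschirnhausen_invP hw'.
have o1 := unitK_OK (near_xi_unit m1); have o2 := unitK_OK (near_xi_unit m2).
have [/MK_OK u1 _] := hw; have [/MK_OK u2 _] := hw'.
have hy : absK ((inv w).2 - (inv w').2) <= e.
  by apply: (@tschirnhausen_v_expand w.1 w'.1) => //; rewrite ?e1 ?e2//; [case: hw|case: hw'].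
have aux m n : absK (w'.1 ^+ m * ((inv w).2 ^+ n - (inv w').2 ^+ n)) <= e.
  rewrite absKM -[leRHS]mul1r ler_pM ?absK_ge0//; first exact: OKX.
  by apply: le_trans hy; apply: absX_lip.
by split; apply: absMX_lip.
Qed.

Lemma chart_mapK w : MK2 K w -> w.1 != 0 ->
  w.1 = (chart_map w).1 ^+ b' / (chart_map w).2 ^+ a' /\
  (inv w).2 = tcoord (ray T j) (chart_map w).1 (chart_map w).2.
Proof.
move=> hw u0; have [/near_xi_unit/abs1_neq0 y0 _] := tschirnhausen_invP hw.
split; last by rewrite tcoordE// ray_det.
rewrite /chart_map /= !exprMn -!exprM [(a * b')%N]mulnC ab_det [(b * a')%N]mulnC.
rewrite [(b' * a')%N]mulnC exprS -mulf_div divff ?expf_neq0//.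
by rewrite mulr1 mulfK// expf_neq0.
Qed.

(** Relative distance is preserved, with the same r < 1, by products, powers and inverses; monomial
    maps can then be handled in both directions. *)
Definition close (r : R) x0 x := absK (x - x0) <= r * absK x0.

Section Close.
Variable r : R.
Hypotheses (r_ge0 : 0 <= r) (r_lt1 : r < 1).

Lemma close_abs x0 x : close r x0 x -> absK x = absK x0.
Proof.
have [->|/eqP x00] := eqVneq x0 0.
  rewrite /close abs0 mulr0 subr0 => le; apply/eqP.
  by rewrite eq_le le absK_ge0.
move=> le; apply: absB_dom; apply: le_lt_trans le _.
by rewrite gtr_pMl// abs_gt0.
Qed.

Lemma closeM x0 x y0 y : close r x0 x -> close r y0 y -> close r (x0 * y0) (x * y).
Proof.
move=> hx hy; have ey := close_abs hy; rewrite /close.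
have -> : x * y - x0 * y0 = (x - x0) * y + x0 * (y - y0) by ring.
rewrite absKM; apply: absD_le; rewrite absKM.
  by rewrite ey mulrA ler_wpM2r ?absK_ge0.
by rewrite mulrCA ler_wpM2l ?absK_ge0.
Qed.

Lemma closeX x0 x n : close r x0 x -> close r (x0 ^+ n) (x ^+ n).
Proof.
move=> hx; elim: n => [|n IH]; last by rewrite !exprS; apply: closeM.
by rewrite /close !expr0 subrr abs0 mulr_ge0 ?absK_ge0.
Qed.

Lemma closeV x0 x : close r x0 x -> close r x0^-1 x^-1.
Proof.
move=> hx; have ex := close_abs hx.
have [x00|x00] := eqVneq x0 0.
  move: hx; rewrite /close x00 subr0 abs0 mulr0 invr0 subr0 abs0 mulr0 absV => le.
  have -> : absK x = 0 by apply/eqP; rewrite eq_le le absK_ge0.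
  by rewrite invr0.
have p0 : 0 < absK x0 by apply: abs_gt0; apply/eqP.
have xn : x != 0 by apply/eqP => e; move: p0; rewrite -ex e abs0 ltxx.
have e : x^-1 - x0^-1 = - ((x - x0) / (x * x0)) by field; rewrite ?xn ?x00.
rewrite /close e absN absM_div absKM ex absV.
rewrite ler_pdivrMr ?mulr_gt0// [absK x0 * _]mulrC -mulrA [_^-1 * _]mulrA mulVf ?gt_eqF//.
by rewrite mul1r.
Qed.

End Close.

(** The monomial maps between (u, y) and (x, y) preserve relative distance. As y is a unit,
    closeness in y is absolute, and by the Lipschitz bounds in both directions it amounts to
    closeness in v once u is close. *)
Lemma chart_map_close n w w' : MK2 K w -> MK2 K w' -> w.1 != 0 -> w'.1 != 0 ->
  let r := rho ^+ n.+1 in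
  close r (chart_map w).1 (chart_map w').1 /\ close r (chart_map w).2 (chart_map w').2 <->
  close r w.1 w'.1 /\ absK (w'.2 - w.2) <= r.
Proof.
move=> hw hw' u0 u'0 r.
have r0 : 0 <= r by apply: rhoX_ge0.
have r1 : r < 1 by rewrite -[ltRHS](expr0 rho) rhoX_ltE.
have [m1 e1] := tschirnhausen_invP hw; have [m2 e2] := tschirnhausen_invP hw'.
have a1 := near_xi_unit m1; have [hu hv] := hw; have [hu' hv'] := hw'.
have cu : close r w.1 w'.1 -> absK (w'.1 - w.1) <= r.
  by move=> h1; apply: le_trans h1 _; rewrite ler_piMr//; apply: MK_OK.
split=> [[h1 h2]|[h1 h2]].
  have [eu ey] := chart_mapK hw u0; have [eu' ey'] := chart_mapK hw' u'0.
  have cy : close r (inv w).2 (inv w').2.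
    by rewrite ey ey' /tcoord; apply: closeM => //; [exact: closeX|apply: closeV => //; exact: closeX].
  have cu' : close r w.1 w'.1.
    by rewrite eu eu'; apply: closeM => //; [exact: closeX|apply: closeV => //; exact: closeX].
  split=> //; rewrite -e1 -e2; apply: tschirnhausen_v_lip => //; first exact: cu.
  by move: cy; rewrite /close a1 mulr1.
have cy : close r (inv w).2 (inv w').2.
  rewrite /close a1 mulr1; apply: (@tschirnhausen_v_expand w'.1 w.1) => //; first exact: cu.
  by rewrite e1 e2.
by split; apply: closeM => //; apply: closeX.
Qed.

Definition shell k : set (plane K) := MK2 K `&` [set w | absK w.1 = rho ^+ k].
(** Will be the image of [shell k] under [chart_map]. *)
Definition piece k : set (plane K) := @torus R K `&` [set p |
  (vK p.1, vK p.2) = comb T j k 0 /\ tcoord (ray T j) (ac p.1) (ac p.2) = - red xi].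

Lemma piece_abs k p : piece k p -> absK p.1 = rho ^+ (k * a) /\ absK p.2 = rho ^+ (k * b).
Proof.
move=> [[[/= Mx My] [x0 y0]] [e _]]; have := e; rewrite /comb !mul0n !addn0 => -[<- <-].
by split; apply: vKP => //; apply: MK_OK.
Qed.

(** As the valuations are k (a, b), the powers of the uniformizer cancel in y^a / x^b. *)
Lemma tcoord_red k x y : absK x = rho ^+ (k * a) -> absK y = rho ^+ (k * b) ->
  tcoord (ray T j) (ac x) (ac y) = red (tcoord (ray T j) x y) /\ absK (tcoord (ray T j) x y) = 1.
Proof.
move=> ax ay; have vx := vK_eq ax; have vy := vK_eq ay.
have e1 : absK (tcoord (ray T j) x y) = 1.
  rewrite /tcoord absM_div !absX ax ay -!exprM.
  by rewrite (_ : k * b * a = k * a * b)%N ?divff ?gt_eqF ?rhoX_gt0//; lia.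
split=> //.
have [ux uy] : absK (x / unif K ^+ (k * a)) = 1 /\ absK (y / unif K ^+ (k * b)) = 1.
  by rewrite !absM_div !abs_unifX ax ay !divff ?gt_eqF ?rhoX_gt0.
rewrite /ac vx vy /tcoord.
have oX n := OKX n (unitK_OK ux); have oY n := OKX n (unitK_OK uy).
rewrite -!redX; [|exact: unitK_OK..].
set X := (x / _) ^+ _ in oX *; set Y := (y / _) ^+ _.
have X1 : absK X = 1 by rewrite absX ux expr1n.
have oq : OK K (y ^+ a / x ^+ b) by apply: unitK_OK.
have rX0 : red X != 0 by apply/eqP/red_neq0 => //; apply: unitK_OK.
apply: (mulIf rX0); rewrite divfK// -redM//; last exact: unitK_OK.
congr (red _); rewrite /X /Y !expr_div_n -!exprM.
have -> : (k * b * a = k * a * b)%N by lia.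
have x0 : x ^+ b != 0 by rewrite expf_neq0//; apply/eqP; apply: rhoX_neq0 ax.
by rewrite mulrA divfK.
Qed.

Lemma chart_map_shell k w : (0 < k)%N -> shell k w -> piece k (chart_map w).
Proof.
move=> k0 [hw /= aw]; have [m1 e1] := tschirnhausen_invP hw; have y1 := near_xi_unit m1.
have u0 := introN eqP (rhoX_neq0 aw).
have [ax ay] := chart_map_abs hw; rewrite aw -!exprM in ax ay.
split.
  by split; [exact: chart_map_MK|split; [exact: rhoX_neq0 ax|exact: rhoX_neq0 ay]].
split; first by rewrite (vK_eq ax) (vK_eq ay) /comb !mul0n !addn0.
have [-> _] := tcoord_red ax ay; have [_ <-] := chart_mapK hw u0.
rewrite -redN; last exact: unitK_OK.
by apply/red_eq; rewrite ?opprK//; [exact: unitK_OK|apply: OKN; exact: unitK_OK].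
Qed.

(** Inverting the monomial chart recovers u and y from the point, and v is then the value of the
    Tschirnhausen series at (u, y). *)
Lemma chart_map_onto k p : (0 < k)%N -> piece k p -> exists2 w, shell k w & chart_map w = p.
Proof.
move=> k0 hp; have [ax ay] := piece_abs hp; case: hp => -[_ [/eqP x0 /eqP y0]] [_ tc].
have [e y1] := tcoord_red ax ay; set y := tcoord _ p.1 p.2 in e y1.
have [sx sy] := tcoord_solve (ray_det reg hjT) x0 y0.
set u := p.1 ^+ b' / p.2 ^+ a' in sx sy.
have au : absK u = rho ^+ k.
  rewrite /u absM_div !absX ax ay -!exprM.
  have -> : (k * a * b' = k + k * b * a')%N by rewrite -mulnA [(a * b')%N]mulnC ab_det; lia.
  by rewrite exprD mulfK// gt_eqF// rhoX_gt0.
have hu : MK K u by apply: comb_MK au k0.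
have hy : MK K (y + xi).
  have oxi := unitK_OK xi_unit.
  rewrite -[xi]opprK; apply/(red_eq (unitK_OK y1) (OKN oxi)).
  by rewrite redN// -e.
exists (u, eval2 V (u, y)); first by split=> //; split=> //; apply: tschirnhausen_v_MK.
by rewrite /chart_map tschirnhausen_inv_unique//= -sx -sy -surjective_pairing.
Qed.

Lemma piece_close k n p p' : piece k p ->
  absK (p'.1 - p.1) <= rho ^+ (n.+1 + k * a) ->
  absK (p'.2 - p.2) <= rho ^+ (n.+1 + k * b) -> piece k p'.
Proof.
move=> hp h1 h2; have [ax ay] := piece_abs hp; case: hp => -[[Mx My] _] [e tc].
have {}h1 : absK (p'.1 - p.1) < absK p.1.
  by apply: le_lt_trans h1 _; rewrite ax rhoX_ltE addSn ltnS leq_addl.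
have {}h2 : absK (p'.2 - p.2) < absK p.2.
  by apply: le_lt_trans h2 _; rewrite ay rhoX_ltE addSn ltnS leq_addl.
have [v1 c1] := vK_ac_near (MK_OK Mx) h1; have [v2 c2] := vK_ac_near (MK_OK My) h2.
have a1 := absB_dom h1; have a2 := absB_dom h2.
split; last by rewrite /= v1 v2 c1 c2.
split; first by split; [rewrite -[MK K _]/(is_true (absK _ < 1)) a1|
  rewrite -[MK K _]/(is_true (absK _ < 1)) a2].
by split; [apply: rhoX_neq0; rewrite a1; exact: ax|apply: rhoX_neq0; rewrite a2; exact: ay].
Qed.

Section Transfer.
Variable mu : {measure set (borel_plane K) -> \bar R}.
Hypothesis haar_mu : normalized_haar mu.

(* chart_map identifies small boxes of a shell with small boxes of a piece, with a
   constant ratio of measures. *)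
Lemma measure_transfer k n (P : set (plane K)) : (0 < k)%N ->
  (forall p p', piece k p -> P p -> absK (p'.1 - p.1) <= rho ^+ n ->
     absK (p'.2 - p.2) <= rho ^+ n -> MK2 K p' -> P p') ->
  measurable (piece k `&` P : set (borel_plane K)) ->
  measurable (shell k `&` chart_map @^-1` P : set (borel_plane K)) ->
  mu (piece k `&` P) =
    ((rho ^+ (k * (a + b).-1))%:E * mu (shell k `&` chart_map @^-1` P))%E.
Proof.
move=> k0 invP mW mV.
(* On the piece |x| = rho^(k a) and |y| = rho^(k b), so equal labels mean relative distance at most
   rho^(n+1). *)
have [I [dx hdx]] := @digits R K (n.+1 + k * a)%N.
have [J [dy hdy]] := @digits R K (n.+1 + k * b)%N.
pose lab (p : plane K) := (dx p.1, dy p.2).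
have labP p p' : MK2 K p -> MK2 K p' -> lab p' = lab p <->
    absK (p'.1 - p.1) <= rho ^+ (n.+1 + k * a) /\ absK (p'.2 - p.2) <= rho ^+ (n.+1 + k * b).
  move=> [/MK_OK x1 /MK_OK y1] [/MK_OK x2 /MK_OK y2]; split.
    by move=> [/hdx h1 /hdy h2]; split; [exact: h1|exact: h2].
  by move=> [h1 h2]; congr pair; [apply/hdx|apply/hdy].
have closeP p p' c : piece k p -> P p -> lab p = c -> piece k p' -> lab p' = c -> P p'.
  move=> hp Pp <- hp'; have [[Mp _] _] := hp; have [[Mp' _] _] := hp'.
  move=> /(labP _ _ Mp Mp')[h1 h2]; apply: (invP p) => //.
    by apply: le_trans h1 _; rewrite rhoX_le//; lia.
  by apply: le_trans h2 _; rewrite rhoX_le//; lia.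
(* A nonempty fibre is the box around any of its points, so one is chosen. *)
have fibW c : piece k `&` P `&` lab @^-1` [set c] =
    (if pselect (exists p, [/\ piece k p, P p & lab p = c]) is left e
     then let p := sval (cid e) in box p.1 (n.+1 + k * a) p.2 (n.+1 + k * b) else set0).
  case: pselect => [e|no]; last first.
    by apply/seteqP; split => p //= [[h1 h2] h3]; apply: no; exists p.
  case: cid => p [hp Pp lp] /=; have [[Mp _] _] := hp.
  apply/seteqP; split => p' /=.
    by move=> [[hp' Pp'] lp']; have [[Mp' _] _] := hp'; apply/labP => //; rewrite lp.
  move=> [h1 h2]; have hp' := piece_close hp h1 h2.
  have lp' : lab p' = c by rewrite -lp; apply/labP => //; case: hp' => -[].
  by split=> //; split=> //; apply: closeP Pp lp hp' lp'.
(* By [chart_map_close] the matching fibre is the box around a preimage of the same point, with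
   relative precision in u and absolute precision in v. *)
have fibV c : shell k `&` chart_map @^-1` P `&` (lab \o chart_map) @^-1` [set c] =
    (if pselect (exists p, [/\ piece k p, P p & lab p = c]) is left e
     then let w := sval (cid2 (chart_map_onto k0 (let: And3 hp _ _ := svalP (cid e) in hp))) in
       box w.1 (n.+1 + k) w.2 n.+1 else set0).
  case: pselect => [e|no]; last first.
    apply/seteqP; split => w //= [[h1 h2] h3]; apply: no; exists (chart_map w).
    by split=> //; apply: chart_map_shell.
  case: cid2 => w hw /=; case: (cid e) => p /= [hp Pp lp] ew.
  have [Mw aw] := hw; have w0 := introN eqP (rhoX_neq0 aw).
  have [ax ay] := piece_abs hp.
  have cl w' : shell k w' -> lab (chart_map w') = c <-> box w.1 (n.+1 + k) w.2 n.+1 w'.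
    move=> [Mw' aw']; have w'0 := introN eqP (rhoX_neq0 aw').
    have := chart_map_close n Mw Mw' w0 w'0.
    rewrite /close ew ax ay aw /= -!exprD => hcl; apply: iff_trans hcl.
    rewrite -lp -ew; apply: iff_trans (labP _ _ _ _) _; [exact: chart_map_MK..|].
    by rewrite ew.
  apply/seteqP; split => w' /=; first by move=> [[hw' _] /(cl w' hw')].
  move=> hb; have hw' : shell k w'.
    case: (hb) => h1 h2; have aw' : absK w'.1 = absK w.1.
      apply: absB_dom; apply: le_lt_trans h1 _.
      by rewrite aw rhoX_ltE addSn ltnS leq_addl.
    split; last by rewrite /= aw' aw.
    split; first by rewrite -[MK K _]/(is_true (absK _ < 1)) aw'; case: Mw.
    rewrite -[MK K _]/(is_true (absK _ < 1)) -(subrK w.2 w'.2).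
    apply: absD_lt; last by case: Mw.
    by apply: le_lt_trans h2 _; rewrite -[ltRHS](expr0 rho) rhoX_ltE.
  have lw' : lab (chart_map w') = c by apply/cl.
  by split=> //; split=> //; apply: closeP Pp lp (chart_map_shell k0 hw') lw'.
(* The area exponents are 2(n+1) + k(a+b) in the piece and 2(n+1) + k in the shell; they differ by
   k(a+b-1). *)
have e : (k * (a + b) = k * (a + b).-1 + k)%N.
  by rewrite -{1}(prednK (_ : 0 < a + b)%N) ?addn_gt0 ?a_gt0// mulnS addnC.
rewrite (@measure_fin _ _ _ mu _ _ lab mW) => [|c]; last first.
  rewrite fibW; case: pselect => [e'|no]; last exact: measurable0.
  exact: box_measurable.
rewrite (@measure_fin _ _ _ mu _ _ (lab \o chart_map) mV) => [|c]; last first.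
  rewrite fibV; case: pselect => [e'|no]; last exact: measurable0.
  exact: box_measurable.
have tr c : mu (piece k `&` P `&` lab @^-1` [set c]) =
    ((rho ^+ (k * (a + b).-1))%:E *
      mu (shell k `&` chart_map @^-1` P `&` (lab \o chart_map) @^-1` [set c]))%E.
  rewrite fibW fibV; case: pselect => [e'|no]; last by rewrite !measure0 mule0.
  rewrite !(box_measure haar_mu) -EFinM -exprD; congr (_ ^+ _)%:E.
  by move: e; rewrite mulnDr; lia.
under eq_bigr => c _ do rewrite tr.
by rewrite ge0_sume_distrr.
Qed.

Variables (f : fps2 K) (s : R[i]).
Hypotheses (f_int : integral2 f) (s_gt : 0 < complex.Re s).

Local Notation tf := (in_tschirnhausen (cone T j) (a * b) xi h f).

Lemma in_tschirnhausen_measurable k :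
  measurable (MK2 K `&` (@lev R K \o tf) @^-1` [set k] : set (borel_plane K)).
Proof.
apply: lev_measurable; first exact: MK2_open.
move=> p Mp e e0; exists (e / 2); first by rewrite divr_gt0.
move=> p' Mp' h1 h2; rewrite !in_tschirnhausenE//.
apply: (@le_lt_trans _ _ (e / 2)); last by rewrite ltr_pdivrMr// ltr_pMr// ltr1n.
have [l1 l2] := chart_map_lip Mp' Mp (ltW h1) (ltW h2).
have [m1 m2] := chart_map_MK Mp; have [m3 m4] := chart_map_MK Mp'.
rewrite [chart_map p']surjective_pairing [chart_map p]surjective_pairing.
exact: eval2_lip.
Qed.

Lemma lev_fst_measurable k :
  measurable (MK2 K `&` (fun w : plane K => lev w.1) @^-1` [set k] : set (borel_plane K)).
Proof.
have := @lev_measurable _ K (MK2 K) fst (@MK2_open _ K); apply=> p Mp e e0.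
by exists e.
Qed.

Lemma lev_abs z k : OK K z -> lev z = k.+1 <-> absK z = rho ^+ k.
Proof.
rewrite /lev => hz; case: eqP => [->|z0]; first by split=> // /rhoX_neq0.
by rewrite (vKP hz z0); split=> [[->]//|/rhoX_inj ->].
Qed.

Lemma shell_lev k : MK2 K `&` (fun w : plane K => lev w.1) @^-1` [set k.+1] = shell k.
Proof.
by apply/seteqP; split => w /= [Mw hw]; split=> //; apply/lev_abs => //; case: Mw => /MK_OK.
Qed.

Lemma in_tschirnhausen_OK w : MK2 K w -> OK K (tf w).
Proof.
move=> Mw; rewrite in_tschirnhausenE//; have [m1 m2] := chart_map_MK Mw.
by rewrite [chart_map w]surjective_pairing; apply: eval2_OK.
Qed.

Definition tschirnhausen_fun (w : plane K) : R[i] :=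
  cpow (absK (tf w)) s * (absK w.1 ^+ (a + b).-1)%:C.

Lemma tschirnhausen_integrable : cintegrable mu (MK2 K) tschirnhausen_fun.
Proof.
(* The integrand depends on the levels of f and of u; [pickle] encodes the pair as one natural
   number. *)
pose c k : R[i] := if @pickle_inv (nat * nat)%type k is Some (e, m) then
  cpow (levabs K e) s * (levabs K m ^+ (a + b).-1)%:C else 0.
have := @cintegrable_discrete _ (borel_plane K) R mu (MK2 K) tschirnhausen_fun
  (fun w => pickle (lev (tf w), lev w.1)) c.
apply.
- exact: (open_measurable (@MK2_open _ K)).
- exact: MK2_finite haar_mu.
- move=> k; case ek : (@pickle_inv (nat * nat)%type k) => [[e m]|]; last first.
    rewrite (_ : _ `&` _ = set0); first exact: measurable0.
    by apply/seteqP; split => w //= [_ hw]; move: ek; rewrite -hw pickleK_inv.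
  rewrite (_ : _ `&` _ = (MK2 K `&` (@lev R K \o tf) @^-1` [set e]) `&`
      (MK2 K `&` (fun w : plane K => lev w.1) @^-1` [set m])).
    by apply: measurableI; [exact: in_tschirnhausen_measurable|exact: lev_fst_measurable].
  apply/seteqP; split => w /=.
    by move=> [Mw hw]; move: ek; rewrite -hw pickleK_inv => -[-> ->].
  move=> [[Mw h1] [_ h2]]; split=> //; rewrite h1 h2.
  by have := @pickle_invK (nat * nat)%type k; rewrite ek.
- move=> w Mw; rewrite /c pickleK_inv /tschirnhausen_fun -levabsK; last exact: in_tschirnhausen_OK.
  by rewrite -levabsK//; apply: MK_OK; case: Mw.
- move=> w Mw; rewrite /tschirnhausen_fun normcM -[leRHS]mulr1 ler_pM ?normc_ge0//.
    by apply: normc_cpow_le1 => //; [exact: absK_ge0|exact: in_tschirnhausen_OK].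
  rewrite normc_real ger0_norm ?exprn_ge0 ?absK_ge0// exprn_ile1 ?absK_ge0//.
  by apply: MK_OK; case: Mw.
Qed.

Lemma piece_open k : open_plane (piece k).
Proof.
exact: (@torus_open _ _ (fun d => d.1 = comb T j k 0 /\
  tcoord (ray T j) d.2.1 d.2.2 = - red xi)).
Qed.

(** On a shell |u| is constant. After splitting by the level of f both integrands are constant, and
    only measures of level sets remain to be compared. *)
Lemma shell_integral k : (0 < k)%N ->
  cintegral mu (piece k) (zeta_fun f s) = cintegral mu (shell k) tschirnhausen_fun.
Proof.
move=> k0.
have mM : measurable (MK2 K : set (borel_plane K)) by exact: (open_measurable (@MK2_open _ K)).
have pM : piece k `<=` MK2 K by move=> p [[]].
have sM : shell k `<=` MK2 K by move=> p [].
have mP := open_measurable (@piece_open k).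
have mS : measurable (shell k : set (borel_plane K)).
  by rewrite -shell_lev; apply: lev_fst_measurable.
have mPf e : measurable (piece k `&` (@lev R K \o eval2 f) @^-1` [set e] : set (borel_plane K)).
  exact: (lev_f_measurable f_int (@piece_open k) pM).
have mSf e : measurable (shell k `&` (@lev R K \o tf) @^-1` [set e] : set (borel_plane K)).
  rewrite (_ : _ `&` _ = shell k `&` (MK2 K `&` (@lev R K \o tf) @^-1` [set e])).
    by apply: measurableI => //; exact: in_tschirnhausen_measurable.
  by rewrite setIA; congr (_ `&` _); apply/esym/setIidl.
apply: (cintegral_eq_fibers mP mS mPf mSf) => [||[|e]].
- apply: (cintegrableS mM mP pM); exact: zeta_integrable.
- apply: (cintegrableS mM mS sM); exact: tschirnhausen_integrable.
- rewrite (@cintegral_ext _ _ _ _ _ _ (fun=> 0)) => [|p [_ /= /lev_eq0 z]]; last first.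
    by rewrite /zeta_fun z abs0 cpow0.
  rewrite [RHS](@cintegral_ext _ _ _ _ _ _ (fun=> 0)) => [|w [_ /= /lev_eq0 z]]; last first.
    by rewrite /tschirnhausen_fun z abs0 cpow0 mul0r.
  by rewrite (cintegral_cst _ _ (mPf 0%N)) (cintegral_cst _ _ (mSf 0%N)) !mul0r.
rewrite (@cintegral_ext _ _ _ _ _ _ (fun=> cpow (rho ^+ e) s)) => [|p [hp /= hl]]; last first.
  rewrite /zeta_fun (_ : absK _ = rho ^+ e)//; apply/lev_abs => //.
  by apply: eval2_MK2_OK => //; apply: pM.
rewrite [RHS](@cintegral_ext _ _ _ _ _ _
    (fun=> cpow (rho ^+ e) s * (rho ^+ (k * (a + b).-1))%:C)) => [|w [[Mw aw] /= hl]]; last first.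
  rewrite /tschirnhausen_fun aw exprM (_ : absK _ = rho ^+ e)//; apply/lev_abs => //.
  exact: in_tschirnhausen_OK.
rewrite (cintegral_cst _ _ (mPf e.+1)) (cintegral_cst _ _ (mSf e.+1)).
have eS : shell k `&` chart_map @^-1` ((@lev R K \o eval2 f) @^-1` [set e.+1]) =
    shell k `&` (@lev R K \o tf) @^-1` [set e.+1].
  by apply/seteqP; split => w [hw /= hl]; split=> //=; rewrite -hl in_tschirnhausenE//; apply: sM.
(* The precision e + 1 suffices: f is 1-Lipschitz, so a displacement of at most rho^(e+1) does not
   change |f| = rho^e. *)
have := @measure_transfer k e.+1 ((@lev R K \o eval2 f) @^-1` [set e.+1]) k0.
rewrite eS => -> //; last first.
  move=> p p' /pM[m1 m2] /= hl h1 h2 [m3 m4].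
  have ap : absK (eval2 f p) = rho ^+ e.
    by apply/lev_abs => //; apply: eval2_MK2_OK.
  rewrite -hl; apply: lev_near; apply: (@le_lt_trans _ _ (rho ^+ e.+1)).
    by rewrite [p]surjective_pairing [p']surjective_pairing; apply: eval2_lip.
  by rewrite ap rhoX_ltE.
rewrite fineM//; first by rewrite rmorphM /= mulrA.
rewrite ge0_fin_numE//; apply: le_lt_trans (MK2_finite haar_mu).
by apply: le_measure; rewrite ?inE// => w [/sM].
Qed.

Lemma tschirnhausen_integral :
  cintegral mu (@torus R K `&` [set p | ray_set T j (- red xi) (units_data p)]) (zeta_fun f s) =
  cintegral mu (MK2 K) tschirnhausen_fun.
Proof.
have mM : measurable (MK2 K : set (borel_plane K)) by exact: (open_measurable (@MK2_open _ K)).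
have mR := open_measurable (@torus_open _ _ (ray_set T j (- red xi))).
(* At valuations k T_j the determinant is k up to sign; the successor matches [lev], which encodes
   |u| = rho^k by k + 1. *)
pose phi (d : (nat * nat) * (resfield K * resfield K)) := (`|detv (ray T j.+1) d.1|%N).+1.
have mRf k : measurable (@torus R K `&` [set p | ray_set T j (- red xi) (units_data p)] `&`
    (phi \o @units_data R K) @^-1` [set k] : set (borel_plane K)).
  exact: torus_fiber_measurable.
apply: (cintegral_eq_fibers mR mM mRf lev_fst_measurable).
- exact: zeta_integrable_torus.
- exact: tschirnhausen_integrable.
have ab1 : (0 < (a + b).-1)%N by move: a_gt0 b_gt0; clear; lia.
case=> [|[|k]].
(* Level 0 is u = 0, where |u|^(nu - 1) vanishes since nu > 1. Level 1, treated next, would be |u| =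
   1 and is empty. *)
- rewrite (_ : _ `&` _ = set0) ?cintegral_set0; last by apply/seteqP; split => p //= [].
  rewrite (@cintegral_ext _ _ _ _ _ _ (fun=> 0)) => [|w [_ /= /lev_eq0 z]]; last first.
    by rewrite /tschirnhausen_fun z abs0 expr0n gtn_eqF// mulr0.
  by rewrite cintegral_cst ?mul0r//; apply: lev_fst_measurable.
- rewrite (_ : _ `&` _ = set0) ?cintegral_set0; last first.
    apply/seteqP; split => p //= [[tp [e _ _]] [e0]].
    have [v1 v2 _ _] := torus_vK tp; have [_] := cellP T (V := (units_data p).1) v1 v2.
    by rewrite e; move: e0; rewrite /=; lia.
  rewrite shell_lev (_ : shell 0 = set0) ?cintegral_set0//.
  by apply/seteqP; split => w //= [[+ _] /= e]; rewrite /MK /= e expr0 ltxx.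
rewrite shell_lev -shell_integral//; congr (cintegral mu _ _).
apply: (@etrans _ _ (@torus R K `&` [set p | ray_set T j (- red xi) (units_data p) /\
    `|detv (ray T j.+1) (units_data p).1|%N = k.+1])).
  apply/seteqP; split => p; first by move=> [[tp hr] [e]].
  by move=> [tp [hr e]]; split=> //; rewrite /= /phi e.
rewrite (ray_fiber reg s_gt (- red xi) k hj).
by apply/seteqP; split => p [tp [e h0]]; split=> //; split=> //; apply/eqP.
Qed.

End Transfer.
End TschirnhausenMap.

(** * The explicit formula *)

Section Decomposition.
Variables (R : realType) (K : padicField R) (T : seq (nat * nat)).
Hypothesis reg : regular_subdivision T.
Variables (f : fps2 K) (c : K) (alpha beta k : nat) (r a b : nat -> nat)
  (S : nat -> nat -> nat) (xi : nat -> nat -> K) (fl : nat -> nat -> {poly fps K}).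
Hypotheses (f_int : integral2 f)
  (f_fact : f = monom2 c alpha beta * \prod_(i < k) \prod_(l < r i) fps_of_poly (fl i l))
  (c_unit : absK c = 1)
  (ab_gt0 : forall i, (i < k)%N -> (0 < a i)%N /\ (0 < b i)%N)
  (T_adm : forall i, (i < k)%N -> (a i, b i) \in T)
  (P_inj : forall i i', (i < k)%N -> (i' < k)%N -> (a i, b i) = (a i', b i') -> i = i')
  (S_gt0 : forall i l, (i < k)%N -> (l < r i)%N -> (0 < S i l)%N)
  (fl_monic : forall i l, (i < k)%N -> (l < r i)%N -> fl i l \is monic)
  (fl_size : forall i l, (i < k)%N -> (l < r i)%N -> size (fl i l) = (a i * S i l).+1)
  (fl_lead : forall i l, (i < k)%N -> (l < r i)%N -> wge (a i, b i) (a i * b i * S i l).+1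
     (fps_of_poly (fl i l - binom_poly (a i) (b i) (xi i l) ^+ S i l)))
  (xi_unit : forall i l, (i < k)%N -> (l < r i)%N -> absK (xi i l) = 1)
  (red_xi_inj : forall i l l', (i < k)%N -> (l < r i)%N -> (l' < r i)%N ->
     red (xi i l) = red (xi i l') -> l = l').

Local Notation F := (resfield K).

(** N(T_j) as the weight of the monomial plus the orders of the factors; [newton_f] identifies it
    with [Nmult]. *)
Definition orderN j : nat := (dot (ray T j) (alpha, beta) +
  \sum_(i < k) \sum_(l < r i) factor_order (a i) (b i) (S i l) (ray T j))%N.

(** The successor accounts for ray 0, which is (1, 0) and precedes the list T. *)
Definition edge i := (index (a i, b i) T).+1.

Lemma edgeP i : (i < k)%N -> (0 < edge i <= size T)%N /\ ray T (edge i) = (a i, b i).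
Proof.
by move=> hi; rewrite /edge rayE nth_index ?T_adm// index_mem T_adm.
Qed.

Definition unit_vertex t t' n n' (G : fps2 K) := exists E d,
  [/\ vertex t t' E d G, absK d = 1, dot t E = n & dot t' E = n'].

Lemma unit_vertexM t t' n n' m m' G H : vlt t t' -> unit_vertex t t' n n' G ->
  unit_vertex t t' m m' H -> unit_vertex t t' (n + m) (n' + m') (G * H).
Proof.
move=> lt [E [d [v d1 e e']]] [E' [d' [v' d'1 e'' e''']]].
exists (E.1 + E'.1, E.2 + E'.2)%N, (d * d'); split.
- exact: vertexM.
- by rewrite absKM d1 d'1 mulr1.
- by rewrite -e -e'' /dot /= !mulnDr; lia.
- by rewrite -e' -e''' /dot /= !mulnDr; lia.
Qed.

Lemma unit_vertex_prod t t' (n n' : nat -> nat) (G : nat -> fps2 K) m : vlt t t' ->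
  (forall i, (i < m)%N -> unit_vertex t t' (n i) (n' i) (G i)) ->
  unit_vertex t t' (\sum_(i < m) n i) (\sum_(i < m) n' i) (\prod_(i < m) G i).
Proof.
move=> lt; elim: m => [_|m IH h].
  rewrite !big_ord0; exists (0, 0)%N, 1; split; rewrite /dot ?muln0//.
    exact: vertex1.
  exact: abs1.
rewrite !big_ord_recr /=; apply: unit_vertexM => //; last exact: h.
by apply: IH => i hi; apply: h; apply: ltnW.
Qed.

(** Each factor contributes an end of its Newton segment, chosen by the side of P_i on which the
    cone lies. The coefficients c, 1 and xi^S are units, and vertices multiply. *)
Lemma newton_f : newton T (fun d => absK d = 1) orderN f.
Proof.
move=> j hj; have lt := ray_vltS reg hj.
have key : unit_vertex (ray T j) (ray T j.+1) (orderN j) (orderN j.+1) f.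
  rewrite {1}f_fact; apply: unit_vertexM => //.
    exists (alpha, beta), c; split=> //; exact: vertex_monom.
  apply: (@unit_vertex_prod _ _
    (fun i => (\sum_(l < r i) factor_order (a i) (b i) (S i l) (ray T j))%N)
    (fun i => (\sum_(l < r i) factor_order (a i) (b i) (S i l) (ray T j.+1))%N)
    (fun i => \prod_(l < r i) fps_of_poly (fl i l))) => // i hi.
  apply: (@unit_vertex_prod _ _
    (fun l => factor_order (a i) (b i) (S i l) (ray T j))
    (fun l => factor_order (a i) (b i) (S i l) (ray T j.+1))
    (fun l => fps_of_poly (fl i l))) => // l hl.
  have [a0 b0] := ab_gt0 hi; have [/andP[_ eT] eR] := edgeP hi.
  have mon := fl_monic hi hl; have sz := fl_size hi hl; have ld := fl_lead hi hl.
  case: (leqP (edge i) j) => h.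
    have h1 : 0 <= detv (a i, b i) (ray T j).
      by rewrite -eR; apply: ray_det_ge0 => //; apply: leqW.
    have h2 : 0 <= detv (a i, b i) (ray T j.+1).
      by rewrite -eR; apply: ray_det_ge0 => //; apply: leqW.
    have [v [e e']] := factor_vertex_hi a0 b0 mon sz ld h1 h2.
    exists (b i * S i l, 0)%N, (xi i l ^+ S i l); split=> //.
    by rewrite absX xi_unit// expr1n.
  have h1 : 0 <= detv (ray T j) (a i, b i).
    by rewrite -eR; apply: ray_det_ge0; [exact: reg|exact: ltnW|apply: leqW].
  have h2 : 0 <= detv (ray T j.+1) (a i, b i).
    by rewrite -eR; apply: ray_det_ge0; [exact: reg|exact: h|apply: leqW].
  have [v [e e']] := factor_vertex_lo a0 b0 mon sz ld h1 h2.
  exists (0, a i * S i l)%N, 1; split=> //; exact: abs1.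
by [].
Qed.

Lemma orderN0 : orderN 0 = alpha.
Proof.
rewrite /orderN ray0 /dot /= mul1n mul0n addn0 big1 ?addn0// => i _.
by rewrite big1// => l _; rewrite /factor_order mul0n minn0.
Qed.

Lemma orderN_last : orderN (size T).+1 = beta.
Proof.
rewrite /orderN ray_last /dot /= mul1n mul0n add0n big1 ?addn0// => i _.
by rewrite big1// => l _; rewrite /factor_order mul0n min0n.
Qed.

(** The initial form is the product of those of the factors. At a lift B of z each is a unit, except
    when P_i = T_j: there it is a unit times (B + xi)^S, which is a unit iff z differs from - red
    xi. *)
Lemma off_strictP j z : (0 < j <= size T)%N -> z != 0 ->
  off_strict T (map_fps2 (@red R K) f) orderN j z <->
  (forall i l, (i < k)%N -> (l < r i)%N -> edge i = j -> z <> - red (xi i l)).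
Proof.
move=> hj z0; have /andP[j0 hT] := hj; have [t1 t2] := ray_pos reg j0 hT.
have dt := ray_det reg hT; have [oB rB] := liftKP z; set B := liftK z in oB rB.
have B1 : absK B = 1 by apply/red_neq0 => //; rewrite rB; apply/eqP.
set X := B ^+ (ray T j.+1).1; set Y := B ^+ (ray T j.+1).2.
have X1 : absK X = 1 by rewrite absX B1 expr1n.
have Y1 : absK Y = 1 by rewrite absX B1 expr1n.
pose v i l := init (ray T j) (factor_order (a i) (b i) (S i l) (ray T j))
  (fps_of_poly (fl i l)) X Y.
have vE i l : (i < k)%N -> (l < r i)%N ->
    absK (v i l) = if edge i == j then absK (B + xi i l) ^+ S i l else 1.
  move=> hi hl; have [a0 b0] := ab_gt0 hi; have [/andP[e0 eT] eR] := edgeP hi.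
  have mon := fl_monic hi hl; have sz := fl_size hi hl; have ld := fl_lead hi hl.
  case: ltngtP => h; rewrite /v.
  - rewrite (factor_init_hi a0 b0 mon sz ld)//; last by rewrite -eR; apply: ray_vlt => //; apply: leqW.
    by rewrite absKM absX xi_unit// expr1n mul1r absX X1 expr1n.
  - rewrite (factor_init_lo a0 b0 mon sz ld)//; last by rewrite -eR; apply: ray_vlt => //; apply: leqW.
    by rewrite absX Y1 expr1n.
  rewrite -h eR (factor_init_eq a0 b0 ld) absX; congr (_ ^+ _).
  rewrite /X /Y -!exprM; move: dt; rewrite -h eR /detv /= => dt.
  have -> : ((ray T (edge i).+1).2 * a i = ((ray T (edge i).+1).1 * b i).+1)%N.
    by move: dt; clear; lia.
  by rewrite exprS -mulrDl absKM absX B1 expr1n mulr1.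
have vO i l : (i < k)%N -> (l < r i)%N -> OK K (v i l).
  move=> hi hl; rewrite /OK /= vE//; case: eqP => // _.
  rewrite exprn_ile1 ?absK_ge0//; apply: OKD => //; apply: unitK_OK; exact: xi_unit.
have fE : init (ray T j) (orderN j) f X Y =
    c * (X ^+ alpha * Y ^+ beta) * \prod_(i < k) \prod_(l < r i) v i l.
  have wl i : (i < k)%N -> forall l : 'I_(r i), true -> wge (ray T j)
      (factor_order (a i) (b i) (S i l) (ray T j)) (fps_of_poly (fl i l)).
    by move=> hi l _; have [a0 b0] := ab_gt0 hi; exact: (factor_wge a0 b0 (fl_monic hi (ltn_ord l)) (fl_size hi (ltn_ord l)) (fl_lead hi (ltn_ord l))).
  have w1 (i : 'I_k) : true -> wge (ray T j)
      (\sum_(l < r i) factor_order (a i) (b i) (S i l) (ray T j))%N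
      (\prod_(l < r i) fps_of_poly (fl i l)).
    by move=> _; have [] := init_prod (index_enum 'I_(r i)) X Y t1 t2 (wl i (ltn_ord i)).
  have [w2 e2] := init_prod (index_enum 'I_k) X Y t1 t2 w1.
  rewrite {1}f_fact /orderN initM//; last exact: wge_monom.
  rewrite init_monom// e2; congr (_ * _); apply: eq_bigr => i _.
  by have [_ ->] := init_prod (index_enum 'I_(r i)) X Y t1 t2 (wl i (ltn_ord i)).
have oP (i : 'I_k) : true -> OK K (\prod_(l < r i) v i l).
  move=> _; have [] // := @red_prod R K _ (index_enum 'I_(r i)) predT (fun l : 'I_(r i) => v i l).
  by move=> l _; apply: vO.
have [rP oPP] := red_prod (index_enum 'I_k) oP.
have cXY : absK (c * (X ^+ alpha * Y ^+ beta)) = 1.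
  by rewrite !absKM (absX X) (absX Y) X1 Y1 !expr1n c_unit !mulr1.
have -> : off_strict T (map_fps2 (@red R K) f) orderN j z =
    (red (\prod_(i < k) \prod_(l < r i) v i l) != 0).
  rewrite /off_strict -rB -!redX// -red_init//; try exact: unitK_OK.
  rewrite fE redM//; last exact: unitK_OK.
  rewrite mulf_eq0 negb_or (_ : red (c * _) != 0)//.
  by apply/eqP/red_neq0 => //; apply: unitK_OK.
have unit_iff i l : (i < k)%N -> (l < r i)%N ->
    red (v i l) != 0 <-> (edge i = j -> z <> - red (xi i l)).
  move=> hi hl; have oxi := unitK_OK (xi_unit hi hl).
  split=> [/eqP/(red_neq0 (vO _ _ hi hl))|h].
    rewrite vE// => + e; rewrite e eqxx => e1 ez.
    have lt : absK (B + xi i l) < 1.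
      rewrite -(opprK (xi i l)); apply/(red_eq oB (OKN oxi)).
      by rewrite redN// rB.
    suff : absK (B + xi i l) ^+ S i l < 1 by rewrite e1 ltxx.
    by rewrite exprn_ilt1 ?absK_ge0// -lt0n S_gt0.
  apply/eqP/(red_neq0 (vO _ _ hi hl)); rewrite vE//; case: eqP => // e.
  rewrite (_ : absK _ = 1) ?expr1n//; apply/(red_neq0 (OKD oB oxi)).
  rewrite redD// rB => /eqP; rewrite addr_eq0 => /eqP; exact: h.
rewrite rP; split=> [/prodf_neq0 h i l hi hl|h].
  apply/unit_iff => //; have := h (Ordinal hi) isT => /=.
  have [-> _] := @red_prod R K _ (index_enum 'I_(r i)) predT (fun l : 'I_(r i) => v i l)
    (fun l _ => vO i l hi (ltn_ord l)).
  by move=> /prodf_neq0/(_ (Ordinal hl) isT).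
apply/prodf_neq0 => i _.
have [-> _] := @red_prod R K _ (index_enum 'I_(r i)) predT (fun l : 'I_(r i) => v i l)
  (fun l _ => vO i l (ltn_ord i) (ltn_ord l)).
by apply/prodf_neq0 => l _; apply/unit_iff => // e; apply: h.
Qed.

Definition strict_point j (z : F) : bool :=
  [exists i : 'I_k, (edge i == j) && [exists l : 'I_(r i), z == - red (xi i l)]].

Lemma strict_pointP j z : reflect (exists (i : 'I_k) (l : 'I_(r i)),
  edge i = j /\ z = - red (xi i l)) (strict_point j z).
Proof.
apply: (iffP existsP) => [[i /andP[/eqP e /existsP[l /eqP ez]]]|[i [l [e ez]]]].
  by exists i, l.
by exists i; rewrite e eqxx; apply/existsP; exists l; rewrite ez.
Qed.

Lemma off_strictE j z : (0 < j <= size T)%N -> z != 0 ->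
  off_strict T (map_fps2 (@red R K) f) orderN j z = ~~ strict_point j z.
Proof.
move=> hj z0; apply/idP/idP => [/(off_strictP hj z0) off|/strict_pointP no].
  apply/strict_pointP => -[i [l [e ez]]]; exact: (off i l (ltn_ord i) (ltn_ord l) e).
apply/off_strictP => // i l hi hl e ez; apply: no.
by exists (Ordinal hi), (Ordinal hl).
Qed.

Lemma edge_inj i i' : (i < k)%N -> (i' < k)%N -> edge i = edge i' -> i = i'.
Proof.
move=> hi hi' e; apply: P_inj => //.
by have [_ <-] := edgeP hi; have [_ <-] := edgeP hi'; rewrite e.
Qed.

(** At most one pair contributes: i is determined because the P_i are distinct, and l because the
    residues of the xi are. *)
Lemma strict_point_count j z : (strict_point j z : nat) =
  (\sum_(i < k) \sum_(l < r i) ((edge i == j) && (z == - red (xi i l))))%N.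
Proof.
case: strict_pointP => [[i [l [e ez]]]|no]; last first.
  rewrite big1// => i _; rewrite big1// => l _; case: eqP => //= e; case: eqP => // ez.
  by case: no; exists i, l.
rewrite (bigD1 i)//= (bigD1 l)//= e ez !eqxx big1 => [|l' /eqP ne]; last first.
  rewrite /=; case: eqP => // /oppr_inj e'; case: ne; apply: val_inj => /=.
  by apply/esym/(@red_xi_inj i).
rewrite big1// => i' /eqP ne; rewrite big1// => l' _; case: eqP => //= e'.
by case: ne; apply: val_inj; apply: (edge_inj (ltn_ord i') (ltn_ord i)); rewrite e' e.
Qed.

Lemma sum_strict_points (V : zmodType) (G : nat -> F -> V) :
  \sum_(j < (size T).+1) \sum_z G j z *+ strict_point j z =
  \sum_(i < k) \sum_(l < r i) G (edge i) (- red (xi i l)).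
Proof.
under eq_bigr => j _.
  under eq_bigr => z _.
    rewrite strict_point_count -sumrMnr; under eq_bigr => i _ do rewrite -sumrMnr.
    over.
  rewrite exchange_big; under eq_bigr => i _ do rewrite exchange_big.
  over.
rewrite exchange_big; apply: eq_bigr => i _; rewrite exchange_big; apply: eq_bigr => l _.
have [/andP[_ eT] _] := edgeP (ltn_ord i).
rewrite (bigD1 (Ordinal (eT : edge i < (size T).+1)%N))//=.
rewrite [X in _ + X]big1 ?addr0 => [|j /eqP ne]; last first.
  rewrite big1// => z _; case: eqP => // e; exfalso; apply: ne; exact: val_inj.
rewrite (bigD1 (- red (xi i l)))//= !eqxx big1 ?addr0// => z /negbTE ->.
by rewrite andbF.
Qed.

Variables (mu : {measure set (borel_plane K) -> \bar R}) (s : R[i])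
  (h : nat -> nat -> {poly fps K}).
Hypotheses (haar_mu : normalized_haar mu) (s_gt : 0 < complex.Re s)
  (h_int : forall i l, (i < k)%N -> (l < r i)%N -> integral2 (fps_of_poly (h i l)))
  (h_lead : forall i l, (i < k)%N -> (l < r i)%N -> wge (a i, b i) (a i * b i).+1
     (fps_of_poly (h i l - binom_poly (a i) (b i) (xi i l)))).

Local Notation wgt := (weight K T orderN s).
Local Notation good j := (#|[pred z : F | (z != 0) &&
  off_strict T (map_fps2 (@red R K) f) orderN j z]|).

(** Strict points turn ray integrals into Tschirnhausen integrals; the other points of a ray all
    give the same integral. Ray 0 and the torus coordinate 0 give empty sets. *)
Lemma zeta_formula : cintegral mu (MK2 K) (zeta_fun f s) =
  \sum_(0 <= j < (size T).+1) ((1 - rho K) ^+ 2)%:C * (wgt j / (1 - wgt j)) *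
    (wgt j.+1 / (1 - wgt j.+1)) +
  \sum_(1 <= j < (size T).+1) (good j)%:R *
    ((#|F|.-1%:R * rho K ^+ 2)%:C * (wgt j / (1 - wgt j))) +
  \sum_(i < k) \sum_(l < r i)
    cintegral mu (MK2 K) (tschirnhausen_fun T (edge i) (h i l) (xi i l) f s).
Proof.
rewrite (zeta_decomposition T f_int haar_mu s_gt) -addrA big_mkord; congr (_ + _).
  by apply: eq_bigr => j _; apply: (cone_integral reg f_int newton_f haar_mu s_gt); rewrite -ltnS.
pose I j z := cintegral mu (@torus R K `&` [set p | ray_set T j z (units_data p)]) (zeta_fun f s).
pose C j : R[i] := (#|F|.-1%:R * rho K ^+ 2)%:C * (wgt j / (1 - wgt j)).
pose g j (z : F) := [&& (0 < j)%N, z != 0 & ~~ strict_point j z].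
have IE (j : 'I_(size T).+1) z : I j z = C j *+ g j z + I j z *+ strict_point j z.
  have hj : (j <= size T)%N by rewrite -ltnS.
  rewrite /g; case: (boolP (strict_point j z)) => ht; first by rewrite !andbF mulr0n add0r.
  rewrite mulr0n addr0 andbT; case: posnP => [j0|j0].
    by rewrite /= mulr0n /I j0 (ray_set_j0 T s_gt) cintegral_set0.
  case: eqP => [->|/eqP z0]; first by rewrite /= mulr0n /I ray_set_b0 cintegral_set0.
  rewrite /= /I (ray_integral reg f_int newton_f haar_mu s_gt)// ?j0//.
  by rewrite off_strictE// j0.
under eq_bigr => j _ do under eq_bigr => z _ do rewrite -/(I _ _) IE.
under eq_bigr => j _ do rewrite big_split.
rewrite big_split /=; congr (_ + _).
  rewrite big_ord_recl big1 ?add0r => [|z _]; last by rewrite /g /= mulr0n.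
  rewrite big_add1 /= big_mkord; apply: eq_bigr => j _.
  rewrite sumrMnr -[LHS]mulr_natl; congr (_%:R * _).
  rewrite -sum1_card [RHS]big_mkcond; apply: eq_bigr => z _; rewrite inE /g /bump /=.
  have hj : (0 < j.+1 <= size T)%N by exact: ltn_ord.
  by case: eqP => //= /eqP z0; rewrite off_strictE//; case: (strict_point _ _).
rewrite sum_strict_points; apply: eq_bigr => i _; apply: eq_bigr => l _; rewrite /I.
have [e0 eR] := edgeP (ltn_ord i).
apply: tschirnhausen_integral => //; first exact: h_int.
  exact: xi_unit.
by rewrite eR; apply: h_lead.
Qed.

Lemma weightV j : (j <= (size T).+1)%N ->
  cpow #|F|%:R ((Nmult T f j)%:R * s + (numult K T j)%:R) = (wgt j)^-1.
Proof.
move=> hj; have q0 : (0 : R) < #|F|%:R by rewrite ltr0n ltnW// card_res_gt1.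
have neq0 (d : K) : absK d = 1 -> d <> 0 by move=> /abs1_neq0/eqP.
rewrite (newton_Nmult reg neq0 newton_f)// numultE//.
rewrite cpowD ?gt_eqF// cpow_natM// cpow_nat// /weight /rho !exprVn.
by rewrite cpowV ?exprn_gt0// fmorphV -invfM invrK.
Qed.

(** Since 0 < m the two omitted indices are distinct, so no term is restored twice. *)
Lemma sum_omit (V : zmodType) (x : nat -> V) m (A B : bool) : (0 < m)%N ->
  \sum_(0 <= j < m.+1) x j =
  \sum_(0 <= j < m.+1 | ~~ ((j == 0%N) && A) && ~~ ((j == m) && B)) x j +
  x 0%N *+ A + x m *+ B.
Proof.
case: m => // m _; rewrite [in RHS]big_mkcond /=.
rewrite !(big_nat_recl m.+1)//= !(big_nat_recr m)//= eqxx /=.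
rewrite [in RHS](eq_big_nat _ _ (F2 := fun j => x j.+1)) => [|j /andP[_ jm]]; last first.
  by rewrite eqSS ltn_eqF.
set y := \sum_(0 <= i < m) _.
case: A; case: B; rewrite /= ?mulr0n ?mulr1n ?add0r ?addr0 ?addrA//.
  by rewrite [y + x 0%N]addrC.
by rewrite -addrA addrC.
Qed.

Lemma sum_delta (x : nat -> R[i]) m i (A : bool) : (0 < i <= m)%N ->
  \sum_(1 <= j < m.+1) ((j == i) && A)%:R * x j = x i *+ A.
Proof.
move=> /andP[i0 im]; rewrite (eq_bigr (fun j => if j == i then x j *+ A else 0)) => [|j _].
  by rewrite -big_mkcond big_nat1_eq i0 ltnS im.
by case: eqP => //= _; rewrite ?mul0r// mulr_natl.
Qed.

Lemma toric_partE : toric_part T f alpha beta s =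
  \sum_(0 <= j < (size T).+1) ((1 - rho K) ^+ 2)%:C * (wgt j / (1 - wgt j)) *
    (wgt j.+1 / (1 - wgt j.+1)) +
  \sum_(1 <= j < (size T).+1) (good j)%:R *
    ((#|F|.-1%:R * rho K ^+ 2)%:C * (wgt j / (1 - wgt j))).
Proof.
rewrite /toric_part; set q : R[i] := #|F|%:R; set m := size T.
pose t j := wgt j / (1 - wgt j).
have m0 : (0 < m)%N by have [] := reg.
have q0 : q != 0 by rewrite pnatr_eq0 -lt0n ltnW// card_res_gt1.
have q1 : q - 1 != 0 by rewrite subr_eq0 (eqr_nat _ _ 1) gtn_eqF// card_res_gt1.
have rq : (rho K)%:C = q^-1 by rewrite /rho fmorphV rmorph_nat.
have w0 j : wgt j != 0.
  rewrite mulf_neq0 ?cpow_neq0 ?rhoX_gt0//.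
  by rewrite rmorphXn /= expf_neq0// rq invr_eq0.
(* With w = 1 / Q one has 1 / (Q - 1) = w / (1 - w), and |w| < 1 keeps the denominators nonzero. *)
have tE j : (j <= m.+1)%N ->
    (cpow #|F|%:R ((Nmult T f j)%:R * s + (numult K T j)%:R) - 1)^-1 = t j.
  move=> hj; rewrite weightV// /t; have := weight_neq1 K reg orderN s_gt hj.
  by move: (wgt j) (w0 j) => w wn wn1; rewrite -[w^-1 - 1](mulfK wn) mulrBl mulVf// mul1r invf_div.
have q2 : ((1 - rho K) ^+ 2)%:C = (q - 1) / q ^+ 2 * (q - 1).
  by rewrite rmorphXn rmorphB rmorph1 /= rq; field.
have q3 : (#|F|.-1%:R * rho K ^+ 2)%:C = (q - 1) / q ^+ 2.
  rewrite rmorphM rmorphXn /= rq rmorph_nat -subn1 natrB ?(ltnW (card_res_gt1 K))//.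
  by rewrite exprVn.
pose x j := (q - 1) * (t j * t j.+1).
(* The weight is then q^-1 and w / (1 - w) = 1 / (q - 1), so an extreme cone term (q - 1) t_0 t_1 or
   (q - 1) t_m t_(m+1) collapses to t_1 or t_m. *)
have edge_w j : (j <= m.+1)%N -> orderN j = 0%N -> ((ray T j).1 + (ray T j).2 = 1)%N ->
    (q - 1) * t j = 1.
  move=> hj n0 e1; rewrite /t (_ : wgt j = q^-1).
    by field; rewrite q0 q1.
  by rewrite /weight n0 expr0 cpow1 mul1r e1 expr1.
have -> : \sum_(1 <= j < m.+1) (card_stratum T (map_fps2 (@red R K) f) j)%:R /
      (cpow #|F|%:R ((Nmult T f j)%:R * s + (numult K T j)%:R) - 1) =
    \sum_(1 <= j < m.+1) (good j)%:R * t j + t m *+ (beta == 0%N) + t 1%N *+ (alpha == 0%N).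
  rewrite -(@sum_delta t m m) ?m0 ?leqnn// -(@sum_delta t m 1)// -!big_split /=.
  apply: eq_big_nat => j hj; rewrite tE; last by case/andP: hj => _ /ltnW.
  rewrite (card_stratumE reg (newton_red newton_f))// orderN_last orderN0.
  by rewrite !natrD !mulrDl.
have -> : \sum_(0 <= j < m.+1 | ~~ ((j == 0%N) && (alpha == 0%N)) && ~~ ((j == m) && (beta == 0%N)))
      (q - 1) / ((cpow #|F|%:R ((Nmult T f j)%:R * s + (numult K T j)%:R) - 1) *
        (cpow #|F|%:R ((Nmult T f j.+1)%:R * s + (numult K T j.+1)%:R) - 1)) =
    \sum_(0 <= j < m.+1 | ~~ ((j == 0%N) && (alpha == 0%N)) && ~~ ((j == m) && (beta == 0%N))) x j.
  rewrite big_mkcond [RHS]big_mkcond; apply: eq_big_nat => j /andP[_ hj].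
  case: ifP => // _.
  rewrite /x -(tE j (ltnW hj)) -(tE j.+1 hj).
  congr (_ * _).
  exact: invfM.
have eS := @sum_omit _ x m (alpha == 0%N) (beta == 0%N) m0.
have e0 : x 0%N *+ (alpha == 0%N) = t 1%N *+ (alpha == 0%N).
  case: eqP => // a0; rewrite /x mulrA edge_w ?mul1r//.
  by rewrite orderN0.
have em : x m *+ (beta == 0%N) = t m *+ (beta == 0%N).
  case: eqP => // b0; rewrite /x mulrCA edge_w ?mulr1//.
    by rewrite orderN_last.
  by rewrite ray_last.
rewrite e0 em in eS.
have -> : \sum_(1 <= j < m.+1) (good j)%:R * ((#|F|.-1%:R * rho K ^+ 2)%:C * (wgt j / (1 - wgt j))) =
    (q - 1) / q ^+ 2 * \sum_(1 <= j < m.+1) (good j)%:R * t j.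
  by rewrite mulr_sumr; apply: eq_bigr => j _; rewrite q3 mulrCA.
have -> : \sum_(0 <= j < m.+1) ((1 - rho K) ^+ 2)%:C * (wgt j / (1 - wgt j)) *
    (wgt j.+1 / (1 - wgt j.+1)) = (q - 1) / q ^+ 2 * \sum_(0 <= j < m.+1) x j.
  by rewrite mulr_sumr; apply: eq_bigr => j _; rewrite q2 /x !mulrA.
rewrite eS -mulrDr; congr (_ * _).
move: (\sum_(1 <= j < m.+1) _) (\sum_(0 <= j < m.+1 | _) _) (t m *+ _) (t 1%N *+ _) => u v y z.
by ring.
Qed.
End Decomposition.

Theorem proposition2p5 (R : realType) (K : padicField R)
  (mu : {measure set (borel_plane K) -> \bar R})
  (Kbar : closedFieldType) (iota : {rmorphism K -> Kbar})
  (f : fps2 K) (c : K) (alpha beta k : nat)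
  (r : nat -> nat) (s_ : nat -> nat -> nat) (a b : nat -> nat)
  (A : nat -> nat -> nat -> nat) (xi : nat -> nat -> K)
  (ft : nat -> nat -> nat -> {poly (fps Kbar)})
  (fl h : nat -> nat -> {poly (fps K)})
  (T : seq (nat * nat)) (s : R[i])
  (haar_mu : normalized_haar mu)
  (iota_alg : forall z, algebraicOver iota z)
  (f_int : integral2 f)
  (f_00 : coef2 f 0 0 = 0)
  (f_prod : map_fps2 iota f = monom2 (iota c) alpha beta *
     \prod_(i < k) \prod_(l < r i) \prod_(t < s_ i l) fps_of_poly (ft i l t))
  (c_unit : (OK K `\` MK K) c)
  (ab_ge2 : forall i, (i < k)%N -> [/\ (2 <= a i)%N, (2 <= b i)%N & coprime (a i) (b i)])
  (s_gt0 : forall i l, (i < k)%N -> (l < r i)%N -> (0 < s_ i l)%N)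
  (A_gt0 : forall i l t, (i < k)%N -> (l < r i)%N -> (t < s_ i l)%N -> (0 < A i l t)%N)
  (ft_lead : forall i l t, (i < k)%N -> (l < r i)%N -> (t < s_ i l)%N ->
     higher_terms (a i) (b i) (a i * b i * A i l t)
       (fps_of_poly (ft i l t -
          ('X ^+ a i + (fps_monom (iota (xi i l)) (b i))%:P) ^+ A i l t)))
  (ft_spec : forall i l t, (i < k)%N -> (l < r i)%N -> (t < s_ i l)%N ->
     [/\ ft i l t \is monic, non_smooth (fps_of_poly (ft i l t))
       & irreducible_elt (ft i l t)])
  (xi_unit : forall i l, (i < k)%N -> (l < r i)%N -> (OK K `\` MK K) (xi i l))
  (xi_neq : forall i l l', (i < k)%N -> (l < r i)%N -> (l' < r i)%N -> l <> l' ->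
     xi i l <> xi i l')
  (red_xi_neq : forall i l l', (i < k)%N -> (l < r i)%N -> (l' < r i)%N -> l <> l' ->
     red (xi i l) <> red (xi i l'))
  (fl_prod : forall i l, (i < k)%N -> (l < r i)%N ->
     map_poly (map_fps iota) (fl i l) = \prod_(t < s_ i l) ft i l t)
  (fl_monic : forall i l, (i < k)%N -> (l < r i)%N -> fl i l \is monic)
  (h_tsch : forall i l, (i < k)%N -> (l < r i)%N ->
     tschirnhausen (fl i l) (\sum_(t < s_ i l) A i l t)%N (h i l))
  (P_lt : forall i i', (i < i')%N -> (i' < k)%N -> vlt (a i, b i) (a i', b i'))
  (T_regular : regular_subdivision T)
  (T_admissible : forall i, (i < k)%N -> (a i, b i) \in T)
  (s_gt : 0 < complex.Re s) :
  Zeta0 mu f s = toric_part T f alpha beta s +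
    \sum_(i < k) \sum_(l < r i)
      (let j := (index (a i, b i) T).+1 in
       cintegral mu (MK2 K) (fun w =>
         cpow (absK (in_tschirnhausen (cone T j) (a i * b i) (xi i l) (h i l) f w)) s
         * (absK w.1 ^+ (numult K T j).-1)%:C)).
Proof.
pose S i l := (\sum_(t < s_ i l) A i l t)%N.
have ab_gt0 i : (i < k)%N -> (0 < a i)%N /\ (0 < b i)%N.
  by move=> /ab_ge2[h1 h2 _]; rewrite !(ltn_trans (ltn0Sn 0)).
have S_gt0 i l : (i < k)%N -> (l < r i)%N -> (0 < S i l)%N.
  move=> hi hl; rewrite /S (bigD1 (Ordinal (s_gt0 i l hi hl)))//= addn_gt0.
  by rewrite A_gt0// s_gt0.
have lead i l (hi : (i < k)%N) (hl : (l < r i)%N) :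
    size (fl i l) = (a i * S i l).+1 /\
    wge (a i, b i) (a i * b i * S i l).+1
      (fps_of_poly (fl i l - binom_poly (a i) (b i) (xi i l) ^+ S i l)).
  have [a0 b0] := ab_gt0 i hi.
  apply: (group_lead (iota := iota) (A := A i l) (ft := ft i l) a0 b0).
  - by move=> t ht; apply: A_gt0.
  - by move=> t ht; apply/higher_termsP; apply: ft_lead.
  - by move=> t ht; have [] := ft_spec i l t hi hl ht.
  - exact: fl_monic.
  - exact: fl_prod.
(* The factorization is known over the algebraic closure; it descends because [iota] is injective on
   coefficients. *)
have f_fact : f = monom2 c alpha beta *
    \prod_(i < k) \prod_(l < r i) fps_of_poly (fl i l).
  have e : map_fps2 iota f = map_fps2 iota (monom2 c alpha beta *
      \prod_(i < k) \prod_(l < r i) fps_of_poly (fl i l)).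
    rewrite f_prod map_fps2M map_fps2_monom map_fps2_prod; congr (_ * _).
    apply: eq_bigr => i _; rewrite map_fps2_prod; apply: eq_bigr => l _.
    by rewrite map_fps2_of_poly fl_prod// fps_of_poly_prod.
  apply: fps2P => m n; apply: (fmorph_inj iota).
  by rewrite -!coef2_map e.
have c1 : absK c = 1 by apply/unit_setP.
have xi1 i l : (i < k)%N -> (l < r i)%N -> absK (xi i l) = 1.
  by move=> hi hl; apply/unit_setP; apply: xi_unit.
(* [vlt] is irreflexive, so distinct indices have distinct P_i. *)
have P_inj i i' : (i < k)%N -> (i' < k)%N -> (a i, b i) = (a i', b i') -> i = i'.
  have ne u v : (u < v)%N -> (v < k)%N -> (a u, b u) <> (a v, b v).
    by move=> uv hv e; have := P_lt u v uv hv; rewrite e /vlt /detv; lia.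
  move=> hi hi' e; case: (ltngtP i i') => // lt; first by case: (ne _ _ lt hi').
  by case: (ne _ _ lt hi).
have red_inj i l l' : (i < k)%N -> (l < r i)%N -> (l' < r i)%N ->
    red (xi i l) = red (xi i l') -> l = l'.
  by move=> hi hl hl' e; apply: contrapT => ne; apply: (red_xi_neq i l l').
have h_int i l : (i < k)%N -> (l < r i)%N -> integral2 (fps_of_poly (h i l)).
  by move=> hi hl; have [] := h_tsch i l hi hl.
have h_lead i l : (i < k)%N -> (l < r i)%N -> wge (a i, b i) (a i * b i).+1
    (fps_of_poly (h i l - binom_poly (a i) (b i) (xi i l))).
  move=> hi hl; have [a0 b0] := ab_gt0 i hi; have [sz ld] := lead i l hi hl.
  have [_ mh sh szh] := h_tsch i l hi hl.
  (* The degree of h multiplied by S is a S, and S is positive. *)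
  have {}sh : size (h i l) = (a i).+1.
    rewrite sz /= in sh; have /eqP := sh.
    rewrite eqn_pmul2r; last exact: S_gt0.
    by move=> /eqP <-; rewrite prednK// size_poly_gt0 monic_neq0.
  apply: (tschirnhausen_lead (@pf_char0 R K) a0 (S_gt0 i l hi hl) ld mh sh).
  by move: szh; rewrite sz sh.
rewrite /Zeta0 -/(zeta_fun f s).
rewrite (zeta_formula T_regular f_int f_fact c1 ab_gt0 T_admissible P_inj S_gt0 fl_monic
  (fun i l hi hl => (lead i l hi hl).1) (fun i l hi hl => (lead i l hi hl).2) xi1 red_inj
  haar_mu s_gt h_int h_lead).
rewrite (toric_partE T_regular f_fact c1 ab_gt0 T_admissible fl_monic
  (fun i l hi hl => (lead i l hi hl).1) (fun i l hi hl => (lead i l hi hl).2) xi1 s_gt).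
congr (_ + _); apply: eq_bigr => i _; apply: eq_bigr => l _.
have [/andP[_ eT] eR] := edgeP T_admissible (ltn_ord i).
rewrite -/(edge T a b i); apply: cintegral_ext => w _; rewrite /tschirnhausen_fun eR.
by rewrite numultE ?eR// leqW.
Qed.
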